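(* Let $(C[[\hbar]],1_C,\cdot,\mathbf K)$ be an anomaly-free binary QFT algebra over $\Bbbk$ with classical cohomology $H$ and a fixed classical off-to-on-shell retract $(f,h,s)$. Let $\underline{\boldsymbol\phi}$ and $\underline{\grave{\boldsymbol\pi}}$ be the canonical families constructed in the context, let $\underline\phi=\phi_1,\phi_2,\dots$ be the classical limit of $\underline{\boldsymbol\phi}$, let $\underline\ell=\ell_1,\ell_2,\dots$ be the classical limit of the quantum descendant $\underline{\boldsymbol\ell}$, and let $\underline{\grave m}=\grave m_2,\grave m_3,\dots$ be the on-shell quantum correlation products, i.e. $\grave m_n$ is the coefficient of $(-\hbar)^{n-2}$ in $\grave{\boldsymbol\pi}_n$. Then there is a family $\underline\phi^{-1}=\phi^{-1}_2,\phi^{-1}_3,\dots$ of $\Bbbk$-linear maps $\phi_n^{-1}:S^{n-2}H\otimes S^2H\to C$ of degree $-1$ such that $\grave m_n=h\circ M_n$ for all $n\ge2$, where for homogeneous $v_1,\dots,v_n\in H$ $$\begin{aligned}M_n(v_1,\dots,v_n)=&\sum_{\substack{\mathfrak p\in P(n),\ |\mathfrak p|=2\\ n-1\nsim_{\mathfrak p}n}}\varepsilon(\mathfrak p)\,\phi(v_{B_1})\cdot\phi(v_{B_2})\\&-\sum_{\substack{\mathfrak p\in P(n),\ |B_{|\mathfrak p|}|=n-|\mathfrak p|+1\\ n-1\sim_{\mathfrak p}n,\ |\mathfrak p|\ne1}}\varepsilon(\mathfrak p)\,\phi_{|\mathfrak p|}\big(v_{B_1},\dots,v_{B_{|\mathfrak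 p|-1}},\grave m(v_{B_{|\mathfrak p|}})\big)\\&+\sum_{\substack{\mathfrak p\in P(n)\\ n-1\sim_{\mathfrak p}n,\ |\mathfrak p|\neq1}}\varepsilon(\mathfrak p)\,\ell_{|\mathfrak p|}\big(\phi(Jv_{B_1}),\dots,\phi(Jv_{B_{|\mathfrak p|-1}}),\phi^{-1}(v_{B_{|\mathfrak p|}})\big).\end{aligned}$$
   Context: Conventions. $\Bbbk$ is a field of characteristic zero, $\hbar$ a formal parameter of degree $0$. Spaces are $\mathbb Z$-graded, $|x|$ is the degree, $Jx=(-1)^{|x|}x$. $\mathrm{Hom}(V,W)^j$ is the space of $\Bbbk$-linear maps of degree $j$; $V[[\hbar]]=\bigoplus_jV^j[[\hbar]]$. A series $\mathbf b=b^{(0)}+\hbar b^{(1)}+\cdots\in\mathrm{Hom}(V,W)^j[[\hbar]]$ is identified with the $\Bbbk[[\hbar]]$-linear map $V[[\hbar]]\to W[[\hbar]]$ it determines; $b^{(0)}$ is its classical limit. $S^nV$ is the $n$-th graded-symmetric power. Partitions. $P(n)$ is the set of partitions $\mathfrak p=B_1\sqcup\cdots\sqcup B_{|\mathfrak p|}$ of $\{1,\dots,n\}$ into nonempty blocks, ordered by increasing maximal elements, each block in increasing order; $k\sim_{\mathfrak p}l$ means $k,l$ lie in the same block. For $B=\{j_1<\dots<j_r\}$, $v_B=v_{j_1}\otimes\cdots\otimes v_{j_r}$, $Jv_B$ means $J$ applied to every entry, $\beta(v_B)=\beta_r(v_{j_1},\dots,v_{j_r})$ for a family $\underline\beta$.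 The Koszul sign $\varepsilon(\mathfrak p)$ is defined by $v_1\odot\cdots\odot v_n=\varepsilon(\mathfrak p)v_{B_1}\odot\cdots\odot v_{B_{|\mathfrak p|}}$. A sum over ''$\mathfrak p\in P(n)$, $|B_i|=n-|\mathfrak p|+1$'' runs over pairs $(\mathfrak p,i)$. For a map $\phi_n^{-1}$ on $S^{n-2}H\otimes S^2H$, $\phi^{-1}_n(v_1,\dots,v_n)$ is its value on $(v_1\odot\cdots\odot v_{n-2})\otimes(v_{n-1}\odot v_n)$. Binary QFT algebra. A tuple $(C[[\hbar]],1_C,\cdot,\mathbf K)$ where $(C,1_C,\cdot)$ is a unital graded-commutative associative $\Bbbk$-algebra (product extended to $C[[\hbar]]$), $\mathbf K=K^{(0)}+\hbar K^{(1)}+\cdots\in\mathrm{Hom}(C,C)^1[[\hbar]]$, $\mathbf K1_C=0$, $\mathbf K\circ\mathbf K=0$, $1_C\neq K^{(0)}x$ for all $x\in C$, such that the family $\underline{\boldsymbol\ell}=\boldsymbol\ell_1,\boldsymbol\ell_2,\dots$ (the quantum descendant) determined recursively by $\mathbf K(x_1\cdots x_n)=\sum_{\mathfrak p\in P(n),|B_i|=n-|\mathfrak p|+1}(-\hbar)^{n-|\mathfrak p|}\varepsilon(\mathfrak p)Jx_{B_1}\cdots Jx_{B_{i-1}}\cdot\boldsymbol\ell(x_{B_i})\cdot x_{B_{i+1}}\cdots x_{B_{|\mathfrak p|}}$ satisfies $\boldsymbol\ell_n\in\mathrm{Hom}(S^nC,C)^1[[\hbar]]$ for all $n\ge1$.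 Anomaly-free. Let $K=K^{(0)}$, $H$ the cohomology of $(C,K)$ (classical cohomology), $1_H$ the class of $1_C$. A classical off-to-on-shell retract is a triple $(f,h,s)$: $f\in\mathrm{Hom}(H,C)^0$, $h\in\mathrm{Hom}(C,H)^0$, $s\in\mathrm{Hom}(C,C)^{-1}$ with $f(1_H)=1_C$, $Kf=0$, $f$ inducing the identity on cohomology, $h(1_C)=1_H$, $hK=0$, $hf=\mathrm{id}_H$, $fh=\mathrm{id}_C-Ks-sK$, $K=KsK$, $s(1_C)=0$, $ss=sf=hs=0$. Put $f^{(0)}=f$ and, for $n\ge1$, $g^{(n)}=\sum_{j=0}^{n-1}K^{(n-j)}f^{(j)}-\sum_{j=1}^{n-1}f^{(n-j)}\kappa^{(j)}$, $\kappa^{(n)}=hg^{(n)}$, $f^{(n)}=-sg^{(n)}$; $\boldsymbol\kappa=\sum_{n\ge1}\hbar^n\kappa^{(n)}$, $\mathbf f=\sum_{n\ge0}\hbar^nf^{(n)}$. The algebra is anomaly-free if $\boldsymbol\kappa=0$ (independent of the choice of retract); then $\mathbf K\circ\mathbf f=0$. Canonical families. For $\boldsymbol\Omega\in\mathrm{Hom}(S^nH,C)^0[[\hbar]]$ with classical limit $\Omega$, define $\nabla\boldsymbol\Omega$ by $(-\hbar)\nabla\boldsymbol\Omega=\boldsymbol\Omega-\mathbf f\circ h\circ\Omega-\mathbf K\circ s\circ\Omega-s\circ K\circ\Omega$ (the right side is divisible by $\hbar$). Set $\boldsymbol\phi_1=\mathbf f$, $\grave{\boldsymbol\pi}_1=\mathrm{id}_H$,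 and recursively for $n\ge2$: $\boldsymbol\Omega_n(v_1,\dots,v_n)=\sum_{\mathfrak p\in P(n),|\mathfrak p|\ne1}(-\hbar)^{n-|\mathfrak p|}\varepsilon(\mathfrak p)\boldsymbol\phi(v_{B_1})\cdots\boldsymbol\phi(v_{B_{|\mathfrak p|}})$, $\boldsymbol\Omega_n^{[i]}=\nabla^i\boldsymbol\Omega_n$ with classical limit $\Omega_n^{[i]}$, and $\boldsymbol\phi_n=-\boldsymbol\Omega_n^{[n-1]}$, $\grave{\boldsymbol\pi}_n=\sum_{i=0}^{n-2}(-\hbar)^i\,h\circ\Omega_n^{[i]}$. Thus $\grave m_n=h\circ\Omega_n^{[n-2]}$. *)

(* Defs.v *)
From HB Require Import structures.
From mathcomp Require Import all_boot all_order all_algebra.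
From mathcomp Require Import zify.
From mathcomp Require Import boolp.

Set Implicit Arguments.
Unset Strict Implicit.
Unset Printing Implicit Defensive.

Import Order.TTheory GRing.Theory Num.Theory.
Local Open Scope ring_scope.

Definition parity (k : fieldType) (i : int) : k := (-1) ^+ absz i.
Arguments parity {k} i.

(* A Z-graded space V = (+)_j V^j, given by its total space together with the
   subspaces [homog j] of homogeneous elements of degree [j].  The last two
   axioms say that the total space is the direct sum of these subspaces. *)
HB.mixin Record Lmodule_isGraded (k : fieldType) V of GRing.Lmodule k V := {
  homog : int -> V -> Prop;
  homog0 : forall i, homog i 0;
  homogP : forall i (a : k) (x y : V),
    homog i x -> homog i y -> homog i (a *: x + y);
  homog_span : forall x : V, exists (r : seq int) (u : int -> V),
    uniq r /\ (forall i, homog i (u i)) /\ x = \sum_(i <- r) u i;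
  homog_free : forall (r : seq int) (u : int -> V), uniq r ->
    (forall i, homog i (u i)) -> \sum_(i <- r) u i = 0 ->
    forall i, i \in r -> u i = 0
}.

#[short(type="gradedLmodType")]
HB.structure Definition GradedLmodule (k : fieldType) :=
  {V of Lmodule_isGraded k V & GRing.Lmodule k V}.

Arguments homog {k} {s} _ _ : rename.

(* [algType k] also asks for 1 <> 0; in a binary QFT algebra this follows from
   the requirement that 1 is not in the image of the classical differential. *)
HB.mixin Record GradedAlgebra_isCommutative (k : fieldType) C
  of GRing.Algebra k C & GradedLmodule k C := {
  homog1 : homog 0 (1 : C);
  homogM : forall i j (x y : C),
    homog i x -> homog j y -> homog (i + j) (x * y);
  gmulC : forall i j (x y : C), homog i x -> homog j y ->
    x * y = parity (i * j) *: (y * x)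
}.

#[short(type="gradedComAlgType")]
HB.structure Definition GradedComAlgebra (k : fieldType) :=
  {C of GradedAlgebra_isCommutative k C & GRing.Algebra k C
      & GradedLmodule k C}.

Definition degree (k : fieldType) (V W : gradedLmodType k) (j : int)
    (b : V -> W) :=
  forall i x, homog i x -> homog (i + j) (b x).

Record complex (k : fieldType) := Complex {
  cx_car :> gradedLmodType k;
  cx_d : {linear cx_car -> cx_car};
  cx_degree : degree 1 cx_d;
  cx_dd : forall x, cx_d (cx_d x) = 0
}.

Section Cohomology.
Variables (k : fieldType) (X : complex k).

Definition is_cocycle : {pred X} := fun x => cx_d X x == 0.

Lemma is_cocycle_submod : submod_closed is_cocycle.
Proof.
split=> [|a x y]; rewrite !unfold_in ?linear0 //.
by move=> /eqP x0 /eqP y0; rewrite linearP x0 y0 scaler0 addr0.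
Qed.
HB.instance Definition _ :=
  GRing.isSubmodClosed.Build k X is_cocycle is_cocycle_submod.

Record cocycle := Cocycle {coval : X; _ : coval \in is_cocycle}.
HB.instance Definition _ := [isSub for coval].
HB.instance Definition _ := [Choice of cocycle by <:].
HB.instance Definition _ := [SubChoice_isSubLmodule of cocycle by <:].

Definition is_coboundary : {pred cocycle} :=
  fun z => `[< exists y, coval z = cx_d X y >].

Lemma coval_linear a (x y : cocycle) :
  coval (a *: x + y) = a *: coval x + coval y.
Proof. by rewrite -[LHS]/(val (a *: x + y)) linearP. Qed.

Lemma covalZ a (x : cocycle) : coval (a *: x) = a *: coval x.
Proof. by rewrite -[LHS]/(val (a *: x)) linearZ. Qed.

Lemma covalB (x y : cocycle) : coval (x - y) = coval x - coval y.
Proof. by rewrite -[LHS]/(val (x - y)) linearB. Qed.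

Lemma is_coboundary_zmod : zmod_closed is_coboundary.
Proof.
split=> [|x y].
  by rewrite unfold_in; apply/asboolP; exists 0; rewrite linear0.
rewrite !unfold_in => /asboolP[u Eu] /asboolP[v Ev].
by apply/asboolP; exists (u - v); rewrite covalB linearB Eu Ev.
Qed.
HB.instance Definition _ :=
  GRing.isZmodClosed.Build cocycle is_coboundary is_coboundary_zmod.

Definition cohomology : Type := {ideal_quot is_coboundary}.
HB.instance Definition _ := GRing.Zmodule.on cohomology.

Definition cocycle_class (z : cocycle) : cohomology :=
  \pi_{ideal_quot is_coboundary}%qT z.

Lemma cocycle_classP x y :
  cocycle_class x = cocycle_class y <->
  exists u, coval x - coval y = cx_d X u.
Proof.
rewrite /cocycle_class; split=> [/eqP|[u Eu]].
  by rewrite -Quotient.idealrBE => /asboolP[u]; rewrite covalB; exists u.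
by apply/eqP; rewrite -Quotient.idealrBE; apply/asboolP; exists u; rewrite covalB.
Qed.

Lemma cocycle_class_surj c : exists z, cocycle_class z = c.
Proof. by exists (repr c); rewrite /cocycle_class reprK. Qed.

Definition coscale (a : k) (c : cohomology) : cohomology :=
  cocycle_class (a *: repr c).

Lemma coscaleE a z : coscale a (cocycle_class z) = cocycle_class (a *: z).
Proof.
have /cocycle_classP[u Eu] : cocycle_class (repr (cocycle_class z))
    = cocycle_class z by rewrite /cocycle_class reprK.
apply/cocycle_classP; exists (a *: u).
have -> : cx_d X (a *: u) = a *: cx_d X u by exact: linearZ.
by rewrite -Eu scalerBr -!covalZ.
Qed.

Lemma coscaleA a b c : coscale a (coscale b c) = coscale (a * b) c.
Proof.
by have [z <-] := cocycle_class_surj c; rewrite !coscaleE scalerA.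
Qed.

Lemma coscale1 : left_id 1 coscale.
Proof. by move=> c; have [z <-] := cocycle_class_surj c; rewrite coscaleE scale1r. Qed.

Lemma cocycle_classD x y :
  cocycle_class (x + y) = cocycle_class x + cocycle_class y.
Proof. by rewrite /cocycle_class; rewrite !piE. Qed.

Lemma coscaleDr : right_distributive coscale +%R.
Proof.
move=> a c d; have [x <-] := cocycle_class_surj c.
have [y <-] := cocycle_class_surj d.
by rewrite -cocycle_classD !coscaleE scalerDr cocycle_classD.
Qed.

Lemma coscaleDl c : {morph coscale^~ c : a b / a + b}.
Proof.
move=> a b; have [x <-] := cocycle_class_surj c.
by rewrite !coscaleE scalerDl cocycle_classD.
Qed.

HB.instance Definition _ := GRing.Zmodule_isLmodule.Build k cohomology
  coscaleA coscale1 coscaleDr coscaleDl.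

Lemma cocycle_class_is_linear : linear cocycle_class.
Proof. by move=> a x y; rewrite cocycle_classD -coscaleE. Qed.
HB.instance Definition _ := GRing.isLinear.Build k cocycle cohomology *:%R
  cocycle_class cocycle_class_is_linear.

Definition cohomog (i : int) (c : cohomology) : Prop :=
  exists z, homog i (coval z) /\ cocycle_class z = c.

Lemma coval_sum (r : seq int) (z : int -> cocycle) :
  coval (\sum_(i <- r) z i) = \sum_(i <- r) coval (z i).
Proof. by rewrite -[LHS]/(val _) raddf_sum. Qed.

Lemma cocycle_class0 : cocycle_class 0 = 0.
Proof. exact: linear0. Qed.

Lemma cohomog0 i : cohomog i 0.
Proof.
exists 0; split; last exact: cocycle_class0.
by rewrite -[coval 0]/(val 0) linear0; apply: homog0.
Qed.

Lemma cohomogP i (a : k) (x y : cohomology) :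
  cohomog i x -> cohomog i y -> cohomog i (a *: x + y).
Proof.
move=> [u [hu <-]] [v [hv <-]]; exists (a *: u + v); split.
  by rewrite coval_linear; apply: homogP.
by rewrite linearP.
Qed.

Lemma sum_subset (V : zmodType) (R r : seq int) (F : int -> V) :
  uniq R -> uniq r -> {subset r <= R} ->
  \sum_(i <- R | i \in r) F i = \sum_(i <- r) F i.
Proof.
move=> uR ur rR; rewrite -big_filter; apply: perm_big.
apply: uniq_perm => // [|i]; first exact: filter_uniq.
by rewrite mem_filter; case: (boolP (i \in r)) => // /rR.
Qed.

Lemma cohomog_span (c : cohomology) : exists (r : seq int) u,
  uniq r /\ (forall i, cohomog i (u i)) /\ c = \sum_(i <- r) u i.
Proof.
have [z <-] := cocycle_class_surj c.
have [r [u [ur [hu Eu]]]] := homog_span (coval z).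
have Ku i : i \in r -> cx_d X (u i) = 0.
  move=> ir; rewrite -[i in LHS](addrK 1).
  apply: (@homog_free _ _ [seq j + 1 | j <- r]
                      (fun j => cx_d X (u (j - 1))) _ _ _ (i + 1)).
  - by rewrite map_inj_uniq // => x y /addIr.
  - by move=> j; rewrite -{1}[j](subrK 1); apply: cx_degree.
  - rewrite big_map -[RHS](_ : cx_d X (coval z) = 0).
      by rewrite Eu linear_sum; apply: eq_bigr => j _; rewrite addrK.
    by apply/eqP; case: (z).
  - by apply/mapP; exists i.
have hz i : exists z', homog i (coval z') /\ (i \in r -> coval z' = u i).
  case: (boolP (i \in r)) => [ir|_].
    have Hi : u i \in is_cocycle by rewrite unfold_in Ku.
    by exists (Cocycle Hi).
  exists 0; split=> //; rewrite -[coval 0]/(val 0) linear0; apply: homog0.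
have [w hw] := choice hz.
exists r, (fun i => cocycle_class (w i)); split=> //; split.
  by move=> i; exists (w i); split=> //; case: (hw i).
rewrite -linear_sum /=; congr cocycle_class; apply: val_inj.
rewrite -[LHS]/(coval z) -[RHS]/(coval _) coval_sum Eu.
by apply: eq_big_seq => i ir; case: (hw i) => _ ->.
Qed.

Lemma cohomog_free (r : seq int) (u : int -> cohomology) : uniq r ->
  (forall i, cohomog i (u i)) -> \sum_(i <- r) u i = 0 ->
  forall i, i \in r -> u i = 0.
Proof.
move=> ur /choice[z hz] su i ir.
have {su} : cocycle_class (\sum_(i <- r) z i) = cocycle_class 0.
  rewrite cocycle_class0 -su linear_sum; apply: eq_bigr => j _.
  by case: (hz j).
move=> /cocycle_classP[y]; rewrite -covalB subr0 coval_sum.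
have [r' [v [ur' [hv ->]]]] := homog_span y.
move=> Ez.
pose Z j := if j \in r then coval (z j) else 0.
pose Y j := if j - 1 \in r' then cx_d X (v (j - 1)) else 0.
have : Z i - Y i = 0.
  apply: (@homog_free _ _ (undup (r ++ [seq j + 1 | j <- r']))
                      (fun j => Z j - Y j)).
  - exact: undup_uniq.
  - move=> j; rewrite -scaleN1r addrC; apply: homogP.
      rewrite /Y; case: ifP => _; last exact: homog0.
      by rewrite -{1}[j](subrK 1); apply: cx_degree.
    by rewrite /Z; case: ifP => _; [case: (hz j)|apply: homog0].
  - rewrite big_split /= sumrN -!big_mkcond /=.
    rewrite sum_subset ?undup_uniq //; last first.
      by move=> j jr; rewrite mem_undup mem_cat jr.
    have eqS j : (j - 1 \in r') = (j \in [seq j + 1 | j <- r']).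
      by rewrite -(mem_map (@addIr _ (1 : int))) /= subrK.
    rewrite Ez linear_sum (eq_bigl _ _ eqS).
    rewrite sum_subset ?undup_uniq //.
    + by rewrite big_map; apply/eqP; rewrite subr_eq0; apply/eqP;
         apply: eq_bigr => j _; rewrite addrK.
    + by rewrite map_inj_uniq // => a b /addIr.
    + by move=> j jr; rewrite mem_undup mem_cat jr orbT.
  - by rewrite mem_undup mem_cat ir.
rewrite {1}/Z ir => /eqP; rewrite subr_eq0 => /eqP Ezi.
case: (hz i) => _ <-; rewrite -cocycle_class0; apply/cocycle_classP.
rewrite -covalB subr0 Ezi /Y; case: ifP => _; first by exists (v (i - 1)).
by exists 0; rewrite linear0.
Qed.

HB.instance Definition _ := Lmodule_isGraded.Build k cohomology
  cohomog0 cohomogP cohomog_span cohomog_free.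
End Cohomology.

(* A vector together with a degree it is homogeneous of.  Formulas with Koszul
   signs are evaluated on sequences of such vectors. *)
Definition hvec (k : fieldType) (V : gradedLmodType k) := (int * V)%type.

Section HomogeneousVectors.
Variables (k : fieldType) (V : gradedLmodType k).
Implicit Types (x : seq (hvec V)) (s b : seq nat).

Definition homogs x := forall y, y \in x -> homog y.1 y.2.

Definition vects x : seq V := [seq y.2 | y <- x].

Definition deg x : int := \sum_(y <- x) y.1.

(* The entries of [x] at the positions listed in [s], i.e. v_B for a block. *)
Definition subv x s : seq (hvec V) := [seq nth (0, 0) x j | j <- s].

Definition Jv (y : hvec V) : hvec V := (y.1, parity y.1 *: y.2).

(* The Koszul sign of the rearrangement v_{s_0}, v_{s_1}, ...: one factor
   (-1)^{|v_a||v_b|} for each inversion of [s] (see [ksignP]). *)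
Fixpoint ksign x s : k :=
  if s is a :: s' then
    \prod_(b <- s' | (b < a)%N)
       parity ((nth (0, 0) x a).1 * (nth (0, 0) x b).1) * ksign x s'
  else 1.

End HomogeneousVectors.

Section MultilinearMaps.
Variables (k : fieldType) (V W : gradedLmodType k).
Variables (n : nat) (j : int) (beta : seq V -> W).

(* A map of n variables is a function on sequences, of which only the values
   on sequences of length [n] matter. *)
Definition multilinear := forall (s1 s2 : seq V) (a : k) (u v : V),
  (size s1 + size s2).+1 = n ->
  beta (s1 ++ (a *: u + v) :: s2)
    = a *: beta (s1 ++ u :: s2) + beta (s1 ++ v :: s2).

Definition mdegree := forall x : seq (hvec V), size x = n -> homogs x ->
  homog (deg x + j) (beta (vects x)).

(* Graded symmetry in the variables at positions [i] and [i.+1], from 0. *)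
Definition gsym_at (i : nat) := forall (s1 s2 : seq V) (y z : hvec V),
  size s1 = i -> (size s1 + size s2).+2 = n ->
  homog y.1 y.2 -> homog z.1 z.2 ->
  beta (s1 ++ y.2 :: z.2 :: s2)
    = parity (y.1 * z.1) *: beta (s1 ++ z.2 :: y.2 :: s2).

(* beta \in Hom(S^n V, W)^j *)
Definition SHom :=
  [/\ multilinear, mdegree & forall i, (i.+1 < n)%N -> gsym_at i].

(* beta \in Hom(S^(n-2) V (x) S^2 V, W)^j, for n >= 2: no symmetry is required
   between the last variable of the first factor and the first variable of
   the second one. *)
Definition S2Hom :=
  [/\ multilinear, mdegree &
      forall i, (i.+1 < n)%N -> i.+1 != (n - 2)%N -> gsym_at i].

End MultilinearMaps.

Lemma ksignP (k : fieldType) (V W : gradedLmodType k) (j : int)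
    (beta : seq V -> W) (x : seq (hvec V)) (t : seq nat) :
  SHom (size x) j beta -> homogs x -> perm_eq t (iota 0 (size x)) ->
  beta (vects x) = ksign x t *: beta (vects (subv x t)).
Proof.
case=> _ _ symb hx.
pose d i := (nth (0, 0) x i).1; pose v i := (nth (0, 0) x i).2.
have vE t' : vects (subv x t') = map v t' by rewrite /vects -map_comp.
have move1 p l1 a l2 : all (fun i => (i < size x)%N) (a :: l1) ->
    (size p + size l1 + size l2).+1 = size x ->
    beta (p ++ map v l1 ++ v a :: l2)
      = (\prod_(b <- l1) parity (d a * d b)) *: beta (p ++ v a :: map v l1 ++ l2).
  elim: l1 p => [|b l1 IH] p; first by rewrite big_nil scale1r.
  move=> /= /and3P[ax bx lx] sz; rewrite big_cons -scalerA.
  rewrite -cat_rcons IH /= ?ax ?lx //; last by rewrite -sz size_rcons; lia.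
  have ha i : (i < size x)%N -> homog (d i) (v i).
    by move=> ix; apply: hx; apply: mem_nth.
  rewrite cat_rcons (symb (size p) _ p _ (d b, v b) (d a, v a)) //=.
  - by rewrite !scalerA mulrC [d b * _]mulrC.
  - by rewrite -sz; lia.
  - by rewrite -sz size_cat size_map; lia.
  - exact: ha.
  - exact: ha.
have main t' : forall p u, uniq t' -> all (fun i => (i < size x)%N) t' ->
    sorted ltn u -> perm_eq t' u -> (size p + size t')%N = size x ->
    beta (p ++ map v u) = ksign x t' *: beta (p ++ map v t').
  elim: t' => [|a t' IH] p u.
    by move=> _ _ _ /perm_size/esym/size0nil-> _; rewrite scale1r.
  move=> /= /andP[at' ut'] /andP[ax tx] su tu sz.
  have uu : uniq u by rewrite -(perm_uniq tu) /= at'.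
  have au : a \in u by rewrite -(perm_mem tu) mem_head.
  case/splitPr: au su tu uu => u1 u2 su tu uu.
  have tu' : perm_eq t' (u1 ++ u2).
    by rewrite -(perm_cons a) (permPl tu) perm_catC /= perm_cons perm_catC.
  have u1t : {subset u1 <= t'}.
    by move=> i iu; rewrite (perm_mem tu') mem_cat iu.
  have u1x : all (fun i => (i < size x)%N) u1.
    by apply/allP => i /u1t it; apply: (allP tx).
  rewrite map_cat /= move1 /= ?ax ?u1x //; last first.
    by rewrite -sz (perm_size tu') size_cat size_map addnS addnA.
  rewrite -map_cat -cat_rcons (IH (rcons p (v a)) (u1 ++ u2)) //; last first.
  - by rewrite size_rcons -sz addSnnS.
  - move: su; rewrite !(sorted_pairwise ltn_trans) !pairwise_cat.
    by rewrite /= allrel_consr => /and3P[/andP[_ ->] -> /andP[_ ->]].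
  rewrite cat_rcons scalerA; congr (_ * _ *: _).
  rewrite -[RHS]big_filter; apply: perm_big.
  have -> : u1 = [seq b <- u1 ++ u2 | (b < a)%N].
    move: su; rewrite (sorted_pairwise ltn_trans) pairwise_cat /=.
    rewrite allrel_consr => /and3P[/andP[/allP lt1 _] _ /andP[/allP lt2 _]].
    rewrite filter_cat [X in _ ++ X](_ : _ = [::]) ?cats0.
      by apply/esym/all_filterP/allP => i /lt1.
    apply/eqP; rewrite -(negbK (_ == _)) -has_filter; apply/hasPn => i /lt2.
    by rewrite /= -leqNgt => /ltnW.
  by apply: perm_filter; rewrite perm_sym.
move=> tx; rewrite -[x in LHS](mkseq_nth (0, 0)) vE -/(subv x _) vE.
apply: (main t [::]).
- by rewrite (perm_uniq tx) iota_uniq.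
- by apply/allP => i; rewrite (perm_mem tx) mem_iota.
- exact: iota_ltn_sorted.
- exact: tx.
- by rewrite (perm_size tx) size_iota.
Qed.

Section Partitions.
Variable n : nat.

Definition parts : {set {set {set 'I_n}}} :=
  [set P | partition P [set: 'I_n]].

(* The blocks of a partition, each one listed in increasing order, ordered by
   increasing maximal (hence last) elements. *)
Definition blocks (P : {set {set 'I_n}}) : seq (seq nat) :=
  sort (fun b c => (last 0 b <= last 0 c)%N)
       [seq [seq val i | i <- enum (B : {set 'I_n})] | B <- enum P].

Definition same_block (P : {set {set 'I_n}}) (i j : nat) : bool :=
  has (fun b => (i \in b) && (j \in b)) (blocks P).

(* n-1 ~ n in the numbering {1, ..., n} *)
Definition last_two_together (P : {set {set 'I_n}}) : bool :=
  same_block P (n - 2)%N (n - 1)%N.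

Lemma size_block P b : P \in parts -> #|P| != 1%N -> b \in blocks P ->
  (size b < n)%N.
Proof.
rewrite inE mem_sort => partP P1 /mapP[B]; rewrite mem_enum => BP ->.
rewrite size_map -cardE.
suff : (#|B| < #|[set: 'I_n]|)%N by rewrite cardsT card_ord.
apply: proper_card.
rewrite properT; apply: contra_neq P1 => BT; apply/eqP.
case/and3P: partP => _ /trivIsetP tiP P0; apply/cards1P; exists B.
apply/setP => D; rewrite inE; apply/idP/eqP => [DP|-> //].
apply/eqP; apply: contraT => neDB.
have := tiP _ _ DP BP neDB; rewrite BT disjoints_subset setCT subset0.
by move=> /eqP D0; rewrite -D0 DP in P0.
Qed.

End Partitions.
Arguments parts n : clear implicits.

Definition epsilon (k : fieldType) (V : gradedLmodType k) n
    (x : seq (hvec V)) (P : {set {set 'I_n}}) : k :=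
  ksign x (flatten (blocks P)).

(* The series sum_m hbar^m a_m is the sequence of its coefficients. *)
Definition ser (V : Type) := nat -> V.

Section Series.
Variables (k : fieldType) (V : lmodType k) (C : algType k).

Definition cst (v : V) : ser V := fun m => if m == 0%N then v else 0.

(* (- hbar)^e a *)
Definition mulNh (e : nat) (a : ser V) : ser V :=
  fun m => if (m < e)%N then 0 else (-1) ^+ e *: a (m - e)%N.

Definition sermul (a b : ser C) : ser C :=
  fun m => \sum_(i < m.+1) a i * b (m - i)%N.

Definition serone : ser C := fun m => if m == 0%N then 1 else 0.

Definition serprod (s : seq (ser C)) : ser C := foldr sermul serone s.

End Series.

Section Descendant.
Variables (k : fieldType) (C : gradedComAlgType k).

(* [ell n m] is the coefficient of hbar^m in the n-th map of the family. *)
Definition descendant_rhs (ell : nat -> ser (seq C -> C))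
    (x : seq (hvec C)) : ser C :=
  let n := size x in fun m =>
  \sum_(P in parts n)
    let bs := blocks P in
    \sum_(i < #|P| | size (nth [::] bs i) == (n - #|P| + 1)%N)
      let B := nth [::] bs i in
      mulNh (n - #|P|) (fun m' => epsilon x P *:
        (\prod_(y <- flatten [seq map (@Jv k C) (subv x b) | b <- take i bs])
            y.2
         * ell (size B) m' (vects (subv x B))
         * \prod_(y <- flatten [seq subv x b | b <- drop i.+1 bs]) y.2)) m.

End Descendant.

(* The quantum descendant is uniquely determined by [bqa_descendant], because
   the partition with one block contributes (- hbar)^(n-1) ell_n(x_1,...,x_n);
   it is kept as a field, [bqa_SHom] being the condition that it be a family
   of power series of symmetric maps. *)
Record binary_QFT_algebra (k : fieldType) := BinaryQFTAlgebra {
  bqa_car :> gradedComAlgType k;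
  bqa_K : ser {linear bqa_car -> bqa_car};
  bqa_ell : nat -> ser (seq bqa_car -> bqa_car);
  bqa_degree : forall m, degree 1 (bqa_K m);
  bqa_K1 : forall m, bqa_K m 1 = 0;
  bqa_KK : forall m x, \sum_(i < m.+1) bqa_K i (bqa_K (m - i)%N x) = 0;
  bqa_one : forall x, 1 <> bqa_K 0%N x;
  bqa_descendant : forall x : seq (hvec bqa_car),
    (0 < size x)%N -> homogs x -> forall m,
    bqa_K m (\prod_(y <- x) y.2) = descendant_rhs bqa_ell x m;
  bqa_SHom : forall n m, (0 < n)%N -> SHom n 1 (bqa_ell n m)
}.

Arguments bqa_ell {k} A n _ _ : rename.

Section Classical.
Variables (k : fieldType) (A : binary_QFT_algebra k).

Lemma bqa_K0K0 x : bqa_K A 0%N (bqa_K A 0%N x) = 0.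
Proof. by have := bqa_KK 0%N x; rewrite big_ord1. Qed.

Definition classical_complex : complex k :=
  Complex (@bqa_degree k A 0%N) bqa_K0K0.

Definition classical_cohomology : gradedLmodType k :=
  cohomology classical_complex.

Lemma one_cocycle : (1 : A) \in is_cocycle (X := classical_complex).
Proof. by rewrite unfold_in /= bqa_K1. Qed.

Definition one_class : classical_cohomology :=
  cocycle_class (@Cocycle k classical_complex 1 one_cocycle).

End Classical.

Record retract (k : fieldType) (A : binary_QFT_algebra k) := Retract {
  rt_f : {linear classical_cohomology A -> A};
  rt_h : {linear A -> classical_cohomology A};
  rt_s : {linear A -> A};
  rt_f_degree : degree 0 rt_f;
  rt_h_degree : degree 0 rt_h;
  rt_s_degree : degree (-1) rt_s;
  rt_f1 : rt_f (one_class A) = 1;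
  rt_Kf : forall v, bqa_K A 0%N (rt_f v) = 0;
  rt_f_class : forall v, exists z : cocycle (classical_complex A),
    coval z = rt_f v /\ cocycle_class z = v;
  rt_h1 : rt_h 1 = one_class A;
  rt_hK : forall x, rt_h (bqa_K A 0%N x) = 0;
  rt_hf : forall v, rt_h (rt_f v) = v;
  rt_fh : forall x,
    rt_f (rt_h x) = x - bqa_K A 0%N (rt_s x) - rt_s (bqa_K A 0%N x);
  rt_KsK : forall x, bqa_K A 0%N x = bqa_K A 0%N (rt_s (bqa_K A 0%N x));
  rt_s1 : rt_s 1 = 0;
  rt_ss : forall x, rt_s (rt_s x) = 0;
  rt_sf : forall v, rt_s (rt_f v) = 0;
  rt_hs : forall x, rt_h (rt_s x) = 0
}.

(* Course-of-values recursion: [crec n = step n F] for any [F] that agrees with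
   [crec] below [n], provided [step n F] only depends on [F] below [n]. *)
Section CourseOfValues.
Variables (T : Type) (t0 : T) (step : nat -> (nat -> T) -> T).

Fixpoint crec_hist (n : nat) : seq T :=
  if n is m.+1 then rcons (crec_hist m) (step m (nth t0 (crec_hist m)))
  else [::].

Definition crec (n : nat) : T := nth t0 (crec_hist n.+1) n.

Lemma size_crec_hist n : size (crec_hist n) = n.
Proof. by elim: n => //= n IHn; rewrite size_rcons IHn. Qed.

Lemma nth_crec_hist n i : (i < n)%N -> nth t0 (crec_hist n) i = crec i.
Proof.
elim: n => // n IHn; rewrite ltnS leq_eqVlt => /orP[/eqP-> //|lt_in].
by rewrite /= nth_rcons size_crec_hist lt_in IHn.
Qed.

Lemma crecE n :
  (forall F G, (forall i, (i < n)%N -> F i = G i) -> step n F = step n G) ->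
  crec n = step n crec.
Proof.
move=> ext; rewrite {1}/crec /= nth_rcons size_crec_hist ltnn eqxx.
by apply: ext => i; apply: nth_crec_hist.
Qed.

End CourseOfValues.

Section CanonicalFamilies.
Variables (k : fieldType) (A : binary_QFT_algebra k) (R : retract A).
Let H := classical_cohomology A.
Let K := bqa_K A.
Let f := rt_f R.
Let h := rt_h R.
Let s := rt_s R.

Definition anomaly_g (fk : nat -> (H -> A) * (H -> H)) (n : nat) (v : H) : A :=
  \sum_(0 <= j < n) K (n - j)%N ((fk j).1 v)
  - \sum_(1 <= j < n) (fk (n - j)%N).1 ((fk j).2 v).

(* The pairs (f^(n), kappa^(n)), with the convention kappa^(0) = 0. *)
Definition anomaly_step (n : nat) (fk : nat -> (H -> A) * (H -> H)) :
    (H -> A) * (H -> H) :=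
  if n == 0%N then (f : H -> A, fun=> 0)
  else (fun v => - s (anomaly_g fk n v), fun v => h (anomaly_g fk n v)).

Definition fkappa : nat -> (H -> A) * (H -> H) :=
  crec (fun=> 0, fun=> 0) anomaly_step.

Definition fser : ser (H -> A) := fun n => (fkappa n).1.
Definition kappa : ser (H -> H) := fun n => (fkappa n).2.

Lemma fkappaE n : fkappa n = anomaly_step n fkappa.
Proof.
apply: crecE => F G FG; rewrite /anomaly_step; case: (posnP n) => // n0.
have gFG v : anomaly_g F n v = anomaly_g G n v.
  congr (_ - _); first by apply: eq_big_nat => i /andP[_ /FG->].
  apply: eq_big_nat => i /andP[i0 lt_in]; rewrite !FG //.
  by rewrite ltn_subrL i0.
by congr pair; apply/funext => v; rewrite gFG.
Qed.

Definition anomaly_free := forall n v, (0 < n)%N -> kappa n v = 0.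

(* Omega - f h Omega^(0) - K s Omega^(0) - s K Omega^(0), evaluated at some
   arguments of Omega; here f and K are the full series. *)
Definition nabla_rhs (a : ser A) : ser A := fun m =>
  a m - fser m (h (a 0%N)) - K m (s (a 0%N)) - cst (s (K 0%N (a 0%N))) m.

Lemma nabla_rhs0 a : nabla_rhs a 0%N = 0.
Proof.
rewrite /nabla_rhs /fser fkappaE /= /cst /= rt_fh /K /s.
set a0 := a 0%N; set u := bqa_K _ _ _; set w := rt_s _ _.
by rewrite -(addrA a0 (- u)) -opprD subKr -addrA -opprD subrr.
Qed.

Definition nabla (a : ser A) : ser A := fun m => - nabla_rhs a m.+1.

Lemma nablaE a : mulNh 1 (nabla a) = nabla_rhs a.
Proof.
apply/funext => -[|m]; first by rewrite nabla_rhs0.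
by rewrite /mulNh /nabla subn1 /= expr1 scaleN1r opprK.
Qed.

Definition Omega_of (phi : nat -> seq (hvec H) -> ser A) (n : nat)
    (x : seq (hvec H)) : ser A := fun m =>
  \sum_(P in parts n | #|P| != 1%N)
    mulNh (n - #|P|) (fun m' => epsilon x P *:
      serprod [seq phi (size b) (subv x b) | b <- blocks P] m') m.

Definition phi_step (n : nat) (phi : nat -> seq (hvec H) -> ser A)
    (x : seq (hvec H)) : ser A :=
  if (n <= 1)%N then fun m => fser m (nth 0 (vects x) 0)
  else fun m => - iter n.-1 nabla (Omega_of phi n x) m.

(* [phi n x] and [Omega n x] are the values of the series phi_n and Omega_n at
   the homogeneous vectors [x = (v_1, ..., v_n)]; since nabla is a
   post-composition, so is [iter i nabla (Omega n x)] for Omega_n^[i]. *)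
Definition phi : nat -> seq (hvec H) -> ser A :=
  crec (fun _ _ => 0) phi_step.

Definition Omega : nat -> seq (hvec H) -> ser A := Omega_of phi.

Lemma phiE n x : (1 < n)%N ->
  phi n x = fun m => - iter n.-1 nabla (Omega n x) m.
Proof.
move=> n1; rewrite /phi crecE => [|F G FG].
  by rewrite /phi_step leqNgt n1.
apply/funext => y; rewrite /phi_step; case: ifP => // _.
suff -> : Omega_of F n y = Omega_of G n y by [].
apply/funext => m; apply: eq_bigr => P /andP[partP P1].
congr mulNh; apply/funext => m'; congr (_ *: serprod _ m').
by apply/eq_in_map => b /(size_block partP P1)/FG->.
Qed.

Lemma phi1E y : phi 1 [:: y] = fser^~ y.2.
Proof. by []. Qed.

Definition OmegaI (n i : nat) (x : seq (hvec H)) : ser A :=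
  iter i nabla (Omega n x).

Definition pi_quantum (n : nat) (x : seq (hvec H)) : ser H :=
  if (n <= 1)%N then cst (nth 0 (vects x) 0)
  else fun m =>
    \sum_(0 <= i < n.-1) mulNh i (cst (h (OmegaI n i x 0%N))) m.

Definition phi_classical (n : nat) (x : seq (hvec H)) : A := phi n x 0%N.

(* The coefficient of (- hbar)^(n-2) in [pi_quantum n x]. *)
Definition mprod (n : nat) (x : seq (hvec H)) : H :=
  (-1) ^+ (n - 2) *: pi_quantum n x (n - 2)%N.

Definition M_of (phi_inv : nat -> seq H -> A) (n : nat) (x : seq (hvec H)) :
    A :=
  \sum_(P in parts n | (#|P| == 2%N) && ~~ last_two_together P)
    epsilon x P *: \prod_(b <- blocks P) phi_classical (size b) (subv x b)
  - \sum_(P in parts n | [&& size (last [::] (blocks P)) == (n - #|P| + 1)%N,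
                             last_two_together P & #|P| != 1%N])
      (let bs := blocks P in
       let B := last [::] bs in
       let xB := subv x B in
       epsilon x P *: phi_classical #|P|
         (rcons (flatten [seq subv x b | b <- take #|P|.-1 bs])
                (deg xB, mprod (size B) xB)))
  + \sum_(P in parts n | last_two_together P && (#|P| != 1%N))
      (let bs := blocks P in
       let B := last [::] bs in
       epsilon x P *: bqa_ell A #|P| 0%N
         (rcons [seq phi_classical (size b) (map (@Jv k H) (subv x b))
                 | b <- take #|P|.-1 bs]
                (phi_inv (size B) (vects (subv x B))))).

End CanonicalFamilies.

(* Main.v *)
(* Put lambda = - hbar, let Phi be the generating function of the canonical
   family phi in formal variables dual to H, and write @_a for its partial
   derivatives.  The sums over all partitions defining Omega_n, completed by
   the one-block term, are the coefficients of exp (Phi / lambda); they are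
   K-closed, and iterating nabla writes them as f (pi_n) + K (eta_n), where
   pi_n has degree at most n - 2 in lambda and its coefficient of
   lambda^(n-2) is m_n.
   Order by order in the formal variables, the closed series
     @_a Phi * @_b Phi + lambda @_a @_b Phi
   can be written as  M_ab^c @_c Phi + K_Phi (Theta_ab)  with power series M
   and Theta in lambda, K_Phi being the differential
   exp (- Phi / lambda) K exp (Phi / lambda) .  Multiplying by exp (Phi / lambda)
   and passing to cohomology gives  lambda^2 @_a @_b pi = M_ab^c lambda @_c pi .
   The left side has no positive powers of lambda and lambda @_c pi is the
   identity up to negative powers, so M does not depend on lambda, and
   M_ab^c is the generating function of the products m_n.  The classical limit
   of the first identity is the theorem, with phi^{-1} = - Theta^(0). *)
Require Import Defs.
From HB Require Import structures.
From mathcomp Require Import all_boot all_order all_algebra.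
From mathcomp Require Import zify ring.
From mathcomp Require Import boolp.

Set Implicit Arguments.
Unset Strict Implicit.
Unset Printing Implicit Defensive.

Import Order.TTheory GRing.Theory Num.Theory.
Local Open Scope ring_scope.

(** * Unshuffles and set partitions of lists *)

(** Generating functions are handled through their coefficients, indexed by lists of vectors: a
    product is a signed sum over splittings of the list ([unsh]), an exponential a signed sum over
    set partitions ([psum]), and a derivative appends a vector. Since blocks are ordered by their
    last entries, differentiating an exponential is the recursion [psum_rcons], and no factorials
    appear. Closedness of the exponential rests on the choice of phi_n. By induction K sends the
    n-th coefficient to lambda^(n-1) D for some D, so K(nabla^(n-1) Omega_n) = D - K(phi_n); as
    phi_n is minus nabla^(n-1) Omega_n, this forces D = 0. The one-block partitions, excluded from
    the last two sums of M_n, would carry the unknowns f(m_n) and K(Theta). The remaining terms form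
    the obstruction of the recursion, which equals the sum of these two, and h f = id, h K = 0 give
    h(M_n) = m_n. The recursion singles out the two derivatives, which is why phi^{-1}_n lives on
    S^{n-2}H (x) S^2H and not on S^nH. *)

Section Parity.

Variable k : fieldType.
Implicit Types i j : int.

Lemma parityD i j : parity (i + j) = parity i * parity j :> k.
Proof.
rewrite /parity -exprD -signr_odd -[RHS]signr_odd; congr (_ ^+ nat_of_bool _).
by lia.
Qed.

Lemma parity0 : parity 0 = 1 :> k. Proof. by []. Qed.

(** Exponents of Koszul signs are polynomials in the degrees that agree only modulo 2. The explicit
    half-difference [t] turns each comparison into a goal for [ring]. *)
Lemma parity_congr i j (t : int) : i = j + 2 * t -> parity i = parity j :> k.
Proof.
move=> ->; rewrite /parity -signr_odd -[RHS]signr_odd.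
by congr (_ ^+ nat_of_bool _); lia.
Qed.

End Parity.
Arguments parity_congr {k i j} t _.

Lemma parity_sqr (k : fieldType) (i : int) : parity i * parity i = 1 :> k.
Proof. by rewrite -parityD -(parity0 k); apply: (parity_congr i); ring. Qed.

Section Linear.
Variables (k : fieldType) (V W : lmodType k) (T : V -> W).
Hypothesis linT : linear T.

(** Maps such as [nabla] and [fser] are plain functions whose linearity is a proved predicate, not
    bundled morphisms; these rules apply to them directly. *)
Lemma linfD u v : T (u + v) = T u + T v.
Proof. by have := linT 1 u v; rewrite !scale1r. Qed.

Lemma linf0 : T 0 = 0.
Proof. by have /eqP := linfD 0 0; rewrite addr0 -{1}[T 0]addr0 (can_eq (addKr _)) => /eqP. Qed.

Lemma linfZ c u : T (c *: u) = c *: T u.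
Proof. by have := linT c u 0; rewrite addr0 linf0 addr0. Qed.

Lemma linfN u : T (- u) = - T u.
Proof. by rewrite -scaleN1r linfZ scaleN1r. Qed.

Lemma linf_sum I (r : seq I) (P : pred I) F :
  T (\sum_(i <- r | P i) F i) = \sum_(i <- r | P i) T (F i).
Proof. by apply: (big_morph T linfD linf0). Qed.

End Linear.

Section Unshuffle.
Variables (k : fieldType) (T : eqType) (d : T -> int).
Implicit Types (x y z : seq T) (W : lmodType k).

Definition dg x : int := \sum_(a <- x) d a.

Lemma dg_cons a x : dg (a :: x) = d a + dg x.
Proof. by rewrite /dg big_cons. Qed.

Lemma dg_nil : dg [::] = 0.
Proof. by rewrite /dg big_nil. Qed.

Lemma dg_cat x y : dg (x ++ y) = dg x + dg y.
Proof. by rewrite /dg big_cat. Qed.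

Lemma dg_rcons x a : dg (rcons x a) = dg x + d a.
Proof. by rewrite -cats1 dg_cat dg_cons dg_nil addr0. Qed.

Lemma dg_perm x y : perm_eq x y -> dg x = dg y.
Proof. by move=> xy; apply: perm_big. Qed.

Lemma dg_split x y z : perm_eq (y ++ z) x -> dg x = dg y + dg z.
Proof. by move=> /dg_perm <-; rewrite dg_cat. Qed.

(* The sum of [F y z] over the splittings of [x] into complementary sublists,
   with the Koszul sign of the rearrangement of [x] into [y ++ z]. *)
Fixpoint unsh W x (F : seq T -> seq T -> W) : W :=
  if x is a :: x' then
    unsh x' (fun y z => F (a :: y) z)
    + unsh x' (fun y z => parity (d a * dg y) *: F y (a :: z))
  else F [::] [::].

Lemma eq_unsh W x (F G : seq T -> seq T -> W) :
  (forall y z, perm_eq (y ++ z) x -> F y z = G y z) -> unsh x F = unsh x G.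
Proof.
elim: x F G => [|a x IH] F G FG; first by apply: FG.
congr (_ + _); apply: IH => y z yz; first by apply: FG; rewrite /= perm_cons.
by congr (_ *: _); apply: FG; rewrite perm_catC /= perm_cons perm_catC.
Qed.

Lemma unsh_linear W W' (L : W -> W') x F : linear L ->
  L (unsh x F) = unsh x (fun y z => L (F y z)).
Proof.
move=> linL; elim: x F => //= a x IH F.
rewrite (linfD linL) !IH; congr (_ + _); apply: eq_unsh => y z _.
by rewrite (linfZ linL).
Qed.

Lemma unshZ W c x F : c *: unsh x F = unsh x (fun y z => c *: (F y z : W)).
Proof. by apply: (unsh_linear (L := *:%R c)) => b u v; rewrite linearP. Qed.

Lemma unshD W x (F G : seq T -> seq T -> W) :
  unsh x (fun y z => F y z + G y z) = unsh x F + unsh x G.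
Proof.
elim: x F G => //= a x IH F G; rewrite IH.
rewrite (eq_unsh (F := fun y z => _ *: (_ + _))
  (G := fun y z => parity (d a * dg y) *: F y (a :: z)
       + parity (d a * dg y) *: G y (a :: z))) ?IH; last first.
  by move=> y z _; rewrite scalerDr.
by rewrite addrACA.
Qed.

Lemma unshN W x F : unsh x (fun y z => - (F y z : W)) = - unsh x F.
Proof. by rewrite -scaleN1r unshZ; apply: eq_unsh => y z _; rewrite scaleN1r. Qed.

Lemma unsh0 W x : unsh x (fun _ _ => 0 : W) = 0.
Proof.
by rewrite -[RHS](scale0r (unsh x (fun _ _ => 0))) unshZ; apply: eq_unsh => y z _; rewrite scale0r.
Qed.

(** [unsh] recurses on the head of the list, set partitions on its last entry. The sign is that of
    carrying [a] back across [z]. *)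
Lemma unsh_rcons W x a (F : seq T -> seq T -> W) :
  unsh (rcons x a) F =
    unsh x (fun y z => parity (d a * dg z) *: F (rcons y a) z)
    + unsh x (fun y z => F y (rcons z a)).
Proof.
elim: x F => [|b x IH] F /=; first by rewrite dg_nil !mulr0 !parity0 !scale1r.
rewrite !IH addrACA; congr (_ + _ + (_ + _)).
apply: eq_unsh => y z _; rewrite dg_cons dg_rcons !scalerA -!parityD.
by congr (_ *: _); apply: (parity_congr (0)); ring.
Qed.

Lemma unshC W x (F : seq T -> seq T -> W) :
  unsh x F = unsh x (fun y z => parity (dg y * dg z) *: F z y).
Proof.
elim: x F => [|a x IH] F /=; first by rewrite dg_nil mul0r parity0 scale1r.
rewrite addrC; congr (_ + _); rewrite IH; apply: eq_unsh => y z _.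
  rewrite scalerA -parityD dg_cons; congr (_ *: _).
  by apply: (parity_congr (0)); ring.
rewrite scalerA -parityD dg_cons; congr (_ *: _).
by apply: (parity_congr (- d a * dg y)); ring.
Qed.

(** Coassociativity of the unshuffle coproduct: both sides run over the splittings of [x] into three
    sublists. *)
Lemma unshA W x (F : seq T -> seq T -> seq T -> W) :
  unsh x (fun y z => unsh y (fun y1 y2 => F y1 y2 z))
    = unsh x (fun y z => unsh z (fun z1 z2 => F y z1 z2)).
Proof.
elim: x F => [|a x IH] F //=.
rewrite unshD IH -addrA; congr (_ + _).
under [RHS]eq_unsh => y z _ do rewrite scalerDr !unshZ.
rewrite unshD -!IH; congr (_ + _); apply: eq_unsh => y z _ //.
rewrite unshZ; apply: eq_unsh => y1 y2 /dg_split->.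
by rewrite scalerA -parityD mulrDr.
Qed.

Lemma unsh_cat W x1 x2 (F : seq T -> seq T -> W) :
  unsh (x1 ++ x2) F = unsh x1 (fun y1 z1 => unsh x2 (fun y2 z2 =>
    parity (dg z1 * dg y2) *: F (y1 ++ y2) (z1 ++ z2))).
Proof.
elim: x1 F => [|a x IH] F /=.
  by apply: eq_unsh => y z _; rewrite dg_nil mul0r parity0 scale1r.
rewrite !IH; congr (_ + _); apply: eq_unsh => y1 z1 _.
rewrite unshZ; apply: eq_unsh => y2 z2 _.
by rewrite !scalerA -!parityD dg_cat dg_cons /= mulrDr mulrDl; congr (parity _ *: _); ring.
Qed.

(** Triangular recursions are solved by this collapse: once the lower coefficients vanish, only the
    top one is left. *)
Lemma unsh_left W x (F : seq T -> seq T -> W) :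
  (forall y z, perm_eq (y ++ z) x -> z != [::] -> F y z = 0) ->
  unsh x F = F x [::].
Proof.
elim: x F => [|a x IH] F F0 //=.
rewrite IH => [|y z yz z0]; last by apply: F0; rewrite //= perm_cons.
rewrite (eq_unsh (G := fun _ _ => 0)) ?unsh0 ?addr0 // => y z yz.
by rewrite F0 ?scaler0 // perm_catC /= perm_cons perm_catC.
Qed.

Lemma unsh_right W x (F : seq T -> seq T -> W) :
  (forall y z, perm_eq (y ++ z) x -> y != [::] -> F y z = 0) ->
  unsh x F = F [::] x.
Proof.
move=> F0; rewrite unshC unsh_left ?dg_nil ?mulr0 ?parity0 ?scale1r // => y z yz z0.
by rewrite F0 ?scaler0 // perm_catC.
Qed.

(** The recursive call goes to an arbitrary sublist, so the structural argument is the fuel [n]; by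
    [psumNE] any bound on the length gives the same sum. *)
Fixpoint psumN W n x (G : seq (seq T) -> W) : W :=
  if n is n'.+1 then
    if x is a :: x' then
      unsh (belast a x') (fun z y =>
        psumN n' z (fun bs => G (rcons bs (rcons y (last a x')))))
    else G [::]
  else G [::].

(* The Koszul-signed sum of [G] over the set partitions of [x], in the order of
   [blocks]: the last block contains the last entry of [x]. *)
Definition psum W x (G : seq (seq T) -> W) : W := psumN (size x) x G.

Lemma psumNS W n a x (G : seq (seq T) -> W) :
  psumN n.+1 (a :: x) G = unsh (belast a x) (fun z y =>
    psumN n z (fun bs => G (rcons bs (rcons y (last a x))))).
Proof. by []. Qed.

Lemma psumNE W n x (G : seq (seq T) -> W) : (size x <= n)%N -> psumN n x G = psum x G.
Proof.
rewrite /psum; have [m lexm] := ubnP (size x).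
elim: m => // m IH in n x lexm G *; case: n x lexm => [|n] [|a x] //= lexm lxn.
apply: eq_unsh => z y zy.
have sz : (size z <= size x)%N.
  by have := perm_size zy; rewrite size_cat size_belast => <-; apply: leq_addr.
by rewrite !IH //; lia.
Qed.

Lemma psum_nil W (G : seq (seq T) -> W) : psum [::] G = G [::].
Proof. by []. Qed.

(** For multiplicative [G] this is the rule for differentiating an exponential: the block of [a] is
    the factor that is differentiated, the other blocks form the exponential again. *)
Lemma psum_rcons W x a (G : seq (seq T) -> W) :
  psum (rcons x a) G =
    unsh x (fun z y => psum z (fun bs => G (rcons bs (rcons y a)))).
Proof.
have -> : psum (rcons x a) G = psumN (size x).+1 (rcons x a) G.
  by rewrite psumNE // size_rcons.
have E b y : belast b (rcons y a) = b :: y.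
  by elim: y b => //= c y IH b; rewrite IH.
case: x => [|b x] //; rewrite rcons_cons psumNS E last_rcons.
apply: eq_unsh => z y zy; rewrite psumNE //.
by have := perm_size zy; rewrite /= size_cat => <-; apply: leq_addr.
Qed.

(** After [psum_rcons] the induction hypothesis is wanted for sublists of [x] that need not be
    prefixes. *)
Lemma size_seq_ind (P : seq T -> Prop) :
  P [::] -> (forall x a, (forall z, (size z <= size x)%N -> P z) -> P (rcons x a)) ->
  forall x, P x.
Proof.
move=> P0 PS x; have [m] := ubnP (size x); elim: m x => // m IH x.
case: (lastP x) => [//|y a]; rewrite size_rcons ltnS => ym.
by apply: PS => z zy; apply: IH; apply: leq_ltn_trans zy _.
Qed.

Lemma split_size x y z : perm_eq (y ++ z) x ->
  (size y <= size x)%N /\ (size z <= size x)%N.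
Proof. by move=> /perm_size <-; rewrite size_cat leq_addr leq_addl. Qed.

Lemma eq_psum W x (F G : seq (seq T) -> W) :
  (forall bs, perm_eq (flatten bs) x -> [::] \notin bs -> F bs = G bs) ->
  psum x F = psum x G.
Proof.
elim/size_seq_ind: x F G => [|x a IH] F G FG; first exact: FG.
rewrite !psum_rcons; apply: eq_unsh => z y zy; apply: IH => [|bs bsz bs0].
  by case: (split_size zy).
apply: FG.
  rewrite -cats1 flatten_cat /= cats0 -rcons_cat -!cats1 perm_cat2r.
  by apply: perm_trans zy; rewrite perm_cat2r.
by rewrite mem_rcons inE negb_or bs0; case: y {zy}.
Qed.

Lemma psum_linear W W' (L : W -> W') x G : linear L ->
  L (psum x G) = psum x (fun bs => L (G bs)).
Proof.
move=> linL; elim/size_seq_ind: x G => [|x a IH] G //.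
rewrite !psum_rcons (unsh_linear _ _ linL); apply: eq_unsh => z y zy.
by rewrite IH //; case: (split_size zy).
Qed.

Lemma psumD W x (F G : seq (seq T) -> W) :
  psum x (fun bs => F bs + G bs) = psum x F + psum x G.
Proof.
elim/size_seq_ind: x F G => [|x a IH] F G //.
rewrite !psum_rcons -unshD; apply: eq_unsh => z y zy.
by rewrite IH //; case: (split_size zy).
Qed.

Lemma psumZ W c x G : c *: psum x G = psum x (fun bs => c *: (G bs : W)).
Proof. by apply: (psum_linear (L := *:%R c)) => b u v; rewrite linearP. Qed.

Lemma psum0 W x : psum x (fun _ => 0 : W) = 0.
Proof.
by rewrite -[RHS](scale0r (psum x (fun _ => 0))) psumZ; apply: eq_psum => y _ _; rewrite scale0r.
Qed.

Lemma psum_unsh_exch W x y (F : seq (seq T) -> seq T -> seq T -> W) :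
  psum x (fun bs => unsh y (F bs)) = unsh y (fun u v => psum x (fun bs => F bs u v)).
Proof.
elim: y F => [|a y IH] F //=; rewrite psumD !IH; congr (_ + _).
by apply: eq_unsh => u v _; rewrite psumZ.
Qed.

Lemma psum_nilp W x (G : seq (seq T) -> W) :
  psum x (fun bs => if bs is [::] then G bs else 0) = if x is [::] then G [::] else 0.
Proof.
case: (lastP x) => [//|y a]; rewrite psum_rcons.
rewrite (eq_unsh (G := fun _ _ => 0)) ?unsh0; first by case: y.
by move=> z u _; rewrite -[RHS](psum0 W z); apply: eq_psum => bs _ _; case: bs.
Qed.

Lemma psum_seq1 W x (G : seq (seq T) -> W) : x != [::] ->
  psum x (fun bs => if size bs == 1%N then G bs else 0) = G [:: x].
Proof.
case: (lastP x) => [//|y a] _; rewrite psum_rcons.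
rewrite (eq_unsh (G := fun z u => if z is [::] then G [:: rcons u a] else 0)).
  by rewrite unsh_right // => -[].
move=> z u _; rewrite -(psum_nilp z (fun _ => G [:: rcons u a])).
by apply: eq_psum => -[|b bs] _ _ //=; rewrite size_rcons.
Qed.

Lemma psum_singletons W x (G : seq (seq T) -> W) :
  psum x (fun bs => if size bs == size x then G bs else 0)
    = G [seq [:: a] | a <- x].
Proof.
elim/size_seq_ind: x G => [|x a IH] G //.
(* A nonempty companion list of [a] leaves fewer than [size x] entries for the other blocks, too few
   for [size x] nonempty blocks. *)
rewrite psum_rcons unsh_left => [|y z yz z0].
  rewrite map_rcons -(IH x _ (fun bs => G (rcons bs [:: a]))) //.
  by apply: eq_psum => bs _ _; rewrite !size_rcons eqSS.
rewrite -[RHS](psum0 W y); apply: eq_psum => bs yb bs0; case: eqP => //.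
rewrite !size_rcons -(perm_size yz) size_cat -(perm_size yb) => -[] E.
have : (size bs <= size (flatten bs))%N.
  elim: bs bs0 {yb E} => //= b bs IHb; rewrite inE negb_or size_cat => /andP[b0 /IHb].
  by case: b b0 => //= c b _; rewrite addSn ltnS => /leq_trans-> //; apply: leq_addl.
by case: z z0 {yz} E => //= c z _; lia.
Qed.

End Unshuffle.

Lemma dg_flatten (T : eqType) (d : T -> int) bs : dg (dg d) bs = dg d (flatten bs).
Proof.
elim: bs => [|b bs IH]; first by rewrite !dg_nil.
by rewrite dg_cons /= dg_cat IH.
Qed.

Section Naturality.
Variables (k : fieldType) (T T' : eqType) (d : T -> int) (d' : T' -> int).

Variable g : T -> T'.
Hypothesis dg_g : forall a, d' (g a) = d a.

Lemma dg_map x : dg d' (map g x) = dg d x.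
Proof. by rewrite /dg big_map; apply: eq_bigr => a _. Qed.

(** Applied with [g] sending a position to the vector there, and with [g] sending a block to its
    degree paired with its value. *)
Lemma unsh_map (W : lmodType k) x (F : seq T' -> seq T' -> W) :
  unsh d' (map g x) F = unsh d x (fun y z => F (map g y) (map g z)).
Proof.
elim: x F => //= a x IH F; rewrite !IH; congr (_ + _).
by apply: eq_unsh => y z _; rewrite dg_map dg_g.
Qed.

Lemma psum_map (W : lmodType k) x (G : seq (seq T') -> W) :
  psum d' (map g x) G = psum d x (fun bs => G (map (map g) bs)).
Proof.
elim/size_seq_ind: x G => [|x a IH] G //.
rewrite map_rcons !psum_rcons unsh_map; apply: eq_unsh => z y zy.
rewrite IH; last by case: (split_size zy).
by apply: eq_psum => bs _ _; rewrite !map_rcons.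
Qed.

End Naturality.

Section PsumUnsh.
Variables (k : fieldType) (T : eqType) (d : T -> int) (W : lmodType k).

(* Set partitions of [x] with a chosen subset of blocks are pairs of set
   partitions of complementary sublists. *)
Lemma psum_unsh x (F : seq (seq T) -> seq (seq T) -> W) :
  psum d x (fun bs => unsh (dg d) bs F) =
    unsh d x (fun y z => psum d y (fun b1 => psum d z (fun b2 => F b1 b2))).
Proof.
elim/size_seq_ind: x F => [|x a IH] F //.
(* The block of the last entry is either among the chosen ones or not, which gives the two summands
   on both sides. *)
rewrite psum_rcons unsh_rcons.
under eq_unsh => z y zy.
  under eq_psum => bs _ _ do rewrite unsh_rcons.
  rewrite psumD !IH; try by case: (split_size zy).
  over.
rewrite unshD; congr (_ + _); last first.
  rewrite unshA; apply: eq_unsh => y z _.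
  under [in RHS]eq_psum => b _ _ do rewrite psum_rcons.
  by rewrite psum_unsh_exch.
rewrite unshA.
under [RHS]eq_unsh => y z _ do rewrite psum_rcons unshZ.
rewrite unshA; apply: eq_unsh => y z _.
rewrite unshC; apply: eq_unsh => u v _.
rewrite [LHS]psumZ [RHS]psumZ; apply: eq_psum => b1 _ _.
rewrite [LHS]psumZ [RHS]psumZ; apply: eq_psum => b2 b2v _.
rewrite scalerA -parityD dg_flatten (dg_perm _ b2v) dg_rcons; congr (_ *: _).
by apply: (parity_congr (dg d u * dg d v)); ring.
Qed.

End PsumUnsh.
Arguments eq_unsh {k T d W x F G} _.
Arguments eq_psum {k T d W x F G} _.
Arguments unsh_linear {k T d W W' L} x F _.
Arguments psum_linear {k T d W W' L} x G _.

(** * The partitions of the statement as set partitions of lists *)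

Lemma uniq_flatten_inj (T : eqType) (bs : seq (seq T)) b c i :
  uniq (flatten bs) -> b \in bs -> c \in bs -> i \in b -> i \in c -> b = c.
Proof.
elim: bs => //= a bs IH; rewrite cat_uniq => /and3P[_ /hasPn dis ubs].
have sub e : e \in bs -> i \in e -> i \notin a.
  by move=> ebs ie; apply: dis; apply/flattenP; exists e.
rewrite !inE => /predU1P[->|bbs] /predU1P[->|cbs] ib ic //.
- by move: (sub _ cbs ic); rewrite ib.
- by move: (sub _ bbs ib); rewrite ic.
- exact: IH.
Qed.

Fixpoint splits (T : Type) (s : seq T) : seq (seq T * seq T) :=
  if s is a :: s' then
    [seq (a :: p.1, p.2) | p <- splits s'] ++ [seq (p.1, a :: p.2) | p <- splits s']
  else [:: ([::], [::])].

Lemma splits_perm (T : eqType) (s : seq T) p : p \in splits s -> perm_eq (p.1 ++ p.2) s.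
Proof.
elim: s p => [|a s IH] p /=; first by rewrite inE => /eqP->.
rewrite mem_cat => /orP[] /mapP[q /IH qs ->] /=; first by rewrite perm_cons.
by rewrite perm_catC /= perm_cons perm_catC.
Qed.

Lemma splits_uniq (T : eqType) (s : seq T) : uniq s -> uniq (splits s).
Proof.
elim: s => //= a s IH /andP[as_ /IH us]; rewrite cat_uniq !map_inj_uniq ?us //=.
- rewrite andbT; apply/hasPn => _ /mapP[p ps ->]; apply/mapP => -[q qs [Ep _]].
  by move: as_; rewrite -(perm_mem (splits_perm ps)) Ep mem_cat inE eqxx.
- by move=> [u v] [u' v'] /= [-> ->].
- by move=> [u v] [u' v'] /= [-> ->].
Qed.

Lemma sorted_ltn_cons a s : sorted ltn (a :: s) = all (ltn a) s && sorted ltn s.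
Proof. by rewrite /= path_sortedE //; apply: ltn_trans. Qed.

Lemma sorted_ltn_rcons a s : sorted ltn (rcons s a) = all (ltn^~ a) s && sorted ltn s.
Proof.
rewrite !(sorted_pairwise ltn_trans) -cats1 pairwise_cat /= andbT.
by rewrite allrel1r.
Qed.

Lemma mem_splits (s : seq nat) p : sorted ltn s ->
  (p \in splits s) = [&& sorted ltn p.1, sorted ltn p.2 & perm_eq (p.1 ++ p.2) s].
Proof.
elim: s p => [|a s IH] [y z].
  move=> _; rewrite inE /=; apply/eqP/and3P => [[-> ->] //|[_ _ /perm_size]].
  by rewrite size_cat; case: y z => [|? ?] [].
rewrite sorted_ltn_cons => /andP[/allP als ss].
apply/idP/idP.
  move=> ps; have /= yzs := splits_perm ps; move: ps; rewrite /= mem_cat.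
  case/orP=> /mapP[[u v]]; rewrite IH //= => /and3P[su sv uvs] [Ey Ez]; subst y z.
    rewrite yzs sv sorted_ltn_cons su !andbT /=; apply/allP => i iu; apply: als.
    by rewrite -(perm_mem uvs) mem_cat iu.
  rewrite yzs su sorted_ltn_cons sv !andbT /=; apply/allP => i iu; apply: als.
  by rewrite -(perm_mem uvs) mem_cat iu orbT.
(* [a] is the least entry, so it heads whichever sorted list contains it. *)
have hd b t : sorted ltn (b :: t) -> a \in b :: t -> b \in a :: s -> b = a.
  rewrite sorted_ltn_cons !inE => /andP[/allP bt _] /predU1P[->//|/bt ba].
  by case/predU1P=> [//|/als /=]; move: ba => /=; lia.
move=> /and3P[/= sy sz yzs]; rewrite mem_cat.
have: a \in y ++ z by rewrite (perm_mem yzs) mem_head.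
rewrite mem_cat => /orP[].
- case: y sy yzs => // b y sy yzs /(hd _ _ sy) Eb.
  have {}Eb : b = a by apply: Eb; rewrite -(perm_mem yzs) mem_head.
  subst b; move: yzs; rewrite /= perm_cons => yzs; apply/orP; left; apply/mapP.
  exists (y, z) => //; rewrite IH //= yzs sz !andbT.
  by move: sy; rewrite sorted_ltn_cons => /andP[].
- case: z sz yzs => // b z sz yzs /(hd _ _ sz) Eb.
  have {}Eb : b = a by apply: Eb; rewrite -(perm_mem yzs) mem_cat mem_head orbT.
  subst b; move: yzs; rewrite perm_catC /= perm_cons perm_catC => yzs.
  apply/orP; right; apply/mapP; exists (y, z) => //; rewrite IH //= yzs sy andTb andbT.
  by move: sz; rewrite sorted_ltn_cons => /andP[].
Qed.

Definition lt_last (b c : seq nat) := (last 0 b < last 0 c)%N.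

(** The normal form produced by [blocks], stated for lists alone; the enumerations by [parts] and by
    [psum] are compared through it. *)
Definition is_setpart (s : seq nat) (bs : seq (seq nat)) :=
  [&& perm_eq (flatten bs) s, all (sorted ltn) bs, [::] \notin bs
    & pairwise lt_last bs].

Lemma last_in (T : eqType) (x0 : T) s : s != [::] -> last x0 s \in s.
Proof. by case: s => // a s _ /=; apply: mem_last. Qed.

Lemma mem_last_max s i : sorted ltn s -> i \in s -> (i <= last 0 s)%N.
Proof.
case: (lastP s) => // t a; rewrite sorted_ltn_rcons last_rcons mem_rcons inE.
by move=> /andP[/allP ta _] /predU1P[->//|/ta/ltnW].
Qed.

(** [a] is the largest entry and blocks are ordered by their last entries, so the block of [a] comes
    last and ends in [a]. This is the recursion of [psum_rcons]. *)
Lemma is_setpart_rcons s a bs : sorted ltn (rcons s a) ->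
  is_setpart (rcons s a) bs <->
  exists p bs', [/\ p \in splits s, is_setpart p.1 bs' &
                    bs = rcons bs' (rcons p.2 a)].
Proof.
rewrite sorted_ltn_rcons => /andP[/allP sa ss]; split; last first.
  case=> -[z y] [bs'] [/=]; rewrite mem_splits //= => /and3P[sz sy zys].
  case/and4P=> bsz bso bs0 bsl ->; apply/and4P; split.
  - rewrite -cats1 flatten_cat /= cats0 -rcons_cat -!cats1 perm_cat2r.
    by apply: perm_trans zys; rewrite perm_cat2r.
  - rewrite all_rcons bso andbT sorted_ltn_rcons sy andbT; apply/allP => i iy.
    by apply: sa; rewrite -(perm_mem zys) mem_cat iy orbT.
  - by rewrite mem_rcons inE negb_or bs0; case: y {sy zys}.
  - rewrite -cats1 pairwise_cat bsl /= andbT allrel1r; apply/allP => b bb.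
    rewrite /lt_last last_rcons; apply: sa; rewrite -(perm_mem zys) mem_cat.
    rewrite -(perm_mem bsz); apply/orP; left; apply/flattenP; exists b => //.
    by apply: last_in; apply: contraNneq bs0 => <-.
case/and4P; case: (lastP bs) => [/perm_size|bs' b]; first by rewrite size_rcons.
rewrite -cats1 flatten_cat /= cats0 => bss.
rewrite cats1 all_rcons mem_rcons inE negb_or => /andP[sb sbs] /andP[b0 bs0].
rewrite -cats1 pairwise_cat allrel1r /= andbT => /andP[/allP lb lbs].
have le_a i : i \in flatten bs' ++ b -> (i <= a)%N.
  by rewrite (perm_mem bss) mem_rcons inE => /predU1P[->//|/sa/ltnW].
have ab : a \in b.
  have : a \in flatten bs' ++ b by rewrite (perm_mem bss) mem_rcons mem_head.
  rewrite mem_cat => /orP[|//] /flattenP[c cbs ac].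
  have := lb _ cbs; have := mem_last_max (allP sbs _ cbs) ac.
  have : (last 0 b <= a)%N by apply: le_a; rewrite mem_cat last_in ?orbT // eq_sym.
  by rewrite /lt_last; lia.
case: (lastP b) b0 sb bss le_a ab {lb} => // y c _ sb bss le_a ab.
have Ec : c = a.
  apply/eqP; rewrite eqn_leq le_a ?mem_cat ?mem_rcons ?mem_head ?orbT //=.
  by have := mem_last_max sb ab; rewrite last_rcons.
subst c.
have zs : perm_eq (flatten bs' ++ y) s.
  by move: bss; rewrite -rcons_cat -!cats1 perm_cat2r.
have us : uniq s by apply: (sorted_uniq ltn_trans ltnn).
(* Splits consist of increasing lists, so the union of the other blocks has to be sorted. *)
exists (sort leq (flatten bs'), y), bs'; split=> //=.
  rewrite mem_splits //=; apply/and3P; split.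
  - rewrite ltn_sorted_uniq_leq sort_uniq (sort_sorted leq_total) andbT.
    by move: us; rewrite -(perm_uniq zs) cat_uniq => /and3P[].
  - by move: sb; rewrite sorted_ltn_rcons => /andP[].
  - by apply: perm_trans zs; rewrite perm_cat2r perm_sort.
  by apply/and4P; split=> //; rewrite perm_sym perm_sort.
by rewrite cats1.
Qed.

(** * Koszul signs as products over inversions *)

Section KoszulSigns.
Variables (k : fieldType) (d : nat -> int).

Definition cross (y z : seq nat) : k :=
  \prod_(a <- y) \prod_(b <- z | (b < a)%N) parity (d a * d b).

Fixpoint ksgn (s : seq nat) : k :=
  if s is a :: s' then
    \prod_(b <- s' | (b < a)%N) parity (d a * d b) * ksgn s'
  else 1.

Lemma ksgn_cat s t : ksgn (s ++ t) = ksgn s * ksgn t * cross s t.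
Proof.
elim: s => [|a s IH] /=; first by rewrite /cross big_nil mulr1 mul1r.
by rewrite IH big_cat /cross big_cons /=; ring.
Qed.

Lemma ksgn_sorted s : sorted ltn s -> ksgn s = 1.
Proof.
elim: s => // a s IH; rewrite sorted_ltn_cons => /andP[/allP as_ /IH {}IH] /=.
rewrite IH mulr1 big_seq_cond big1 // => b /andP[/as_ /= ab].
by rewrite ltnNge (ltnW ab).
Qed.

Lemma cross_perm y y' z : perm_eq y y' -> cross y z = cross y' z.
Proof. exact: perm_big. Qed.

Lemma cross_rcons y z a : {in y, forall b, (b < a)%N} ->
  cross y (rcons z a) = cross y z.
Proof.
move=> ya; apply: eq_big_seq => b /ya ba.
by rewrite -cats1 big_cat /= big_cons ltnNge (ltnW ba) /= big_nil mulr1.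
Qed.

(** The head [a] is smaller than the rest. On the left it makes no inversion with the right part; on
    the right it makes one with each entry of the left part, and these signs multiply to the factor
    in [unsh]. *)
Lemma unsh_splits (W : lmodType k) s (F : seq nat -> seq nat -> W) : sorted ltn s ->
  unsh d s F = \sum_(p <- splits s) cross p.1 p.2 *: F p.1 p.2.
Proof.
elim: s F => [|a s IH] F; first by rewrite /= big_seq1 /cross big_nil scale1r.
rewrite sorted_ltn_cons => /andP[/allP as_ ss] /=.
rewrite big_cat !big_map !IH //=; congr (_ + _); apply: eq_big_seq => p ps.
  congr (_ *: _); rewrite /cross big_cons /= [X in X * _]big_seq_cond.
  rewrite [X in X * _]big1 ?mul1r // => b.
  case/andP=> bp; rewrite ltnNge ltnW //; apply: as_.
  by rewrite -(perm_mem (splits_perm ps)) mem_cat bp orbT.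
rewrite scalerA; congr (_ *: _); rewrite mulrC.
have : {in p.1, forall b, (a < b)%N}.
  by move=> b bp; apply: as_; rewrite -(perm_mem (splits_perm ps)) mem_cat bp.
elim: (p.1) => [|b y IHy] ab; first by rewrite dg_nil mulr0 /cross !big_nil mulr1.
rewrite dg_cons /cross big_cons [in RHS]big_cons -/(cross y _) -/(cross y _).
have -> : \prod_(b0 <- a :: p.2 | (b0 < b)%N) (parity (d b * d b0) : k)
   = parity (d a * d b) * \prod_(b0 <- p.2 | (b0 < b)%N) parity (d b * d b0).
  by rewrite big_cons ab ?mem_head // [d a * _]mulrC.
rewrite mulrDr parityD -IHy; first by rewrite /cross; ring.
by move=> c cy; rewrite ab // inE cy orbT.
Qed.

(** The sign of the flattened partition is that of the earlier blocks times the inversions between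
    them and the last block. The last block is increasing and its end [a] is maximal, so neither
    contributes further inversions. *)
Lemma psum_setparts (W : lmodType k) s : sorted ltn s ->
  exists L, [/\ uniq L, (forall bs, bs \in L <-> is_setpart s bs) &
    forall g : seq (seq nat) -> W,
      psum d s g = \sum_(bs <- L) ksgn (flatten bs) *: g bs].
Proof.
elim/size_seq_ind: s => [|s a IH] sa.
  exists [:: [::]]; split=> // [bs|g]; last by rewrite big_seq1 scale1r.
  rewrite inE; split=> [/eqP->//|]; case: bs => // -[|i b] bs /and4P[].
    by rewrite inE.
  by move=> /perm_size.
have /andP[sla ss] : all (ltn^~ a) s && sorted ltn s by rewrite -sorted_ltn_rcons.
(* The enumerations of all left parts are chosen at once, so the property is made conditional on [z]
   being one. *)
have /choice[L hL] z : exists L, z \in unzip1 (splits s) ->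
    [/\ uniq L, (forall bs, bs \in L <-> is_setpart z bs) &
    forall g : seq (seq nat) -> W,
      psum d z g = \sum_(bs <- L) ksgn (flatten bs) *: g bs].
  have [/mapP[[z' y] zs /= Ez]|_] := boolP (z \in unzip1 (splits s)); last by exists [::].
  subst z'; move: zs; rewrite mem_splits //= => /and3P[sz _ zys].
  by have [L hL] := IH z (proj1 (split_size zys)) sz; exists L.
have {}hL p : p \in splits s -> [/\ uniq (L p.1),
    (forall bs, bs \in L p.1 <-> is_setpart p.1 bs) &
    forall g : seq (seq nat) -> W,
      psum d p.1 g = \sum_(bs <- L p.1) ksgn (flatten bs) *: g bs].
  by move=> ps; apply: hL; apply: map_f.
exists [seq rcons bs (rcons p.2 a) | p <- splits s, bs <- L p.1]; split.
(* The left part is recovered from its partition: it is increasing with the same entries as the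
   flattened blocks. *)
- apply: allpairs_uniq_dep => [||/= u v].
  + exact/splits_uniq/(sorted_uniq ltn_trans ltnn).
  + by move=> p /hL[].
  + move=> /allpairsPdep[[z y] [bs [ps bsL ->]]] /allpairsPdep[[z' y'] [bs' [qs bsL' ->]]] /=.
    move=> /rcons_inj[Eb /rcons_inj[Ey]]; subst bs' y'.
    suff <- : z = z' by [].
    have [_ /(_ bs)[/(_ bsL)/and4P[bz _ _ _] _] _] := hL _ ps.
    have [_ /(_ bs)[/(_ bsL')/and4P[bz' _ _ _] _] _] := hL _ qs.
    move: ps qs; rewrite !mem_splits //= => /and3P[sz _ _] /and3P[sz' _ _].
    apply: (irr_sorted_eq ltn_trans ltnn sz sz'); apply: perm_mem.
    by rewrite perm_sym in bz; apply: perm_trans bz bz'.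
- move=> bs; rewrite is_setpart_rcons //; split.
    move=> /allpairsPdep[p [bs' [ps bsL ->]]]; exists p, bs'; split=> //.
    by have [_ /(_ bs')[]] := hL _ ps; auto.
  move=> [p [bs' [ps bsp ->]]]; apply/allpairsPdep; exists p, bs'; split=> //.
  by have [_ /(_ bs')[]] := hL _ ps; auto.
- move=> g; rewrite psum_rcons unsh_splits // big_allpairs_dep.
  apply: eq_big_seq => p ps; have [_ Lp ->] := hL _ ps.
  rewrite scaler_sumr; apply: eq_big_seq => bs /Lp/and4P[bz _ _ _].
  rewrite scalerA; congr (_ *: _).
  rewrite -cats1 flatten_cat /= cats0 ksgn_cat.
  move: (ps); rewrite mem_splits //= => /and3P[_ sy pss].
  rewrite [ksgn (rcons _ _)]ksgn_sorted ?mulr1; last first.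
    rewrite sorted_ltn_rcons sy andbT; apply/allP => i iy; apply: (allP sla).
    by rewrite -(perm_mem pss) mem_cat iy orbT.
  rewrite mulrC cross_rcons => [|i]; last first.
    rewrite (perm_mem bz) => iz; apply: (allP sla).
    by rewrite -(perm_mem pss) mem_cat iz.
  by rewrite (cross_perm _ bz).
Qed.

End KoszulSigns.

(** * The bijection between partitions of a finite set and normal forms of lists of blocks *)

Section Blocks.

Variable n : nat.
Implicit Types (B : {set 'I_n}) (P : {set {set 'I_n}}).

Definition block_seq B : seq nat := [seq val i | i <- enum B].

Definition seq_block (b : seq nat) : {set 'I_n} := [set i | val i \in b].

Lemma sorted_block_seq B : sorted ltn (block_seq B).
Proof.
rewrite /block_seq sorted_map.
rewrite /enum_mem; apply: sorted_filter; first by move=> ? ? ?; apply: ltn_trans.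
by rewrite -sorted_map -enumT val_enum_ord; apply: iota_ltn_sorted.
Qed.

Lemma mem_block_seq B (i : 'I_n) : (val i \in block_seq B) = (i \in B).
Proof. by rewrite mem_map ?mem_enum //; apply: val_inj. Qed.

Lemma block_seqK B : seq_block (block_seq B) = B.
Proof. by apply/setP => i; rewrite inE mem_block_seq. Qed.

Lemma seq_blockK b : sorted ltn b -> {in b, forall i, (i < n)%N} ->
  block_seq (seq_block b) = b.
Proof.
move=> sb bn; apply: (irr_sorted_eq ltn_trans ltnn (sorted_block_seq _) sb) => i.
apply/idP/idP => [/mapP[j]|ib]; first by rewrite mem_enum inE => ? ->.
by rewrite -[i]/(val (Ordinal (bn _ ib))) mem_block_seq inE.
Qed.

Lemma mem_blocks P b : (b \in blocks P) = (b \in [seq block_seq B | B <- enum P]).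
Proof. by rewrite mem_sort. Qed.

Lemma blocks_inj : injective (@blocks n).
Proof.
have blP P B : (B \in P) = (block_seq B \in blocks P).
  rewrite mem_blocks mem_map ?mem_enum // => ? ? /(congr1 seq_block).
  by rewrite !block_seqK.
by move=> P Q PQ; apply/setP => B; rewrite !blP PQ.
Qed.

Lemma perm_flatten_blocks P : P \in parts n -> perm_eq (flatten (blocks P)) (iota 0 n).
Proof.
rewrite inE => /and3P[/eqP cP tiP P0].
have E : perm_eq (flatten (map (fun B => enum B) (enum P))) (enum 'I_n).
  apply/permP => a; rewrite count_flatten -map_comp sumnE big_map big_enum /=.
  have cE B : count a (enum B) = \sum_(i in B) (a i : nat).
    by rewrite -sum1_count big_enum_cond /= big_mkcondr; apply: eq_bigr => i _; case: (a i).
  rewrite (eq_bigr _ (fun B _ => cE B)) -(big_trivIset _ tiP) /= cP.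
  rewrite -sum1_count big_enum_cond /= [RHS]big_mkcond /=.
  by rewrite (eq_bigl predT) => [|i]; rewrite ?inE //; apply: eq_bigr => i _; case: (a i).
apply: perm_trans (perm_flatten (permEl (perm_sort _ _))) _.
rewrite -val_enum_ord.
have -> : flatten [seq [seq val i | i <- enum B] | B : {set 'I_n} <- enum P]
  = map val (flatten (map (fun B => enum B) (enum P))).
  by rewrite map_flatten -map_comp.
exact: perm_map.
Qed.

Lemma is_setpart_blocks P : P \in parts n -> is_setpart (iota 0 n) (blocks P).
Proof.
move=> Pn; have fP := perm_flatten_blocks Pn.
have so : all (sorted ltn) (blocks P).
  by apply/allP => b; rewrite mem_blocks => /mapP[B _ ->]; apply: sorted_block_seq.
have b0 : [::] \notin blocks P.
  rewrite mem_blocks; apply/mapP => -[B]; rewrite mem_enum => BP E0.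
  move: Pn; rewrite inE => /and3P[_ _]; case/negP.
  suff <- : B = set0 by [].
  by rewrite -[B]block_seqK -E0; apply/setP => i; rewrite !inE.
apply/and4P; split=> //.
have : pairwise (fun b c => (last 0 b <= last 0 c)%N) (blocks P).
  rewrite -sorted_pairwise; last by move=> ? ? ?; apply: leq_trans.
  by apply: sort_sorted => ? ?; apply: leq_total.
have : uniq (flatten (blocks P)) by rewrite (perm_uniq fP) iota_uniq.
elim: (blocks P) b0 {fP so} => //= b bs IH; rewrite inE negb_or cat_uniq.
move=> /andP[b0 bs0] /and3P[_ /hasPn dis us] /andP[/allP lb lbs].
rewrite IH // andbT; apply/allP => c cbs; have := lb _ cbs.
rewrite /lt_last leq_eqVlt => /predU1P[E|//].
have : last 0 c \in flatten bs.
  apply/flattenP; exists c => //; apply: last_in.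
  by apply: contraNneq bs0 => <-.
by move=> /dis; rewrite -E last_in // eq_sym.
Qed.

Lemma blocks_surj bs : is_setpart (iota 0 n) bs ->
  exists2 P, P \in parts n & blocks P = bs.
Proof.
move=> hbs; case/and4P: (hbs) => fbs sbs bs0 lbs.
have lt_n b i : b \in bs -> i \in b -> (i < n)%N.
  move=> bbs ib; have : i \in flatten bs by apply/flattenP; exists b.
  by rewrite (perm_mem fbs) mem_iota.
have bK b : b \in bs -> block_seq (seq_block b) = b.
  by move=> bbs; apply: seq_blockK; [apply: (allP sbs)|move=> i; apply: lt_n].
have ubs : uniq (flatten bs) by rewrite (perm_uniq fbs) iota_uniq.
pose P := [set B in map seq_block bs].
have PP : P \in parts n.
  rewrite inE; apply/and3P; split.
  - apply/eqP/setP => i; rewrite inE; apply/bigcupP.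
    have : val i \in flatten bs by rewrite (perm_mem fbs) mem_iota /=.
    move=> /flattenP[b bbs ib]; exists (seq_block b); last by rewrite inE.
    by rewrite inE map_f.
  - apply/trivIsetP => B C; rewrite !inE => /mapP[b bbs ->] /mapP[c cbs ->].
    apply: contraNT => /pred0Pn[i] /=; rewrite !inE => /andP[ib ic].
    by apply/eqP; congr seq_block; apply: (uniq_flatten_inj ubs bbs cbs ib ic).
  - rewrite inE; apply/mapP => -[b bbs E0]; case/negP: bs0.
    have <- : b = [::]; last by [].
    rewrite -(bK _ bbs) -E0; apply/eqP; rewrite -size_eq0 size_map -cardE.
    by rewrite cards0.
(* Both lists are strictly sorted for [lt_last], so it is enough that they have the same members. *)
exists P => //; apply: (@irr_sorted_eq _ lt_last).
- by move=> ? ? ?; apply: ltn_trans.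
- by move=> ?; rewrite /lt_last ltnn.
- by case/and4P: (is_setpart_blocks PP) => _ _ _; apply: pairwise_sorted.
- exact: pairwise_sorted.
move=> b; rewrite mem_blocks; apply/mapP/idP => [[B]|bbs].
  by rewrite mem_enum inE => /mapP[c cbs ->] ->; rewrite bK.
by exists (seq_block b); rewrite ?bK // mem_enum inE map_f.
Qed.

Lemma size_blocks P : size (blocks P) = #|P|.
Proof. by rewrite size_sort size_map -cardE. Qed.

End Blocks.

Section Bridge.
Variables (k : fieldType) (V : gradedLmodType k).

Definition posdeg (x : seq (hvec V)) (i : nat) : int := (nth (0, 0) x i).1.

Lemma ksignE x s : ksign x s = ksgn k (posdeg x) s.
Proof. by elim: s => //= a s ->. Qed.

Lemma size_subv (x : seq (hvec V)) s : size (subv x s) = size s.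
Proof. exact: size_map. Qed.

(** [blocks] maps [parts n] bijectively onto the normal forms over which [psum] runs, with the same
    sign. All sums over partitions in the definitions enter the calculus of [psum] through this
    identity. *)
Lemma sum_parts (W : lmodType k) n (x : seq (hvec V)) (g : seq (seq nat) -> W) :
  \sum_(P in parts n) epsilon x P *: g (blocks P)
    = psum (posdeg x) (iota 0 n) g.
Proof.
have [L [uL LP ->]] := psum_setparts (posdeg x) W (iota_ltn_sorted 0 n).
have -> : \sum_(P in parts n) epsilon x P *: g (blocks P) =
    \sum_(bs <- map (@blocks n) (enum (parts n))) ksgn k (posdeg x) (flatten bs) *: g bs.
  by rewrite big_map big_enum; apply: eq_bigr => P _; rewrite /epsilon ksignE.
apply: perm_big; apply: uniq_perm => //.
  by rewrite map_inj_uniq ?enum_uniq //; apply: blocks_inj.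
move=> bs; apply/mapP/idP => [[P]|/LP/blocks_surj[P Pn <-]].
  by rewrite mem_enum => Pn ->; apply/LP/is_setpart_blocks.
by exists P; rewrite ?mem_enum.
Qed.

Lemma psum_subv (W : lmodType k) (x : seq (hvec V)) (G : seq (seq (hvec V)) -> W) :
  psum (posdeg x) (iota 0 (size x)) (fun bs => G [seq subv x b | b <- bs])
    = psum fst x G.
Proof.
rewrite -[in RHS](mkseq_nth (0, 0) x) /mkseq.
by rewrite (psum_map (d := posdeg x) (d' := fst) (g := nth (0, 0) x)).
Qed.

End Bridge.

(** * Power series *)
HB.instance Definition _ (V : choiceType) := Choice.copy (ser V) (nat -> V).

Section SerZmodule.

Variable V : zmodType.
Implicit Types a b c : ser V.

Fact ser_addA : associative (fun a b : ser V => (fun m => a m + b m) : ser V).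
Proof. by move=> a b c; apply/funext => m; rewrite addrA. Qed.

Fact ser_addC : commutative (fun a b : ser V => (fun m => a m + b m) : ser V).
Proof. by move=> a b; apply/funext => m; rewrite addrC. Qed.

Fact ser_add0 : left_id ((fun=> 0) : ser V) (fun a b : ser V => (fun m => a m + b m) : ser V).
Proof. by move=> a; apply/funext => m; rewrite add0r. Qed.

Fact ser_addN : left_inverse ((fun=> 0) : ser V) (fun a : ser V => (fun m => - a m) : ser V)
  (fun a b : ser V => (fun m => a m + b m) : ser V).
Proof. by move=> a; apply/funext => m; rewrite addNr. Qed.
HB.instance Definition _ := GRing.isZmodule.Build (ser V)
  ser_addA ser_addC ser_add0 ser_addN.

Lemma serD a b m : (a + b) m = a m + b m. Proof. by []. Qed.

Lemma ser0 m : (0 : ser V) m = 0. Proof. by []. Qed.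

Lemma serB a b m : (a - b) m = a m - b m. Proof. by []. Qed.

Lemma ser_sum I (r : seq I) (P : pred I) (F : I -> ser V) m :
  (\sum_(i <- r | P i) F i) m = \sum_(i <- r | P i) F i m.
Proof. exact: (big_morph (fun a : ser V => a m)). Qed.

(* The series [\sum_l hbar^l G_l]. *)
Definition insum (G : nat -> ser V) : ser V := fun m => \sum_(l < m.+1) G l (m - l)%N.

Lemma eq_insum G G' : (forall l, G l = G' l) -> insum G = insum G'.
Proof. by move=> GG; apply/funext => m; apply: eq_bigr => l _; rewrite GG. Qed.

Lemma insumD G G' : insum (fun l => G l + G' l) = insum G + insum G'.
Proof. by apply/funext => m; rewrite serD -big_split. Qed.

Lemma triangular_sum N (F : nat -> nat -> V) :
  \sum_(l < N) \sum_(i < l.+1) F i (l - i)%N = \sum_(i < N) \sum_(j < N - i) F i j.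
Proof.
elim: N => [|N IH]; first by rewrite !big_ord0.
rewrite big_ord_recr IH /= [RHS]big_ord_recr /= subSnn big_ord1 big_ord_recr /= subnn.
rewrite addrA; congr (_ + _); rewrite -big_split; apply: eq_bigr => i _ /=.
by rewrite subSn ?big_ord_recr // ltnW.
Qed.

(** Both sides attach hbar^(i+j) to [S i j]. Associativity of the product and continuity of [hat]
    are instances of this regrouping. *)
Lemma insum_conv (S : nat -> nat -> ser V) :
  insum (fun l => \sum_(i < l.+1) S i (l - i)%N) = insum (fun i => insum (S i)).
Proof.
apply/funext => m; rewrite /insum.
under eq_bigr do rewrite ser_sum.
have := triangular_sum m.+1 (fun i j => S i j (m - i - j)%N).
rewrite (eq_bigr (fun l : 'I_m.+1 => \sum_(i < l.+1) S i (l - i)%N (m - l)%N)) => [->|l _].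
  by apply: eq_bigr => i _; rewrite subSn // -ltnS.
apply: eq_bigr => i _; congr (S _ _ _).
by have := ltn_ord i; have := ltn_ord l; lia.
Qed.

Lemma cst_insum (a : ser V) : a = insum (fun l m => if m == 0%N then a l else 0).
Proof.
apply/funext => m; rewrite /insum big_ord_recr /= subnn eqxx big1 ?add0r // => i _.
by rewrite subn_eq0 leqNgt ltn_ord.
Qed.

End SerZmodule.

Section SerLmodule.
Variables (k : fieldType) (V : lmodType k).
Implicit Types a b c : ser V.

Definition ser_scale (x : k) a : ser V := fun m => x *: a m.

Fact ser_scaleA x y a : ser_scale x (ser_scale y a) = ser_scale (x * y) a.
Proof. by apply/funext => m; rewrite /ser_scale scalerA. Qed.

Fact ser_scale1 : left_id 1 ser_scale.
Proof. by move=> a; apply/funext => m; rewrite /ser_scale scale1r. Qed.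

Fact ser_scaleDr : right_distributive ser_scale +%R.
Proof. by move=> x a b; apply/funext => m; rewrite /ser_scale scalerDr. Qed.

Fact ser_scaleDl a : {morph ser_scale^~ a : x y / x + y}.
Proof. by move=> x y; apply/funext => m; rewrite /ser_scale scalerDl. Qed.
HB.instance Definition _ := GRing.Zmodule_isLmodule.Build k (ser V)
  ser_scaleA ser_scale1 ser_scaleDr ser_scaleDl.

Lemma serZ (x : k) a m : (x *: a) m = x *: a m. Proof. by []. Qed.

Lemma cstE (v : V) m : cst v m = if m == 0%N then v else 0. Proof. by []. Qed.

Lemma insumZ (x : k) G : insum (fun l => x *: G l : ser V) = x *: insum G.
Proof. by apply/funext => m; rewrite serZ scaler_sumr. Qed.

Lemma cst_linear : linear (@cst k V : V -> ser V).
Proof. by move=> x u v; apply/funext => -[|m] //; rewrite serD serZ !cstE /= scaler0 addr0. Qed.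

Lemma ser_expand a : a = insum (fun l => cst (a l) : ser V).
Proof. exact: cst_insum. Qed.

Lemma mulNhE e a m : mulNh e a m = if (m < e)%N then 0 else (-1) ^+ e *: a (m - e)%N.
Proof. by []. Qed.

Lemma mulNh_linear e : linear (mulNh e : ser V -> ser V).
Proof.
move=> x u v; apply/funext => m; rewrite serD serZ !mulNhE.
case: ifP => _; first by rewrite scaler0 addr0.
by rewrite serD serZ linearP.
Qed.

Lemma mulNh0 a : mulNh 0 a = a.
Proof. by apply/funext => m; rewrite mulNhE subn0 expr0 scale1r. Qed.

Lemma mulNhM e e' a : mulNh e (mulNh e' a) = mulNh (e + e') a.
Proof.
apply/funext => m; rewrite !mulNhE exprD -scalerA subnDA.
have [me|em] := ltnP m e; first by rewrite ltn_addr.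
by rewrite ltn_subLR //; case: ifP => _; rewrite ?scaler0.
Qed.

Lemma mulNh_inj e : injective (mulNh e : ser V -> ser V).
Proof.
move=> a b ab; apply/funext => m; have := congr1 (fun c : ser V => c (e + m)%N) ab.
rewrite !mulNhE ltnNge leq_addr addKn /= => /eqP; rewrite (inj_eq (scalerI _)) ?signr_eq0 //.
by move/eqP.
Qed.

(** Written as an [insum] with one nonzero term, multiplication by a power of - hbar commutes with
    every continuous linear map. *)
Lemma mulNh_insum e a :
  mulNh e a = insum (fun l => if l == e then (-1) ^+ e *: a else 0 : ser V).
Proof.
apply/funext => m; rewrite mulNhE /insum; case: ltnP => [me|em].
  by rewrite big1 // => i _; case: eqP => // ie; have := ltn_ord i; rewrite ie; lia.
have em' : (e < m.+1)%N by [].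
rewrite (bigD1 (Ordinal em')) //= eqxx big1 ?addr0 // => i.
by rewrite -val_eqE /= => /negPf->.
Qed.

Lemma coef_sum_mulNh (F : nat -> V) n m :
  (\sum_(i < n) mulNh i (cst (F i)) : ser V) m = if (m < n)%N then (-1) ^+ m *: F m else 0.
Proof.
rewrite ser_sum (eq_bigr (fun i : 'I_n => if i == m :> nat then (-1) ^+ m *: F m else 0)).
  rewrite -big_mkcond; case: ifP => mn; last first.
    by rewrite big1 // => i /eqP im; move: (ltn_ord i); rewrite im mn.
  by rewrite (big_pred1 (Ordinal mn)).
move=> i _; rewrite mulNhE cstE subn_eq0; case: (ltngtP i m) => [im|im|->] //=.
by rewrite scaler0.
Qed.

Lemma insum_inj0 (G : nat -> ser V) : (forall l, (0 < l)%N -> G l = 0) -> insum G = G 0%N.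
Proof.
move=> G0; apply/funext => m; rewrite /insum big_ord_recl subn0 big1 ?addr0 // => i _.
by rewrite G0.
Qed.

End SerLmodule.

Section SeriesLinear.
Variables (k : fieldType).

(* [k[[hbar]]]-linear and continuous maps. *)
Definition serlin (V W : lmodType k) (T : ser V -> ser W) :=
  linear T /\ forall G, T (insum G) = insum (fun l => T (G l)).

Lemma serlin_comp (V W X : lmodType k) (S : ser W -> ser X) (T : ser V -> ser W) :
  serlin S -> serlin T -> serlin (fun a => S (T a)).
Proof.
move=> [lS cS] [lT cT]; split=> [x u v|G]; first by rewrite lT lS.
by rewrite cT cS.
Qed.

Lemma eq_serlin (V W : lmodType k) (S T : ser V -> ser W) :
  serlin S -> serlin T -> (forall v, S (cst v) = T (cst v)) -> S =1 T.
Proof.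
move=> [_ cS] [_ cT] ST a; rewrite (ser_expand a) cS cT.
by apply: eq_insum.
Qed.

Lemma serlin_mulNh (V W : lmodType k) (T : ser V -> ser W) e a :
  serlin T -> T (mulNh e a) = mulNh e (T a).
Proof.
move=> [lT cT]; rewrite mulNh_insum cT [RHS]mulNh_insum.
by apply: eq_insum => l; case: ifP => _; rewrite ?(linf0 lT) ?(linfZ lT).
Qed.
Variables (V W : lmodType k).

(** The map of power series determined by a series [T] of maps, as for bold letters in the
    statement. *)
Definition hat (T : nat -> V -> W) (a : ser V) : ser W :=
  insum (fun l m => T m (a l)).

Lemma hatE T a m : hat T a m = \sum_(l < m.+1) T (m - l)%N (a l).
Proof. by []. Qed.

Lemma hat_serlin T : (forall m, linear (T m)) -> serlin (hat T).
Proof.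
move=> lT; split=> [x u v|G].
  rewrite /hat -insumZ -insumD; apply: eq_insum => l; apply/funext => m.
  by rewrite serD serZ serD serZ lT.
rewrite /hat -insum_conv; apply: eq_insum => l; apply/funext => m.
by rewrite (linf_sum (lT m)) ser_sum.
Qed.

Lemma hat_cst T v : (forall m, linear (T m)) -> hat T (cst v) = T^~ v.
Proof.
move=> lT; rewrite /hat insum_inj0; first by apply/funext.
by move=> l l0; apply/funext => m; rewrite cstE eqn0Ngt l0 (linf0 (lT m)).
Qed.

Lemma hat0 T a : hat T a 0%N = T 0%N (a 0%N).
Proof. by rewrite hatE big_ord1. Qed.

End SeriesLinear.

Lemma mulNh_serlin (k : fieldType) (V : lmodType k) e : serlin (mulNh e : ser V -> ser V).
Proof.
suff -> : mulNh e = hat (fun m (v : V) => if m == e then (-1) ^+ e *: v else 0).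
  apply: hat_serlin => m a u v; case: ifP => _; last by rewrite scaler0 addr0.
  by rewrite linearP.
apply/funext => a; apply/funext => m; rewrite hatE mulNhE; case: ltnP => [me|em].
  rewrite big1 // => l _; case: eqP => // E; move: me; rewrite -E.
  by have := ltn_ord l; lia.
have lt_me : (m - e < m.+1)%N by rewrite ltnS leq_subr.
rewrite (bigD1 (Ordinal lt_me)) //= subKn // eqxx big1 ?addr0 // => l.
rewrite -val_eqE /= => /eqP lne; case: eqP => // E; case: lne; rewrite -E.
by rewrite subKn // -ltnS.
Qed.

Lemma serlin0 (k : fieldType) (V W : lmodType k) : serlin (fun _ : ser V => 0 : ser W).
Proof.
split=> [a u v|G]; first by rewrite scaler0 addr0.
by apply/funext => m; rewrite /insum big1.
Qed.

Section SerRing.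
Variables (k : fieldType) (A : algType k).
Implicit Types a b c : ser A.

Definition ser_one : ser A := cst 1.

(** The Cauchy product [sermul], in a form to which the lemmas on [insum] apply. *)
Definition ser_mul a b : ser A := insum (fun l m => a l * b m).

Lemma ser_mul_linl b : linear (ser_mul^~ b).
Proof.
move=> x u v; rewrite /ser_mul -insumZ -insumD; apply: eq_insum => l.
by apply/funext => m; rewrite !(serD, serZ) mulrDl scalerAl.
Qed.

Lemma ser_mul_linr a : linear (ser_mul a).
Proof.
move=> x u v; rewrite /ser_mul -insumZ -insumD; apply: eq_insum => l.
by apply/funext => m; rewrite !(serD, serZ) mulrDr scalerAr.
Qed.

Fact ser_mulA : associative ser_mul.
Proof.
move=> a b c; pose S i j : ser A := fun m => a i * b j * c m.
rewrite [RHS](_ : _ = insum (fun l => \sum_(i < l.+1) S i (l - i)%N)); last first.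
  by apply: eq_insum => l; apply/funext => m; rewrite ser_sum mulr_suml.
rewrite insum_conv; apply: eq_insum => l; apply/funext => m.
by rewrite /S /ser_mul /insum mulr_sumr; apply: eq_bigr => i _; rewrite mulrA.
Qed.

Fact ser_mul1 : left_id ser_one ser_mul.
Proof.
move=> a; rewrite /ser_mul insum_inj0 => [|l l0].
  by apply/funext => m; rewrite mul1r.
by apply/funext => m; rewrite /ser_one cstE eqn0Ngt l0 mul0r.
Qed.

Fact ser_mulr1 : right_id ser_one ser_mul.
Proof.
move=> a; rewrite [RHS]ser_expand; apply: eq_insum => l; apply/funext => m.
by rewrite /ser_one !cstE; case: eqP => _; rewrite ?mulr1 ?mulr0.
Qed.

Fact ser_mulDl : left_distributive ser_mul +%R.
Proof. by move=> a b c; apply: linfD (ser_mul_linl c) _ _. Qed.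

Fact ser_mulDr : right_distributive ser_mul +%R.
Proof. by move=> a b c; apply: linfD (ser_mul_linr a) _ _. Qed.

Fact ser_one_neq0 : ser_one != 0.
Proof.
apply/eqP => /(congr1 (fun a : ser A => a 0%N)) /eqP.
by rewrite /ser_one cstE ser0 oner_eq0.
Qed.
HB.instance Definition _ := GRing.Zmodule_isNzRing.Build (ser A)
  ser_mulA ser_mul1 ser_mulr1 ser_mulDl ser_mulDr ser_one_neq0.

Fact ser_scaleAl (x : k) a b : x *: (a * b) = (x *: a) * b.
Proof. exact: esym (linfZ (ser_mul_linl b) x _). Qed.
HB.instance Definition _ := GRing.Lmodule_isLalgebra.Build k (ser A) ser_scaleAl.

Fact ser_scaleAr (x : k) a b : x *: (a * b) = a * (x *: b).
Proof. exact: esym (linfZ (ser_mul_linr a) x _). Qed.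
HB.instance Definition _ := GRing.Lalgebra_isAlgebra.Build k (ser A) ser_scaleAr.

Lemma serM a b m : (a * b) m = \sum_(l < m.+1) a l * b (m - l)%N.
Proof. by []. Qed.

Lemma serM0 a b : (a * b) 0%N = a 0%N * b 0%N.
Proof. by rewrite serM big_ord1. Qed.

Lemma ser1 : (1 : ser A) = cst 1. Proof. by []. Qed.

Lemma mulr_serlin a : serlin ( *%R a : ser A -> ser A).
Proof.
split=> [|G]; first exact: ser_mul_linr.
rewrite -[LHS]/(ser_mul a (insum G)) -[in RHS]/(ser_mul) /ser_mul.
pose S i j : ser A := fun m => a i * G j m.
transitivity (insum (fun i => insum (S i))).
  by apply: eq_insum => i; apply/funext => m; rewrite /S /insum mulr_sumr.
transitivity (insum (fun j => insum (S^~ j))); last by [].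
rewrite -!insum_conv; apply: eq_insum => l.
rewrite [RHS](reindex_inj rev_ord_inj); apply: eq_bigr => i _ /=.
by rewrite subSS subKn // -ltnS.
Qed.

Lemma mull_serlin b : serlin (fun a : ser A => a * b).
Proof.
split=> [|G]; first exact: ser_mul_linl.
pose S i j : ser A := fun m => G i j * b m.
transitivity (insum (fun l => \sum_(i < l.+1) S i (l - i)%N)).
  by apply: eq_insum => l; apply/funext => m; rewrite ser_sum mulr_suml.
by rewrite insum_conv.
Qed.

Lemma mulNhAl e a b : mulNh e a * b = mulNh e (a * b) :> ser A.
Proof. exact: (serlin_mulNh _ _ (mull_serlin b)). Qed.

Lemma mulNhAr e a b : a * mulNh e b = mulNh e (a * b) :> ser A.
Proof. exact: (serlin_mulNh _ _ (mulr_serlin a)). Qed.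

Lemma cstM (u v : A) : cst u * cst v = cst (u * v) :> ser A.
Proof.
rewrite -[LHS]/(ser_mul _ _) /ser_mul insum_inj0 => [|l l0].
  by apply/funext => -[|m]; rewrite !cstE //= mulr0.
by apply/funext => m; rewrite cstE eqn0Ngt l0 mul0r.
Qed.

Lemma cstMl (u : A) a m : ((cst u : ser A) * a) m = u * a m.
Proof.
rewrite serM big_ord_recl subn0 big1 ?addr0 // => i _.
by rewrite cstE mul0r.
Qed.

Lemma cstMr (u : A) a m : (a * (cst u : ser A)) m = a m * u.
Proof.
rewrite serM big_ord_recr /= subnn big1 ?add0r // => i _.
by rewrite cstE subn_eq0 leqNgt ltn_ord mulr0.
Qed.

Lemma cst_prod (s : seq A) : (cst (\prod_(y <- s) y) : ser A) = \prod_(y <- s) cst y.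
Proof.
by elim: s => [|a s IH]; rewrite ?big_nil // !big_cons -IH cstM.
Qed.

End SerRing.

Section Homogeneous.
Variables (k : fieldType) (V : gradedLmodType k).

Definition homS i (a : ser V) := forall m, homog i (a m).

Lemma homogD i (u v : V) : homog i u -> homog i v -> homog i (u + v).
Proof. by move=> hu hv; rewrite -[u]scale1r; apply: homogP. Qed.

Lemma homogZ i c (u : V) : homog i u -> homog i (c *: u).
Proof. by move=> hu; rewrite -[_ *: _]addr0; apply: homogP => //; apply: homog0. Qed.

Lemma homogN i (u : V) : homog i u -> homog i (- u).
Proof. by rewrite -scaleN1r; apply: homogZ. Qed.

Lemma homog_sum i I (r : seq I) (P : pred I) (F : I -> V) :
  (forall j, P j -> homog i (F j)) -> homog i (\sum_(j <- r | P j) F j).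
Proof.
by move=> hF; apply: (big_ind (homog i)) => //; [apply: homog0|apply: homogD].
Qed.

Lemma homS_cst i v : homog i v -> homS i (cst v).
Proof. by move=> hv m; rewrite cstE; case: ifP => // _; apply: homog0. Qed.

Lemma homS0 i : homS i 0.
Proof. by move=> m; apply: homog0. Qed.

Lemma homSD i a b : homS i a -> homS i b -> homS i (a + b).
Proof. by move=> ha hb m; apply: homogD. Qed.

Lemma homSZ i c a : homS i a -> homS i (c *: a).
Proof. by move=> ha m; apply: homogZ. Qed.

Lemma homSN i a : homS i a -> homS i (- a).
Proof. by move=> ha m; apply: homogN. Qed.

Lemma homS_mulNh i e a : homS i a -> homS i (mulNh e a).
Proof.
move=> ha m; rewrite mulNhE; case: ifP => _; [exact: homog0|exact: homogZ].
Qed.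

Lemma homS_insum i G : (forall l, homS i (G l)) -> homS i (insum G).
Proof. by move=> hG m; apply: homog_sum => l _; apply: hG. Qed.

End Homogeneous.

Lemma homS_hat (k : fieldType) (V W : gradedLmodType k) i j (T : nat -> V -> W) a :
  (forall m, degree j (T m)) -> homS i a -> homS (i + j) (hat T a).
Proof. by move=> hT ha m; apply: homog_sum => l _; apply: hT. Qed.

Section HomogeneousAlgebra.
Variables (k : fieldType) (C : gradedComAlgType k).

Lemma homSM i j (a b : ser C) : homS i a -> homS j b -> homS (i + j) (a * b).
Proof. by move=> ha hb m; rewrite serM; apply: homog_sum => l _; apply: homogM. Qed.

Lemma homS1 : homS 0 (1 : ser C).
Proof. by rewrite ser1; apply: homS_cst; apply: homog1. Qed.

Lemma serC i j (a b : ser C) : homS i a -> homS j b ->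
  a * b = parity (i * j) *: (b * a).
Proof.
move=> ha hb; apply/funext => m; rewrite serZ !serM scaler_sumr.
rewrite [RHS](reindex_inj rev_ord_inj); apply: eq_bigr => l _ /=.
by rewrite subSS subKn -1?ltnS //; apply: gmulC.
Qed.

End HomogeneousAlgebra.

(** * Multilinear maps on power series *)

Section SlotMaps.
Variables (k : fieldType).

Definition mlin (V W : lmodType k) (F : seq V -> W) := forall s1 s2 (a : k) u v,
  F (s1 ++ (a *: u + v) :: s2) = a *: F (s1 ++ u :: s2) + F (s1 ++ v :: s2).

Definition mcont (V W : lmodType k) (F : seq (ser V) -> ser W) := forall s1 s2 G,
  F (s1 ++ insum G :: s2) = insum (fun l => F (s1 ++ G l :: s2)).
Variables V W : lmodType k.

Lemma mlin_serlin (F : seq (ser V) -> ser W) s1 s2 : mlin F -> mcont F ->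
  serlin (fun a => F (s1 ++ a :: s2)).
Proof. by move=> lF cF; split=> [a u v|G]; [apply: lF|apply: cF]. Qed.

(** The extension of [F] to series arguments that is hbar-linear in each slot when [F] is
    multilinear. *)
Fixpoint ser_eval (F : seq V -> ser W) (al : seq (ser V)) : ser W :=
  if al is a :: al' then insum (fun l => ser_eval (fun x => F (a l :: x)) al') else F [::].

Lemma eq_ser_eval F G al : F =1 G -> ser_eval F al = ser_eval G al.
Proof.
elim: al F G => [|a al IH] F G FG /=; first exact: FG.
by apply: eq_insum => l; apply: IH.
Qed.

Lemma ser_eval_comb (c : k) F G al :
  ser_eval (fun x => c *: F x + G x) al = c *: ser_eval F al + ser_eval G al.
Proof.
elim: al F G => [|a al IH] F G //=.
by rewrite -insumZ -insumD; apply: eq_insum => l; rewrite IH.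
Qed.

Lemma sev0 al : ser_eval (fun=> 0) al = 0.
Proof.
elim: al => //= a al IH; apply/funext => m; rewrite /insum big1 // => l _.
by rewrite IH.
Qed.

Lemma ser_eval_sum I (r : seq I) (F : I -> seq V -> ser W) al :
  ser_eval (fun x => \sum_(i <- r) F i x) al = \sum_(i <- r) ser_eval (F i) al.
Proof.
elim: r => [|i r IH].
  by rewrite big_nil (@eq_ser_eval _ (fun=> 0)) ?sev0 // => x; rewrite big_nil.
rewrite big_cons (@eq_ser_eval _ (fun x => 1 *: F i x + \sum_(i <- r) F i x)).
  by rewrite ser_eval_comb scale1r IH.
by move=> x; rewrite big_cons scale1r.
Qed.

Lemma mlin_cons (F : seq V -> ser W) a : mlin F -> mlin (fun x => F (a :: x)).
Proof. by move=> lF s1 s2; apply: (lF (a :: s1)). Qed.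

Lemma ser_eval_mlin F : mlin F -> mlin (ser_eval F).
Proof.
move=> lF s1 s2 c u v; elim: s1 F lF => [|a s1 IH] F lF /=.
  rewrite -insumZ -insumD; apply: eq_insum => l; rewrite -ser_eval_comb.
  by apply: eq_ser_eval => x; apply: (lF [::]).
rewrite -insumZ -insumD; apply: eq_insum => l; apply: IH.
exact: mlin_cons.
Qed.

Lemma ser_eval_mcont F : mlin F -> mcont (ser_eval F).
Proof.
move=> lF s1 s2 G; elim: s1 F lF => [|a s1 IH] F lF /=.
  rewrite -insum_conv; apply: eq_insum => l; rewrite -ser_eval_sum.
  apply: eq_ser_eval => x; rewrite /insum.
  have linF : linear (fun v => F (v :: x)) by move=> c u v; apply: (lF [::]).
  exact: (linf_sum linF).
have E l : ser_eval (fun x => F (a l :: x)) (s1 ++ insum G :: s2) =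
   insum (fun i => ser_eval (fun x => F (a l :: x)) (s1 ++ G i :: s2)).
  by rewrite IH //; apply: mlin_cons.
under eq_insum do rewrite E.
have insumC (S : nat -> nat -> ser W) :
    insum (fun i => insum (S i)) = insum (fun i => insum (S^~ i)).
  rewrite -!insum_conv; apply: eq_insum => l.
  rewrite [RHS](reindex_inj rev_ord_inj); apply: eq_bigr => i _ /=.
  by rewrite subSS subKn // -ltnS.
by rewrite insumC.
Qed.

Lemma ser_eval_cst F s : mlin F -> ser_eval F [seq cst v | v <- s] = F s.
Proof.
elim: s F => //= v s IH F lF; rewrite insum_inj0 => [|l l0].
  by rewrite IH //; apply: mlin_cons.
rewrite cstE eqn0Ngt l0 (@eq_ser_eval _ (fun=> 0)) ?sev0 // => x.
have linF : linear (fun v => F (v :: x)) by move=> c u u'; apply: (lF [::]).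
exact: (linf0 linF).
Qed.

Lemma ser_eval_0 F al : ser_eval F al 0%N = F [seq a 0%N | a <- al] 0%N.
Proof. by elim: al F => //= a al IH F; rewrite /insum big_ord1 IH. Qed.

End SlotMaps.

(* Families indexed by lists of vectors with a degree; [comb] is a linear
   combination or a power series, so that a single lemma on sums over splits
   covers linearity and continuity in each entry. *)
Section Slots.
Variables (k : fieldType) (V : Type) (W : lmodType k).
Variables (I : Type) (comb : (I -> W) -> W).

Definition is_comb := (forall F G, comb (fun i => F i + G i) = comb F + comb G) /\
  (forall c F, comb (fun i => c *: F i) = c *: comb F).
Variables (v0 : V) (v : I -> V).

Definition slot (F : seq (int * V) -> W) := forall s1 s2 e,
  F (s1 ++ (e, v0) :: s2) = comb (fun i => F (s1 ++ (e, v i) :: s2)).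

End Slots.

Section SlotUnsh.
Variables (k : fieldType) (V : eqType) (W : lmodType k).
Variables (I : Type) (comb : (I -> W) -> W) (v0 : V) (v : I -> V).
Hypothesis hcomb : is_comb comb.

Lemma comb_ext F G : (forall i, F i = G i) -> comb F = comb G.
Proof. by move=> /funext->. Qed.

Lemma comb_unsh (T : eqType) (d : T -> int) x (F : I -> seq T -> seq T -> W) :
  comb (fun i => unsh d x (F i)) = unsh d x (fun y z => comb (fun i => F i y z)).
Proof.
case: hcomb => combD combZ; elim: x F => //= a x IH F.
rewrite combD !IH; congr (_ + _); apply: eq_unsh => y z _; exact: combZ.
Qed.

Lemma comb_psum (T : eqType) (d : T -> int) x (G : I -> seq (seq T) -> W) :
  comb (fun i => psum d x (G i)) = psum d x (fun bs => comb (fun i => G i bs)).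
Proof.
elim/size_seq_ind: x G => [|x a IH] G //.
under comb_ext do rewrite psum_rcons.
rewrite comb_unsh psum_rcons; apply: eq_unsh => z y zy; apply: IH.
by case: (split_size zy).
Qed.

Lemma unsh_slot F :
  (forall z, slot comb v0 v (F^~ z)) -> (forall y, slot comb v0 v (F y)) ->
  slot comb v0 v (fun x => unsh fst x F : W).
Proof.
case: (hcomb) => combD combZ sl sr s1 s2 e.
rewrite unsh_cat; under [in RHS]comb_ext do rewrite unsh_cat.
rewrite comb_unsh; apply: eq_unsh => y1 z1 _ /=.
rewrite combD !comb_unsh; congr (_ + _); apply: eq_unsh => y2 z2 _.
  by rewrite (sl _ _ _ e) -combZ; apply: comb_ext => i; rewrite !dg_cons.
by rewrite (sr _ _ _ e) -!combZ.
Qed.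

Definition bslot (G : seq (seq (int * V)) -> W) := forall bs1 bs2 s1 s2 e,
  G (bs1 ++ (s1 ++ (e, v0) :: s2) :: bs2)
    = comb (fun i => G (bs1 ++ (s1 ++ (e, v i) :: s2) :: bs2)).

Lemma psum_slot G : bslot G -> slot comb v0 v (fun x => psum fst x G : W).
Proof.
move=> sG s1 s2 e; have [m] := ubnP (size (s1 ++ s2)).
elim: m => // m IH in s1 s2 e G sG *.
case: (lastP s2) => [|t b] sm.
  rewrite cats1 psum_rcons; under [in RHS]comb_ext do rewrite cats1 psum_rcons.
  rewrite comb_unsh; apply: eq_unsh => z y _; rewrite comb_psum.
  apply: eq_psum => bs _ _; rewrite -!cats1 (sG bs [::] y [::] e).
  by apply: comb_ext => i; rewrite !cats1.
rewrite -rcons_cons -rcons_cat psum_rcons.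
under [in RHS]comb_ext do rewrite -rcons_cons -rcons_cat psum_rcons.
(* [unsh_slot] asks for the slot property on lists of every length, the induction hypothesis gives
   it up to length [m] only; cutting off to 0 bridges the gap. *)
pose F z y := if (size z <= m)%N then
  psum fst z (fun bs => G (rcons bs (rcons y b))) else 0 : W.
have EF u : unsh fst (s1 ++ (e, u) :: t) (fun z y =>
    psum fst z (fun bs => G (rcons bs (rcons y b)))) = unsh fst (s1 ++ (e, u) :: t) F.
  apply: eq_unsh => z y /split_size[sz _]; rewrite /F ifT //.
  by move: sz sm; rewrite !size_cat /= size_rcons; lia.
have comb0 : comb (fun=> 0) = 0.
  by case: hcomb => _ combZ; rewrite -[RHS](scale0r (comb (fun=> 0))) -combZ;
     apply: comb_ext => i; rewrite scale0r.
rewrite EF (_ : comb _ = comb (fun i => unsh fst (s1 ++ (e, v i) :: t) F)); last first.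
  exact: comb_ext.
apply: unsh_slot => [y|z] r1 r2 e'; last first.
  rewrite /F; case: ifP => _ //; rewrite comb_psum; apply: eq_psum => bs _ _.
  rewrite -cats1 rcons_cat rcons_cons (sG bs [::]); apply: comb_ext => i.
  by rewrite cats1 rcons_cat rcons_cons.
rewrite /F size_cat /=; case: ifP => rm.
  rewrite IH; first by apply: comb_ext => i; rewrite size_cat /= rm.
    by move=> bs1 bs2 q1 q2 e''; rewrite !rcons_cat !rcons_cons sG; apply: comb_ext => i;
       rewrite !rcons_cat !rcons_cons.
  by move: rm; rewrite size_cat addnS.
by rewrite -[LHS]comb0; apply: comb_ext => i; rewrite size_cat /= rm.
Qed.

End SlotUnsh.

Section Multilinear.
Variables (k : fieldType) (V W : lmodType k).

Definition hlin (F : seq (int * V) -> W) := forall s1 s2 e (a : k) u v,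
  F (s1 ++ (e, a *: u + v) :: s2)
    = a *: F (s1 ++ (e, u) :: s2) + F (s1 ++ (e, v) :: s2).

Definition lin_comb (a : k) (F : bool -> W) : W := a *: F true + F false.

Lemma is_comb_lin a : is_comb (lin_comb a).
Proof.
split=> [F G|c F]; rewrite /lin_comb; first by rewrite scalerDr addrACA.
by rewrite scalerDr !scalerA mulrC.
Qed.

Lemma hlin_slot F : hlin F <-> forall a (u v : V),
  slot (lin_comb a) (a *: u + v) (fun b : bool => if b then u else v) F.
Proof. by split=> hF => [a u v s1 s2 e|s1 s2 e a u v]; rewrite hF. Qed.

Definition hblin (G : seq (seq (int * V)) -> W) := forall bs1 bs2 s1 s2 e (a : k) u v,
  G (bs1 ++ (s1 ++ (e, a *: u + v) :: s2) :: bs2)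
    = a *: G (bs1 ++ (s1 ++ (e, u) :: s2) :: bs2) + G (bs1 ++ (s1 ++ (e, v) :: s2) :: bs2).

Lemma unsh_hlin F : (forall z, hlin (F^~ z)) -> (forall y, hlin (F y)) ->
  hlin (fun x => unsh fst x F : W).
Proof.
move=> lF rF; apply/hlin_slot => a u v; apply: unsh_slot; first exact: is_comb_lin.
  by move=> z; move/hlin_slot: (lF z); apply.
by move=> y; move/hlin_slot: (rF y); apply.
Qed.

Lemma psum_hlin G : hblin G -> hlin (fun x => psum fst x G : W).
Proof.
move=> lG; apply/hlin_slot => a u v; apply: psum_slot; first exact: is_comb_lin.
by move=> bs1 bs2 s1 s2 e; rewrite lG.
Qed.

End Multilinear.

Section Continuous.
Variables (k : fieldType) (V W : lmodType k).

Definition hcont (F : seq (int * ser V) -> ser W) := forall s1 s2 e G,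
  F (s1 ++ (e, insum G) :: s2) = insum (fun l => F (s1 ++ (e, G l) :: s2)).

Lemma is_comb_insum : is_comb (@insum W).
Proof. by split=> [F G|c F]; rewrite ?insumD ?insumZ. Qed.

Lemma unsh_hcont F : (forall z, hcont (F^~ z)) -> (forall y, hcont (F y)) ->
  hcont (fun x => unsh fst x F).
Proof.
move=> lF rF s1 s2 e G; apply: (@unsh_slot _ _ _ _ (@insum W) (insum G) G).
- exact: is_comb_insum.
- by move=> z r1 r2 e'; apply: lF.
- by move=> y r1 r2 e'; apply: rF.
Qed.

End Continuous.

(** The identities to be extended hold for homogeneous vectors only. Series are therefore expanded
    one slot at a time, each coefficient inheriting the degree of its series, behind a prefix of
    constants. *)
Lemma eq_hcont (k : fieldType) (V : gradedLmodType k) (W : lmodType k)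
    (F G : seq (int * ser V) -> ser W) : hcont F -> hcont G ->
  (forall x : seq (hvec V), homogs x ->
     F [seq (y.1, cst y.2) | y <- x] = G [seq (y.1, cst y.2) | y <- x]) ->
  forall al, (forall a, a \in al -> homS a.1 a.2) -> F al = G al.
Proof.
move=> cF cG FG al hal.
suff FGx x : homogs x -> F ([seq (y.1, cst y.2) | y <- x] ++ al)
    = G ([seq (y.1, cst y.2) | y <- x] ++ al) by apply: (FGx [::]).
elim: al hal x => [|[e a] al IH] hal x hx; first by rewrite cats0 FG.
rewrite (ser_expand a) cF cG; apply: eq_insum => l.
have -> : [seq (y.1, cst y.2) | y <- x] ++ (e, cst (a l)) :: al
  = [seq (y.1, cst y.2) | y <- rcons x (e, a l)] ++ al.
  by rewrite map_rcons cat_rcons.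
apply: IH => [b bal|y]; first by apply: hal; rewrite in_cons bal orbT.
rewrite mem_rcons in_cons => /predU1P[->|/hx//]; exact: (hal (e, a) (mem_head _ _) l).
Qed.

(** * The quantum descendant on power series *)

Lemma homogs_cat (k : fieldType) (V : gradedLmodType k) (x y : seq (hvec V)) :
  homogs (x ++ y) <-> homogs x /\ homogs y.
Proof.
split=> [h|[hx hy] a]; last by rewrite mem_cat => /orP[/hx|/hy].
by split=> a ax; apply: h; rewrite mem_cat ax ?orbT.
Qed.

Lemma homogs_perm (k : fieldType) (V : gradedLmodType k) (x y : seq (hvec V)) :
  perm_eq x y -> homogs y -> homogs x.
Proof. by move=> xy hy a; rewrite (perm_mem xy); apply: hy. Qed.

Lemma homogs_split (k : fieldType) (V : gradedLmodType k) (x y z : seq (hvec V)) :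
  perm_eq (y ++ z) x -> homogs x -> homogs y /\ homogs z.
Proof. by move=> yz hx; apply/homogs_cat; apply: homogs_perm yz hx. Qed.

Lemma homogs_rcons (k : fieldType) (V : gradedLmodType k) (x : seq (hvec V)) a :
  homogs (rcons x a) <-> homogs x /\ homog a.1 a.2.
Proof.
rewrite -cats1; split=> [/homogs_cat[hx ha]|[hx ha]].
  by split=> //; apply: ha; rewrite mem_head.
by apply/homogs_cat; split=> // b; rewrite in_cons orbF => /eqP->.
Qed.

Section Descendant.
Variables (k : fieldType) (A : binary_QFT_algebra k).
Implicit Types (x : seq (hvec A)) (bs : seq (seq (hvec A))).

(** The convention ell_0 = 0 lets sums over splits include the empty choice of arguments of ell. *)
Definition ellS (vs : seq A) : ser A :=
  fun m => if vs is [::] then 0 else bqa_ell A (size vs) m vs.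

Definition lhat (al : seq (ser A)) : ser A := ser_eval ellS al.

Definition Khat : ser A -> ser A := hat (bqa_K A).

Definition hprod x : A := \prod_(y <- x) y.2.

Lemma ellS_mlin : mlin ellS.
Proof.
move=> s1 s2 c u v; apply/funext => m.
have [lin _ _] := @bqa_SHom k A (size s1 + size s2).+1 m isT.
have E w : ellS (s1 ++ w :: s2) m
    = bqa_ell A (size s1 + size s2).+1 m (s1 ++ w :: s2).
  by rewrite -addnS -[(size s2).+1]/(size (w :: s2)) -size_cat; case: (s1).
by rewrite serD serZ !E lin.
Qed.

Lemma homS_ellS x : homogs x -> homS (dg fst x + 1) (ellS (vects x)).
Proof.
case: x => [|a x] hx m; first exact: homog0.
have [_ hdeg _] := @bqa_SHom k A (size (a :: x)) m isT.
by have := hdeg (a :: x) erefl hx; rewrite /ellS /= /vects size_map.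
Qed.

Lemma hprod_rcons x a : hprod (rcons x a) = hprod x * a.2.
Proof. by rewrite /hprod -cats1 big_cat big_seq1. Qed.

Lemma homog_hprod x : homogs x -> homog (dg fst x) (hprod x).
Proof.
elim: x => [|a x IH] hx; first by rewrite dg_nil /hprod big_nil; apply: homog1.
rewrite dg_cons /hprod big_cons; apply: homogM; first by apply: hx; rewrite mem_head.
by apply: IH => b bx; apply: hx; rewrite in_cons bx orbT.
Qed.

Lemma hprod_Jv x : hprod (map (@Jv k A) x) = parity (dg fst x) *: hprod x.
Proof.
elim: x => [|a x IH]; first by rewrite dg_nil parity0 scale1r.
rewrite /hprod !big_cons dg_cons parityD -/(hprod _) IH /= -scalerAl -scalerAr scalerA.
by rewrite mulrC.
Qed.

Definition dterm bs i : ser A :=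
  mulNh (size (flatten bs) - size bs)
    (cst (hprod (map (@Jv k A) (flatten (take i bs))))
     * ellS (vects (nth [::] bs i)) * cst (hprod (flatten (drop i.+1 bs)))).

Definition dcond bs i := size (nth [::] bs i) == (size (flatten bs) - size bs + 1)%N.

Definition dsum bs : ser A := \sum_(i < size bs | dcond bs i) dterm bs i.

Lemma size_flatten_ge bs :
  [::] \notin bs -> (size bs <= size (flatten bs))%N.
Proof.
elim: bs => //= b bs IH; rewrite in_cons negb_or size_cat => /andP[b0 /IH].
by case: b b0 => // a b _ /=; lia.
Qed.

Lemma size_nth_flatten bs i :
  [::] \notin bs -> (i < size bs)%N ->
  (size (nth [::] bs i) + (size bs).-1 <= size (flatten bs))%N.
Proof.
elim: bs i => //= b bs IH i; rewrite in_cons negb_or size_cat => /andP[b0 bs0].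
have := size_flatten_ge bs0; have : (0 < size b)%N by case: b b0.
by case: i => [|i] /=; [lia|rewrite ltnS => ? ? /(IH _ bs0); lia].
Qed.

(** The condition on the size of B_i forces all other blocks to be singletons. An index before the
    last one thus needs [c] to be a singleton, and the last index needs [bs] to consist of
    singletons. *)
Lemma dsum_rcons bs (c : seq (hvec A)) : [::] \notin bs -> c != [::] ->
  dsum (rcons bs c) =
    (if size c == 1%N then dsum bs * cst (hprod c) else 0)
    + (if size bs == size (flatten bs) then
         mulNh (size c).-1 (cst (hprod (map (@Jv k A) (flatten bs))) * ellS (vects c))
       else 0).
Proof.
move=> bs0 c0; have sc : (0 < size c)%N by case: c c0.
have sbs := size_flatten_ge bs0.
have fl : flatten (rcons bs c) = flatten bs ++ c by rewrite -cats1 flatten_cat /= cats0.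
rewrite /dsum size_rcons big_mkcond big_ord_recr /=; congr (_ + _).
- case: ifPn => [/eqP c1|c1].
    rewrite mulr_suml [RHS]big_mkcond; apply: eq_bigr => i _ /=.
    have li := ltn_ord i.
    rewrite /dcond fl nth_rcons li size_cat size_rcons c1.
    have -> : (size (flatten bs) + 1 - (size bs).+1 = size (flatten bs) - size bs)%N.
      by lia.
    case: ifP => // _; rewrite /dterm fl size_cat size_rcons c1.
    have -> : (size (flatten bs) + 1 - (size bs).+1 = size (flatten bs) - size bs)%N.
      by lia.
    rewrite mulNhAl; congr mulNh.
    rewrite nth_rcons li -[RHS]mulrA cstM; congr (cst (hprod _) * _ * cst _).
      by rewrite -cats1 takel_cat // ltnW.
    by rewrite drop_rcons // -cats1 flatten_cat /= cats0 /hprod big_cat.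
  rewrite big1 // => i _; case: ifP => //; rewrite /dcond fl nth_rcons ltn_ord.
  rewrite size_cat size_rcons => /eqP E; exfalso.
  by have := size_nth_flatten bs0 (ltn_ord i); have := ltn_ord i; lia.
- rewrite /dcond fl nth_rcons ltnn eqxx size_cat size_rcons.
  have -> : (size c == size (flatten bs) + size c - (size bs).+1 + 1)%N
          = (size bs == size (flatten bs)) by apply/eqP/eqP; lia.
  case: eqP => // E; rewrite /dterm fl size_cat size_rcons nth_rcons ltnn eqxx.
  rewrite drop_oversize ?size_rcons // -cats1 take_size_cat //.
  rewrite [hprod (flatten [::])]/hprod big_nil -ser1 mulr1; congr mulNh.
  by rewrite -E; lia.
Qed.

Definition descendant x : ser A :=
  unsh fst x (fun y z => mulNh (size y).-1 (ellS (vects y)) * cst (hprod z)).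

(** All blocks but B_i being singletons, a pair (partition, i) amounts to the sublist of arguments
    of ell. The signs from J are absorbed when ell, of degree 1, moves to the front. *)
Lemma psum_dsum x : homogs x -> psum fst x dsum = descendant x.
Proof.
elim/size_seq_ind: x => [|x a IH] hx.
  rewrite psum_nil /dsum big_ord0 /descendant /= mulNh0.
  have -> : ellS (vects [::]) = 0 by [].
  by rewrite mul0r.
have [hx' ha] := (homogs_rcons _ _).1 hx.
rewrite psum_rcons /descendant unsh_rcons.
have E z y : perm_eq (z ++ y) x ->
  psum fst z (fun bs => dsum (rcons bs (rcons y a))) =
  (if y is [::] then psum fst z dsum * cst a.2 else 0)
  + parity (dg fst z) *: mulNh (size y) (cst (hprod z) * ellS (vects (rcons y a))).
  move=> zy; pose P : ser A :=
    mulNh (size y) (cst (hprod (map (@Jv k A) z)) * ellS (vects (rcons y a))).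
  rewrite (eq_psum (G := fun bs =>
     (if y is [::] then dsum bs * cst a.2 else 0) +
     (if size bs == size z then mulNh (size y)
        (cst (hprod (map (@Jv k A) (flatten bs))) * ellS (vects (rcons y a))) else 0))).
    rewrite psumD psum_singletons; congr (_ + _).
      case: y {zy P} => [|b y]; last exact: psum0.
      rewrite (psum_linear (L := fun u => u * cst a.2)) //.
      by case: (mull_serlin (cst a.2 : ser A)).
    have -> : flatten [seq [:: a0] | a0 <- z] = z by elim: (z) => //= b u ->.
    rewrite hprod_Jv (linfZ (@cst_linear _ _)) -scalerAl.
    exact: (linfZ (@mulNh_linear _ _ _)).
  move=> bs bsz bs0; rewrite dsum_rcons //; last by case: (y).
  rewrite (perm_size bsz) size_rcons eqSS; congr (_ + _).
  by case: (y) => [|b y'] //=; rewrite /hprod big_seq1.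
rewrite (eq_unsh E) unshD addrC; congr (_ + _).
  rewrite unshC; apply: eq_unsh => y z zy.
  have [hy hz] := homogs_split zy hx'.
  have hya : homogs (rcons y a) by apply/homogs_rcons.
  rewrite size_rcons mulNhAl -(linfZ (@mulNh_linear _ _ _)).
  rewrite -!(linfZ (@mulNh_linear _ _ _)); congr mulNh.
  rewrite (serC (homS_cst (homog_hprod hz)) (homS_ellS hya)) !scalerA -!parityD.
  congr (_ *: _); rewrite dg_rcons; apply: (parity_congr (dg fst y * dg fst z + dg fst z)).
  by ring.
rewrite unsh_left => [|y z yz z0]; last by case: z z0 {yz}.
rewrite IH // /descendant.
rewrite (unsh_linear (L := fun u => u * cst a.2)); last first.
  by case: (mull_serlin (cst a.2 : ser A)).
by apply: eq_unsh => y z _; rewrite hprod_rcons -mulrA cstM.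
Qed.

Lemma descendant_rhsE x m : descendant_rhs (bqa_ell A) x m =
  psum (posdeg x) (iota 0 (size x)) (fun ps => dsum [seq subv x b | b <- ps]) m.
Proof.
rewrite -(@sum_parts _ _ _ (size x) x (fun ps => dsum [seq subv x b | b <- ps])) ser_sum.
apply: eq_bigr => P Pn.
have fl : size (flatten [seq subv x b | b <- blocks P]) = size x.
  rewrite size_flatten /shape -map_comp (eq_map (g := size)); last exact: size_subv.
  by rewrite -[sumn _]size_flatten (perm_size (perm_flatten_blocks Pn)) size_iota.
rewrite serZ /dsum ser_sum scaler_sumr.
rewrite -(big_mkord (fun i => size (nth [::] (blocks P) i) == (size x - #|P| + 1)%N)
  (fun i => mulNh (size x - #|P|) (fun m' => epsilon x P *:
    (\prod_(y <- flatten [seq map (@Jv k A) (subv x b) | b <- take i (blocks P)]) y.2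
     * bqa_ell A (size (nth [::] (blocks P) i)) m' (vects (subv x (nth [::] (blocks P) i)))
     * \prod_(y <- flatten [seq subv x b | b <- drop i.+1 (blocks P)]) y.2)) m)).
rewrite -(big_mkord (dcond [seq subv x b | b <- blocks P])
  (fun i => epsilon x P *: dterm [seq subv x b | b <- blocks P] i m)).
rewrite size_map size_blocks big_nat_cond [RHS]big_nat_cond.
have nthE i : (i < #|P|)%N -> nth [::] [seq subv x b | b <- blocks P] i
    = subv x (nth [::] (blocks P) i).
  by move=> iP; rewrite (nth_map [::]) // size_blocks.
apply: eq_big => i.
  case: (ltnP i #|P|) => //= iP.
  by rewrite /dcond nthE // size_subv fl size_map size_blocks.
move=> /andP[/andP[_ iP] /eqP si]; rewrite /dterm nthE // fl size_map size_blocks.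
rewrite !mulNhE; case: ifP => _; first by rewrite scaler0.
rewrite scalerA [RHS]scalerA [in LHS]mulrC; congr (_ *: _).
rewrite cstMr cstMl /hprod -map_take -map_drop; congr (_ * _ * _).
- by rewrite map_flatten -map_comp.
(* The size condition rules out an empty block, the only place where [ellS] and [bqa_ell] could
   differ. *)
- move: si; case: (nth _ _ _) => [|j b]; first by rewrite addn1.
  by move=> _; rewrite /ellS /= size_map size_map.
Qed.

Lemma homS_lhat (al : seq (int * ser A)) : (forall a, a \in al -> homS a.1 a.2) ->
  homS (dg fst al + 1) (lhat (map snd al)).
Proof.
rewrite /lhat; have := homS_ellS; move: ellS => F.
elim: al F 1 => [|[e a] al IH] F j hF hal.
  by rewrite dg_nil /= -[0](dg_nil (fst : hvec A -> int)); apply: (hF [::]).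
rewrite dg_cons /=; apply: homS_insum => l.
rewrite [e + _]addrC -addrA; apply: IH => [x hx|b bal]; last first.
  by apply: hal; rewrite in_cons bal orbT.
rewrite addrA [_ + e]addrC -[e + _]/((e, a l).1 + dg fst x) -dg_cons.
apply: (hF ((e, a l) :: x)) => y; rewrite in_cons => /predU1P[->|/hx//].
exact: (hal (e, a) (mem_head _ _) l).
Qed.

Lemma Khat_hprod x : homogs x -> Khat (cst (hprod x)) = descendant x.
Proof.
move=> hx; have lK m : linear (bqa_K A m) by apply: linearP.
rewrite /Khat hat_cst //.
case: x hx => [|a x] hx.
  apply/funext => m; rewrite /hprod big_nil bqa_K1 /descendant /= mulNh0.
  by rewrite (_ : ellS _ = 0) ?mul0r.
rewrite -psum_dsum // -psum_subv; apply/funext => m.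
by rewrite -descendant_rhsE -bqa_descendant.
Qed.

Lemma Khat_serlin : serlin Khat.
Proof. by apply: hat_serlin => m; apply: linearP. Qed.

Lemma lhat_mlin : mlin lhat.
Proof. exact: ser_eval_mlin ellS_mlin. Qed.

Lemma lhat_mcont : mcont lhat.
Proof. exact: ser_eval_mcont ellS_mlin. Qed.

Lemma lhat_mulNh s1 s2 e a : lhat (s1 ++ mulNh e a :: s2) = mulNh e (lhat (s1 ++ a :: s2)).
Proof.
exact: (serlin_mulNh _ _ (mlin_serlin s1 s2 lhat_mlin lhat_mcont)).
Qed.

Lemma lhat_mulNhs (T : Type) (e : T -> nat) (a : T -> ser A) (s : seq T) al :
  lhat ([seq mulNh (e b) (a b) | b <- s] ++ al)
    = mulNh (\sum_(b <- s) e b) (lhat ([seq a b | b <- s] ++ al)).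
Proof.
rewrite -[_ ++ al]cat0s -[_ ++ al in RHS]cat0s.
elim: s [::] => [|b s IH] r; first by rewrite big_nil mulNh0.
by rewrite /= lhat_mulNh -cat_rcons IH cat_rcons mulNhM big_cons.
Qed.

Lemma lhat_cst vs : lhat [seq cst v | v <- vs] = ellS vs.
Proof. exact: ser_eval_cst ellS_mlin. Qed.

(** Both sides are continuous in each factor, so [eq_hcont] reduces to constants, where this is the
    recursion defining the descendant. *)
Lemma Khat_prod (al : seq (int * ser A)) : (forall a, a \in al -> homS a.1 a.2) ->
  Khat (\prod_(a <- al) a.2) = unsh fst al (fun y z =>
    mulNh (size y).-1 (lhat (map snd y)) * \prod_(a <- z) a.2).
Proof.
have pc : hcont (fun z : seq (int * ser A) => \prod_(a <- z) a.2).
  move=> s1 s2 e G; rewrite big_cat big_cons /=.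
  have [_ cl] := mull_serlin (\prod_(a <- s2) a.2).
  have [_ cr] := mulr_serlin (\prod_(a <- s1) a.2).
  rewrite cl cr; apply: eq_insum => l.
  by rewrite big_cat big_cons.
move: al; apply: (@eq_hcont k A A (fun al => Khat (\prod_(a <- al) a.2))
  (fun al => unsh fst al (fun y z =>
    mulNh (size y).-1 (lhat (map snd y)) * \prod_(a <- z) a.2))).
- move=> s1 s2 e G; rewrite pc; case: Khat_serlin => _; exact.
- apply: unsh_hcont => [z|y] s1 s2 e G.
    have [_ cl] := mull_serlin (\prod_(a <- z) a.2).
    have [_ cN] := @mulNh_serlin k A (size (s1 ++ (e, insum G) :: s2)).-1.
    rewrite map_cat lhat_mcont cN cl; apply: eq_insum => l.
    by rewrite map_cat !size_cat.
  have [_ cr] := mulr_serlin (mulNh (size y).-1 (lhat (map snd y))).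
  by rewrite pc cr.
- move=> x hx; have := Khat_hprod hx.
  rewrite /hprod -(big_map snd predT id) cst_prod !big_map => ->.
  rewrite (unsh_map (d := fst)) // /descendant; apply: eq_unsh => y z _.
  rewrite size_map -map_comp /hprod -(big_map snd predT id) cst_prod !big_map.
  by rewrite -lhat_cst -map_comp.
Qed.

End Descendant.

(** * The canonical families *)

Section Closed.
Variables (k : fieldType) (T : eqType) (d : T -> int) (W : lmodType k) (P : W -> Prop).
Hypotheses (PD : forall u v, P u -> P v -> P (u + v)) (PZ : forall c u, P u -> P (c *: u)).

Lemma unsh_closed x F : (forall y z, perm_eq (y ++ z) x -> P (F y z)) -> P (unsh d x F).
Proof.
elim: x F => [|a x IH] F PF /=; first exact: PF.
apply: PD; apply: IH => y z yz; first by apply: PF; rewrite /= perm_cons.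
by apply: PZ; apply: PF; rewrite perm_catC /= perm_cons perm_catC.
Qed.

Lemma psum_closed x G : (forall bs, perm_eq (flatten bs) x -> [::] \notin bs -> P (G bs)) ->
  P (psum d x G).
Proof.
elim/size_seq_ind: x G => [|x a IH] G PG; first exact: PG.
rewrite psum_rcons; apply: unsh_closed => z y zy.
apply: IH => [|bs bsz bs0]; first by case: (split_size zy).
apply: PG.
  rewrite -cats1 flatten_cat /= cats0 -rcons_cat -!cats1 perm_cat2r.
  by apply: perm_trans zy; rewrite perm_cat2r.
by rewrite mem_rcons inE negb_or bs0; case: y {zy}.
Qed.

End Closed.

Section SolvingByNabla.
Variables (k : fieldType) (A : binary_QFT_algebra k) (R : retract A).
Hypothesis hA : anomaly_free R.
Let H : gradedLmodType k := classical_cohomology A.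
Let K : ser {linear A -> A} := bqa_K A.
Let f := rt_f R.
Let h := rt_h R.
Let s := rt_s R.

Lemma fser0 v : fser R 0 v = f v.
Proof. by rewrite /fser fkappaE. Qed.

(** With kappa = 0 the second sum in g^(n) consists of values f^(n-j)(0), which vanish by linearity
    at smaller indices; hence the joint induction. The vanishing under [h] is kappa^(n) = 0. *)
Lemma fser_linear_rec n :
  linear (fser R n) /\ ((0 < n)%N -> forall v,
    fser R n v = - s (\sum_(j < n) K (n - j)%N (fser R j v))
    /\ h (\sum_(j < n) K (n - j)%N (fser R j v)) = 0).
Proof.
have [m] := ubnP n; elim: m n => // m IH n nm.
have lin_lt j : (j < n)%N -> linear (fser R j) by move=> jn; apply: (IH j _).1; lia.
have gE v : anomaly_g (fkappa R) n v = \sum_(j < n) K (n - j)%N (fser R j v).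
  rewrite /anomaly_g big_mkord big_nat_cond [X in _ - X]big1 ?subr0 // => j.
  move=> /andP[/andP[j0 jn] _]; rewrite -/(kappa R j v) hA //.
  by rewrite -/(fser R (n - j)%N) (linf0 (lin_lt _ _)) // ltn_subrL j0 (leq_trans _ jn).
have nE : (0 < n)%N -> forall v,
    fser R n v = - s (\sum_(j < n) K (n - j)%N (fser R j v))
    /\ h (\sum_(j < n) K (n - j)%N (fser R j v)) = 0.
  move=> n0 v; rewrite -!gE; split.
    by rewrite {1}/fser fkappaE /anomaly_step eqn0Ngt n0.
  by have := hA v n0; rewrite /kappa fkappaE /anomaly_step eqn0Ngt n0.
split=> //; have [->|n0] := posnP n; first by move=> a u v; rewrite !fser0 linearP.
have lG : linear (fun v => \sum_(j < n) K (n - j)%N (fser R j v)).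
  move=> a u v; rewrite scaler_sumr -big_split; apply: eq_bigr => j _ /=.
  by rewrite lin_lt // linearP.
by move=> a u v; rewrite !(nE n0 _).1 lG linearP opprD scalerN.
Qed.

Lemma fser_linear n : linear (fser R n).
Proof. exact: (fser_linear_rec n).1. Qed.

Definition fhat : ser H -> ser A := hat (fser R).

Lemma fhat_serlin : serlin fhat.
Proof. exact: hat_serlin fser_linear. Qed.

Lemma fhat_cst v : fhat (cst v) = fser R ^~ v.
Proof. exact: hat_cst fser_linear. Qed.

Lemma Khat_linear : linear (@Khat k A).
Proof. by case: (@Khat_serlin k A). Qed.

Lemma Khat_cst v : Khat (cst v) = (fun m => K m v) :> ser A.
Proof. by apply: hat_cst => m; apply: linearP. Qed.

Lemma KhatK a : Khat (Khat a) = 0 :> ser A.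
Proof.
apply: (eq_serlin (serlin_comp (@Khat_serlin k A) (@Khat_serlin k A)) (serlin0 A A)).
move=> v; rewrite Khat_cst; apply/funext => m; rewrite /Khat hatE.
rewrite -[RHS](bqa_KK m v) [RHS](reindex_inj rev_ord_inj); apply: eq_bigr => i _ /=.
by rewrite subSS subKn // -ltnS.
Qed.

(** Let c = K f(v) and g = g^(n), so that c_n = g - K_0 s g. If the lower coefficients of c vanish,
    K c = 0 gives K_0 c_n = 0, hence K_0 g = 0. Together with h g = 0 the retract identity becomes g
    = K_0 s g, so c_n = 0. *)
Lemma Khat_fhat b : Khat (fhat b) = 0.
Proof.
apply: (eq_serlin (serlin_comp (@Khat_serlin k A) fhat_serlin) (serlin0 H A)).
move=> v; rewrite fhat_cst; set c := Khat _; have Kc : Khat c = 0 by apply: KhatK.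
suff c0 n : c n = 0 by apply/funext.
have [m] := ubnP n; elim: m n => // m IH n nm.
have : Khat c n = 0 by rewrite Kc.
rewrite /Khat hatE big_ord_recr /= subnn big1 ?add0r => [Kcn|i _]; last first.
  by rewrite IH ?linear0 //; apply: leq_trans (ltn_ord i) _.
have [n0|n0] := posnP n; first by rewrite n0 /c /Khat hat0 fser0 rt_Kf.
have [_ /(_ n0 v)[fE hg]] := fser_linear_rec n.
have cE : c n = \sum_(j < n) K (n - j)%N (fser R j v) + K 0%N (fser R n v).
  by rewrite /c /Khat hatE big_ord_recr /= subnn.
move: Kcn cE; rewrite fE; set g := \sum_(j < n) _ in hg *.
move=> Kcn cE; rewrite cE linearD linearN linearN /= bqa_K0K0 oppr0 addr0 in Kcn.
have := rt_fh R g; rewrite hg linear0 Kcn linear0 subr0 => /esym/eqP.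
by rewrite subr_eq0 => /eqP Eg; rewrite cE linearN /= -Eg subrr.
Qed.

Lemma Khat_mulNh e a : Khat (mulNh e a) = mulNh e (Khat a) :> ser A.
Proof. exact: serlin_mulNh (@Khat_serlin k A). Qed.

Lemma fhat_mulNh e b : fhat (mulNh e b) = mulNh e (fhat b).
Proof. exact: serlin_mulNh fhat_serlin. Qed.

Lemma nabla_split (a : ser A) : K 0%N (a 0%N) = 0 ->
  a = fhat (cst (h (a 0%N))) + Khat (cst (s (a 0%N))) + mulNh 1 (nabla R a).
Proof.
move=> Ka; rewrite nablaE fhat_cst Khat_cst; apply/funext => m.
rewrite !serD /nabla_rhs -/K Ka linear0 /= cstE if_same subr0.
by rewrite addrC [fser _ _ _ + _]addrC addrA !subrK.
Qed.

(** When K is applied to [nabla_split], K f = 0 and K K = 0 leave only the last term, and one factor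
    - hbar cancels. *)
Lemma Khat_nabla a Y n : Khat a = mulNh n.+1 Y ->
  K 0%N (a 0%N) = 0 /\ Khat (nabla R a) = mulNh n Y.
Proof.
move=> Ka; have K0 : K 0%N (a 0%N) = 0.
  by rewrite -(hat0 (bqa_K A)) -/(Khat a) Ka mulNhE.
split=> //; apply: (@mulNh_inj _ _ 1%N); rewrite mulNhM add1n -Ka.
rewrite [in RHS](nabla_split K0) !(linfD Khat_linear) Khat_fhat KhatK.
by rewrite !add0r Khat_mulNh.
Qed.

Definition hsum n a : ser H :=
  \sum_(i < n) mulNh i (cst (h (iter i (nabla R) a 0%N))).

Definition ssum n a : ser A :=
  \sum_(i < n) mulNh i (cst (s (iter i (nabla R) a 0%N))).

(** Each nabla divides K a by - hbar, so n steps are possible; [hsum] and [ssum] collect the classes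
    and primitives split off on the way. *)
Lemma nabla_iter_split n a Y : Khat a = mulNh n Y ->
  Khat (iter n (nabla R) a) = Y /\
  a = fhat (hsum n a) + Khat (ssum n a) + mulNh n (iter n (nabla R) a).
Proof.
elim: n a => [|n IH] a Ka.
  rewrite Ka mulNh0; split=> //; rewrite /hsum /ssum !big_ord0 mulNh0.
  by rewrite (linf0 fhat_serlin.1) (linf0 Khat_linear) !add0r.
have [K0 /IH[KN NE]] := Khat_nabla Ka; rewrite -iterSr in KN NE; split=> //.
rewrite [LHS](nabla_split K0) [in LHS]NE !(linfD (@mulNh_linear _ _ _)) mulNhM add1n.
rewrite -fhat_mulNh -Khat_mulNh !addrA; congr (_ + _).
have hE : hsum n.+1 a = cst (h (a 0%N)) + mulNh 1 (hsum n (nabla R a)).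
  rewrite /hsum big_ord_recl mulNh0 (linf_sum (@mulNh_linear _ _ _)); congr (_ + _).
  by apply: eq_bigr => i _; rewrite mulNhM iterSr.
have sE : ssum n.+1 a = cst (s (a 0%N)) + mulNh 1 (ssum n (nabla R a)).
  rewrite /ssum big_ord_recl mulNh0 (linf_sum (@mulNh_linear _ _ _)); congr (_ + _).
  by apply: eq_bigr => i _; rewrite mulNhM iterSr.
rewrite hE sE (linfD Khat_linear) (linfD fhat_serlin.1) -!addrA; congr (_ + _).
by rewrite addrCA.
Qed.

Lemma nabla_linear : linear (nabla R).
Proof.
have linB (V : lmodType k) (F G : ser A -> V) : linear F -> linear G ->
    linear (fun a => F a - G a).
  by move=> lF lG c a b; rewrite lF lG scalerBr opprD addrACA.
have l0 : linear (fun a : ser A => a 0%N) by [].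
move=> c a b; apply/funext => m.
have lr : linear (fun a : ser A => nabla_rhs R a m.+1).
  apply: (linB _ _ _); first apply: (linB _ _ _); first apply: (linB _ _ _) => //.
  - by move=> x u v; rewrite serD serZ linearP fser_linear.
  - by move=> x u v; rewrite serD serZ !linearP.
  - by move=> x u v; rewrite serD serZ !linearP (@cst_linear k A x _ _) serD serZ.
by rewrite serD serZ /nabla lr opprD scalerN.
Qed.

Definition phiq (x : seq (hvec H)) : ser A := phi R (size x) x.

Definition Omegaq (x : seq (hvec H)) : ser A := Omega R (size x) x.

(* The weights absorb the powers of lambda: [exp_phi (v_1, ..., v_n)] is
   [lambda^n] times the coefficient of [exp (Phi / lambda)]. *)
Definition wphi (x : seq (hvec H)) : ser A := mulNh (size x).-1 (phiq x).

Definition exp_phi (x : seq (hvec H)) : ser A :=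
  psum fst x (fun bs => \prod_(b <- bs) wphi b).

Lemma serprodE (l : seq (ser A)) : serprod l = \prod_(a <- l) a.
Proof. by elim: l => [|a l IH]; rewrite ?big_nil // big_cons -IH. Qed.

Lemma OmegaqE x : Omegaq x = psum fst x (fun bs => if size bs == 1%N then 0 else
  mulNh (size x - size bs) (\prod_(b <- bs) phiq b)).
Proof.
set G := fun bs => _.
rewrite -psum_subv -(@sum_parts _ _ _ (size x) x (fun ps => G [seq subv x b | b <- ps])) /G.
apply/funext => m; rewrite ser_sum /Omegaq /Omega /Omega_of big_mkcondr.
apply: eq_bigr => P _; rewrite size_map size_blocks serZ.
case: eqP => _; first by rewrite ser0 scaler0.
have -> : [seq phi R (size b) (subv x b) | b <- blocks P]
    = map phiq [seq subv x b | b <- blocks P].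
  by rewrite -map_comp; apply: eq_map => b; rewrite /= /phiq size_subv.
rewrite serprodE big_map -[fun m' => _]/(epsilon x P *: (\prod_(_ <- _) _ : ser A)).
by rewrite (linfZ (@mulNh_linear _ _ _)) serZ.
Qed.

Lemma wphi_prod (bs : seq (seq (hvec H))) : [::] \notin bs ->
  \prod_(b <- bs) wphi b = mulNh (size (flatten bs) - size bs) (\prod_(b <- bs) phiq b).
Proof.
elim: bs => [|b bs IH]; first by rewrite !big_nil mulNh0.
rewrite in_cons negb_or => /andP[b0 bs0]; rewrite !big_cons IH // /wphi.
rewrite mulNhAl mulNhAr mulNhM; congr mulNh.
have sbs : (size bs <= size (flatten bs))%N.
  elim: bs bs0 {IH} => //= c bs IH; rewrite in_cons negb_or size_cat => /andP[c0 /IH].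
  by case: c c0 => // a c _ /=; lia.
by rewrite /= size_cat; case: b b0 => //= a b _; lia.
Qed.

Lemma exp_phiE x : x != [::] -> exp_phi x = Omegaq x + mulNh (size x).-1 (phiq x).
Proof.
move=> x0; rewrite OmegaqE.
have <- : psum fst x (fun bs => if size bs == 1%N then mulNh (size x).-1 (phiq (flatten bs)) else 0)
   = mulNh (size x).-1 (phiq x) by rewrite psum_seq1 //= cats0.
rewrite -psumD; apply: eq_psum => bs bsx bs0; rewrite wphi_prod // (perm_size bsx).
case: eqP => [s1|_]; last by rewrite addr0.
by case: bs s1 {bsx bs0} => // b [] // _; rewrite add0r big_seq1 /= cats0 subn1.
Qed.

End SolvingByNabla.

(** * Degrees of the canonical families and the action of K on their exponential *)

Section DegreesOfTheFamilies.
Variables (k : fieldType) (A : binary_QFT_algebra k) (R : retract A).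
Hypothesis hA : anomaly_free R.
Let H : gradedLmodType k := classical_cohomology A.
Notation phiq := (phiq R).
Notation wphi := (wphi R).
Notation Omegaq := (Omegaq R).
Notation exp_phi := (exp_phi R).
Implicit Types (x : seq (hvec H)) (bs : seq (seq (hvec H))).

Lemma deg_fser n : degree 0 (fser R n).
Proof.
have [m] := ubnP n; elim: m n => // m IH n nm i v hv.
have [->|n0] := posnP n; first by rewrite fser0; apply: rt_f_degree.
rewrite ((fser_linear_rec hA n).2 n0 v).1; apply: homogN.
have -> : i + 0 = (i + 0) + 1 + -1 by ring.
apply: rt_s_degree; apply: homog_sum => j _; apply: bqa_degree.
by apply: IH => //; apply: leq_trans (ltn_ord j) _.
Qed.

Lemma homS_fhat i b : homS i b -> homS i (fhat R b).
Proof. by move=> hb; rewrite -[i]addr0; apply: homS_hat deg_fser hb. Qed.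

Lemma homS_nabla d a : homS d a -> homS d (nabla R a).
Proof.
move=> ha m; have ha0 := ha 0%N; rewrite /nabla /nabla_rhs.
apply: homogN; apply: homogD; first apply: homogD; first apply: homogD => //.
- apply: homogN; have -> : d = d + 0 + 0 by ring.
  by apply: deg_fser; apply: rt_h_degree.
- apply: homogN; have -> : d = d + -1 + 1 by ring.
  by apply: bqa_degree; apply: rt_s_degree.
apply: homogN; have -> : d = d + 1 + -1 by ring.
by rewrite cstE /=; apply: homog0.
Qed.

Lemma homS_iter_nabla d n a : homS d a -> homS d (iter n (nabla R) a).
Proof. by move=> ha; elim: n => //= n; apply: homS_nabla. Qed.

Lemma block_lt x bs b : perm_eq (flatten bs) x -> [::] \notin bs -> size bs != 1%N ->
  b \in bs -> (size b < size x)%N.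
Proof.
move=> /perm_size <- bs0 bs1 bbs.
have : size (flatten (rem b bs)) != 0%N.
  apply: contraNN bs1; rewrite size_eq0 => /eqP E.
  have : size (rem b bs) = 0%N.
    have : [::] \notin rem b bs by apply: contraNN bs0 => /mem_rem.
    by case: (rem b bs) E => //= -[|? ?] ? //; rewrite mem_head.
  by rewrite size_rem //; case: bs bbs {E bs0} => // ? [].
have /perm_flatten/perm_size -> := perm_to_rem bbs.
by rewrite /= size_cat; lia.
Qed.

Lemma homogs_block x bs b : perm_eq (flatten bs) x -> homogs x -> b \in bs -> homogs b.
Proof.
move=> bsx hx bbs a ab; apply: hx; rewrite -(perm_mem bsx).
by apply/flattenP; exists b.
Qed.

Lemma homS_prod (F : seq (hvec H) -> ser A) bs :
  (forall b, b \in bs -> homS (dg fst b) (F b)) ->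
  homS (dg fst (flatten bs)) (\prod_(b <- bs) F b).
Proof.
elim: bs => [|b bs IH] hF; first by rewrite big_nil dg_nil; apply: homS1.
rewrite big_cons /= dg_cat; apply: homSM; first by apply: hF; rewrite mem_head.
by apply: IH => c cbs; apply: hF; rewrite in_cons cbs orbT.
Qed.

Lemma homS_psum d x (G : seq (seq (hvec H)) -> ser A) :
  (forall bs, perm_eq (flatten bs) x -> [::] \notin bs -> homS d (G bs)) ->
  homS d (psum fst x G).
Proof.
by move=> hG; apply: psum_closed => // [u v|c u]; [apply: homSD|apply: homSZ].
Qed.

Lemma phiq1 a : phiq [:: a] = fhat R (cst a.2).
Proof. by rewrite fhat_cst. Qed.

Lemma phiqE x : (1 < size x)%N -> phiq x = - iter (size x).-1 (nabla R) (Omegaq x).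
Proof. by move=> x1; rewrite /phiq phiE. Qed.

Lemma homS_phiq_Omegaq x : homogs x -> homS (dg fst x) (phiq x) /\ homS (dg fst x) (Omegaq x).
Proof.
have [m] := ubnP (size x); elim: m x => // m IH x xm hx.
have hOm : homS (dg fst x) (Omegaq x).
  rewrite OmegaqE; apply: homS_psum => bs bsx bs0; case: eqP => [_|/eqP s1].
    exact: homS0.
  apply: homS_mulNh; rewrite -(dg_perm _ bsx); apply: homS_prod => b bbs.
  apply: (IH b _ (homogs_block bsx hx bbs)).1.
  exact: leq_trans (block_lt bsx bs0 s1 bbs) xm.
split=> //; have [x1|] := ltnP 1 (size x).
  by rewrite phiqE //; apply: homSN; apply: homS_iter_nabla.
(* On the empty list [phi] reads the default vector 0, so its value vanishes by linearity. *)
case: x hx {xm hOm} => [_ _ n|a [|//] ha _].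
  by rewrite -[phiq _ n]/(fser R n 0) (linf0 (fser_linear hA n)); apply: homog0.
rewrite phiq1; apply: homS_fhat; apply: homS_cst.
by rewrite dg_cons dg_nil addr0; apply: ha; rewrite mem_head.
Qed.

Lemma homS_phiq x : homogs x -> homS (dg fst x) (phiq x).
Proof. by move=> hx; case: (homS_phiq_Omegaq hx). Qed.

Lemma homS_wphi x : homogs x -> homS (dg fst x) (wphi x).
Proof. by move=> hx; apply: homS_mulNh; apply: homS_phiq. Qed.

Lemma homS_exp_phi x : homogs x -> homS (dg fst x) (exp_phi x).
Proof.
move=> hx; apply: homS_psum => bs bsx _; rewrite -(dg_perm _ bsx).
by apply: homS_prod => b bbs; apply: homS_wphi; apply: homogs_block bsx hx bbs.
Qed.

Lemma psum_mul (y z : seq (hvec H)) (F G : seq (seq (hvec H)) -> ser A) :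
  psum fst y (fun b1 => psum fst z (fun b2 => F b1 * G b2)) =
    psum fst y F * psum fst z G.
Proof.
rewrite (psum_linear (L := fun u => u * psum fst z G)); last by case: (mull_serlin (psum fst z G)).
apply: eq_psum => b _ _.
by rewrite (psum_linear (L := *%R (F b))) //; case: (mulr_serlin (F b)).
Qed.

(** Weighted coefficients of exp(- Phi / lambda) K(exp(Phi / lambda)). In [wdesc_arg] an extra
    argument [th] is inserted last. *)
Definition wdesc y : ser A := psum fst y (fun bs => mulNh (size bs).-1 (lhat (map wphi bs))).

Definition wdesc_arg (th : ser A) y : ser A :=
  psum fst y (fun bs => mulNh (size bs) (lhat (rcons (map wphi bs) th))).

Definition phidegs bs : seq (int * ser A) := [seq (dg fst b, wphi b) | b <- bs].

Lemma homS_phidegs x bs : perm_eq (flatten bs) x -> homogs x ->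
  forall a, a \in phidegs bs -> homS a.1 a.2.
Proof.
move=> bsx hx a /mapP[b bbs ->]; apply: homS_wphi.
exact: homogs_block bsx hx bbs.
Qed.

Lemma phidegs_snd bs : map snd (phidegs bs) = map wphi bs.
Proof. by rewrite /phidegs -map_comp. Qed.

(** [Khat_prod] selects some blocks of each partition as arguments of ell, and [psum_unsh] turns the
    selection of blocks into a split of [x]. *)
Lemma Khat_exp_phi x : homogs x ->
  Khat (exp_phi x) = unsh fst x (fun y z => wdesc y * exp_phi z).
Proof.
move=> hx; rewrite /exp_phi (psum_linear _ _ (@Khat_linear k A)).
under eq_unsh => y z _ do rewrite -psum_mul.
rewrite -psum_unsh; apply: eq_psum => bs bsx bs0.
have := Khat_prod (homS_phidegs bsx hx); rewrite big_map => ->.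
rewrite (unsh_map (d := dg fst)) //; apply: eq_unsh => b1 b2 _.
by rewrite size_map -/(phidegs b1) phidegs_snd big_map.
Qed.

Lemma homS_wdesc_arg y e th : homogs y -> homS e th -> homS (dg fst y + e + 1) (wdesc_arg th y).
Proof.
move=> hy hth; apply: homS_psum => bs bsy bs0; apply: homS_mulNh.
rewrite -phidegs_snd -[th]/((e, th).2) -map_rcons.
rewrite -(dg_perm _ bsy) -dg_flatten.
rewrite -(dg_map (g := fun b => (dg fst b, wphi b)) (d' := fst)) //.
rewrite -[e]/((e, th).1) -(dg_rcons fst (phidegs bs) (e, th)).
apply: homS_lhat => a; rewrite mem_rcons in_cons => /predU1P[->//|].
exact: homS_phidegs bsy hy a.
Qed.

(** With [th] as last factor, [unsh_rcons] separates the terms where it is an argument of ell from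
    those where it stays outside; the latter add up to K of the exponential, times [th]. *)
Lemma Khat_exp_phi_th x e th : homogs x -> homS e th ->
  Khat (exp_phi x * th) =
    unsh fst x (fun z y => parity (dg fst z) *: (exp_phi z * wdesc_arg th y)) + Khat (exp_phi x) * th.
Proof.
move=> hx hth; have lth := (mull_serlin th).1.
rewrite {1}/exp_phi (psum_linear _ _ lth) (psum_linear _ _ (@Khat_linear k A)).
have E bs : perm_eq (flatten bs) x -> [::] \notin bs ->
  Khat (\prod_(b <- bs) wphi b * th) =
   unsh (dg fst) bs (fun b1 b2 => parity (e * dg fst (flatten b2)) *:
      (mulNh (size b1) (lhat (rcons (map wphi b1) th)) * \prod_(b <- b2) wphi b))
   + unsh (dg fst) bs (fun b1 b2 =>
      mulNh (size b1).-1 (lhat (map wphi b1)) * (\prod_(b <- b2) wphi b * th)).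
  move=> bsx bs0; have hal a : a \in rcons (phidegs bs) (e, th) -> homS a.1 a.2.
    rewrite mem_rcons in_cons => /predU1P[->//|].
    exact: homS_phidegs bsx hx a.
  have := Khat_prod hal.
  rewrite -cats1 big_cat big_seq1 big_map /= => ->; rewrite cats1 unsh_rcons.
  rewrite !(unsh_map (d := dg fst)) //; congr (_ + _); apply: eq_unsh => b1 b2 _.
    rewrite -/(phidegs b1) -/(phidegs b2) map_rcons size_rcons size_map phidegs_snd big_map.
    by rewrite (dg_map (d := dg fst)) // dg_flatten.
  rewrite -/(phidegs b1) -/(phidegs b2) size_map phidegs_snd.
  by rewrite -cats1 big_cat big_seq1 big_map.
rewrite (eq_psum E) psumD !psum_unsh; congr (_ + _).
  rewrite [RHS]unshC; apply: eq_unsh => y z yz; have [hy hz] := homogs_split yz hx.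
  rewrite (serC (homS_exp_phi hz) (homS_wdesc_arg hy hth)) !scalerA -!parityD.
  rewrite /wdesc_arg /exp_phi -psum_mul psumZ; apply: eq_psum => b1 _ _.
  rewrite psumZ; apply: eq_psum => b2 b2z _; congr (_ *: _).
  rewrite (dg_perm _ b2z).
  apply: (parity_congr (- dg fst y * dg fst z - dg fst z)); ring.
rewrite Khat_exp_phi // (unsh_linear _ _ lth); apply: eq_unsh => y z _.
rewrite /wdesc /exp_phi -mulrA (psum_linear _ _ lth) -psum_mul.
by apply: eq_psum.
Qed.

End DegreesOfTheFamilies.

(** * Closedness of the exponential and decomposition of closed series *)

Section Decomposition.
Variables (k : fieldType) (A : binary_QFT_algebra k) (R : retract A).
Hypothesis hA : anomaly_free R.
Let H : gradedLmodType k := classical_cohomology A.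
Let K : ser {linear A -> A} := bqa_K A.
Let h := rt_h R.
Let s := rt_s R.
Notation phiq := (phiq R).
Notation wphi := (wphi R).
Notation Omegaq := (Omegaq R).
Notation exp_phi := (exp_phi R).
Notation fhat := (fhat R).
Notation wdesc := (wdesc R).
Notation wdesc_arg := (wdesc_arg R).
Implicit Types (x y z u : seq (hvec H)) (bs : seq (seq (hvec H))) (a b : hvec H).
Let KhatL : serlin (@Khat k A) := @Khat_serlin k A.
Let mulNhL (V : lmodType k) e : linear (mulNh e : ser V -> ser V) := @mulNh_linear k V e.

Lemma sum_predn bs : [::] \notin bs ->
  (\sum_(b <- bs) (size b).-1 = size (flatten bs) - size bs /\
   size bs <= size (flatten bs))%N.
Proof.
elim: bs => [|b bs IH]; first by rewrite big_nil.
rewrite in_cons negb_or big_cons /= size_cat => /andP[b0 /IH[-> sb]].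
by case: b b0 => // a b _ /=; lia.
Qed.

Definition desc y : ser A := psum fst y (fun bs => lhat (map phiq bs)).

(* The coefficients of [K_Phi th], up to the sign [parity (dg fst y)]. *)
Definition desc_arg (th : ser A) y : ser A :=
  psum fst y (fun bs => lhat (rcons (map phiq bs) th)).

Lemma wdesc_desc y : wdesc y = mulNh (size y).-1 (desc y).
Proof.
rewrite /desc (psum_linear _ _ (@mulNhL _ _)); apply: eq_psum => bs bsy bs0.
rewrite -[map wphi bs]cats0 (lhat_mulNhs (fun c : seq (hvec H) => (size c).-1)) cats0 mulNhM.
have [-> sb] := sum_predn bs0; rewrite -(perm_size bsy).
have arith p q : (0 < p <= q -> p.-1 + (q - p) = q.-1)%N by lia.
case: bs {bsy bs0} sb => [|b bs] sb; last by congr mulNh; apply: arith.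
by rewrite [lhat _](_ : _ = 0) // !(linf0 (@mulNhL _ _)).
Qed.

Lemma wdesc_arg_desc_arg th y : wdesc_arg th y = mulNh (size y) (desc_arg th y).
Proof.
rewrite /desc_arg (psum_linear _ _ (@mulNhL _ _)); apply: eq_psum => bs bsy bs0.
rewrite -!cats1 (lhat_mulNhs (fun c : seq (hvec H) => (size c).-1)) mulNhM.
have [-> sb] := sum_predn bs0; rewrite -(perm_size bsy); congr mulNh.
exact: subnKC.
Qed.

Lemma exp_phi_nil : exp_phi [::] = 1.
Proof. by rewrite /exp_phi psum_nil big_nil. Qed.

(** The exponential has constant coefficient 1, so [Khat_exp_phi] can be solved for [wdesc] by
    induction on the size. *)
Lemma wdesc0 n : (forall y, (size y < n)%N -> homogs y -> Khat (exp_phi y) = 0) ->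
  forall y, (size y < n)%N -> homogs y -> wdesc y = 0.
Proof.
move=> KE y; have [m] := ubnP (size y); elim: m y => // m IH y ym yn hy.
have := KE y yn hy; rewrite Khat_exp_phi // unsh_left ?exp_phi_nil ?mulr1 // => y1 z yz z0.
have [hy1 _] := homogs_split yz hy.
have lt : (size y1 < size y)%N.
  by rewrite -(perm_size yz) size_cat; case: z z0 {yz} => // c z _ /=; rewrite addnS ltnS leq_addr.
rewrite IH ?mul0r //; first exact: leq_trans lt ym.
exact: ltn_trans lt yn.
Qed.

Lemma Khat1 : Khat (1 : ser A) = 0.
Proof. by rewrite ser1 Khat_cst; apply/funext => m; rewrite bqa_K1. Qed.

(** By [wdesc0] only the top term of K(exp) survives, which is [desc x] times the power n - 1 of -
    hbar. Then K(nabla^(n-1) Omega) = desc - K(phi), while the left side is - K(phi) by definition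
    of phi; so [desc x = 0]. *)
Lemma Khat_exp_phi_Omegaq x : homogs x -> (1 < size x)%N ->
  (forall y, (size y < size x)%N -> homogs y -> Khat (exp_phi y) = 0) ->
  Khat (Omegaq x) = mulNh (size x).-1 (- Khat (phiq x)) /\ Khat (exp_phi x) = 0.
Proof.
move=> hx x1 KE; have x0 : x != [::] by case: x x1 {hx KE}.
have KEx : Khat (exp_phi x) = mulNh (size x).-1 (desc x).
  rewrite Khat_exp_phi // unsh_left ?exp_phi_nil ?mulr1 ?wdesc_desc // => y z yz z0.
  have [hy _] := homogs_split yz hx.
  rewrite (wdesc0 KE) ?mul0r //.
  by rewrite -(perm_size yz) size_cat; case: z z0 {yz} => // c z _ /=; rewrite addnS ltnS leq_addr.
have KOm : Khat (Omegaq x) = mulNh (size x).-1 (desc x - Khat (phiq x)).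
  rewrite (linfD (@mulNhL _ _)) (linfN (@mulNhL _ _)) -KEx exp_phiE //.
  by rewrite (linfD KhatL.1) Khat_mulNh addrK.
have [KN _] := nabla_iter_split hA KOm.
have L0 : desc x = 0.
  move: KN; rewrite -[iter _ _ _]opprK -phiqE // (linfN KhatL.1) => /eqP.
  by rewrite eq_sym subr_eq addNr => /eqP.
by rewrite KOm KEx L0 sub0r (linf0 (@mulNhL _ _)).
Qed.

Lemma exp_phi_seq1 a : exp_phi [:: a] = fhat (cst a.2).
Proof. by rewrite /exp_phi /psum /= big_seq1 /wphi mulNh0 phiq1. Qed.

Lemma Khat_exp_phi0 x : homogs x -> Khat (exp_phi x) = 0.
Proof.
have [m] := ubnP (size x); elim: m x => // m IH x xm hx.
have [x1|] := ltnP 1 (size x).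
  apply: (Khat_exp_phi_Omegaq hx x1 _).2 => y yx hy; apply: IH => //.
  exact: leq_trans yx xm.
case: x {xm hx} => [_|a [|//] _]; first by rewrite exp_phi_nil Khat1.
by rewrite exp_phi_seq1 Khat_fhat.
Qed.

Lemma Khat_exp_phi_desc_arg x e th : homogs x -> homS e th ->
  Khat (exp_phi x * th) =
    unsh fst x (fun z y => parity (dg fst z) *: (exp_phi z * mulNh (size y) (desc_arg th y))).
Proof.
move=> hx hth; rewrite (Khat_exp_phi_th hA hx hth) Khat_exp_phi0 // mul0r addr0.
by apply: eq_unsh => z y _; rewrite wdesc_arg_desc_arg.
Qed.

Definition piq x : ser H := pi_quantum R (size x) x.

Lemma hsumE n c m : hsum R n c m =
  if (m < n)%N then (-1) ^+ m *: h (iter m (nabla R) c 0%N) else 0.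
Proof. exact: (coef_sum_mulNh (fun i => h (iter i (nabla R) c 0%N))). Qed.

Lemma piqE x : (1 < size x)%N -> piq x = hsum R (size x).-1 (Omegaq x).
Proof.
move=> x1; rewrite /piq /pi_quantum leqNgt x1 /= /hsum; apply/funext => m.
by rewrite ser_sum big_mkord.
Qed.

Lemma piq1 a : piq [:: a] = cst a.2.
Proof. by []. Qed.

Lemma piq_deg x m : (1 < size x)%N -> (size x - 2 < m)%N -> piq x m = 0.
Proof. by move=> x1 xm; rewrite piqE // hsumE ifN // -leqNgt; move: x1 xm; lia. Qed.

Lemma piq_mprod x : (1 < size x)%N ->
  piq x (size x - 2)%N = (-1) ^+ (size x - 2) *: mprod R (size x) x.
Proof. by move=> x1; rewrite /mprod scalerA -expr2 sqrr_sign scale1r. Qed.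

Lemma exp_phi_piq x : homogs x -> x != [::] -> exists eta, exp_phi x = fhat (piq x) + Khat eta.
Proof.
move=> hx x0; have [x1|x1] := ltnP 1 (size x); last first.
  exists 0; rewrite (linf0 KhatL.1) addr0.
  by case: x x0 x1 {hx} => // a [|//] _ _; rewrite exp_phi_seq1.
exists (ssum R (size x).-1 (Omegaq x)); rewrite piqE //.
have [KOm _] := Khat_exp_phi_Omegaq hx x1 (fun y _ hy => Khat_exp_phi0 hy).
have [_ E] := nabla_iter_split hA KOm.
(* The remainder left after the nabla steps is cancelled by the one-block term. *)
rewrite exp_phiE // {1}E -addrA -(linfD (@mulNhL _ _)) phiqE // subrr.
by rewrite (linf0 (@mulNhL _ _)) addr0.
Qed.

(** Applying [h] at order 0 shows w_0 = 0, and then c_0 is closed. Both sides can be divided by -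
    hbar, with [nabla R c] as the new primitive, and the argument repeats. *)
Lemma fhat_Khat_inj w c : fhat w = Khat c -> w = 0.
Proof.
move=> E; apply/funext => m; elim: m w c E => [|m IH] w c E.
  have := congr1 (fun a : ser A => h (a 0%N)) E.
  by rewrite /Khat /fhat !hat0 fser0 rt_hK rt_hf.
have w0 : w 0%N = 0.
  have := congr1 (fun a : ser A => h (a 0%N)) E.
  by rewrite /Khat /fhat !hat0 fser0 rt_hK rt_hf.
pose w' : ser H := fun m => - w m.+1.
have wE : w = mulNh 1 w'.
  apply/funext => -[|n]; first by rewrite w0 mulNhE.
  by rewrite mulNhE subn1 expr1 scaleN1r /= opprK.
have c0 : K 0%N (c 0%N) = 0.
  by have := congr1 (fun a : ser A => a 0%N) E; rewrite /Khat /fhat !hat0 fser0 w0 linear0.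
have E' : fhat w' = Khat (nabla R c).
  apply: (@mulNh_inj _ _ 1%N); rewrite -fhat_mulNh // -wE E.
  rewrite [in LHS](nabla_split hA c0) !(linfD KhatL.1) Khat_fhat // KhatK !add0r.
  by rewrite Khat_mulNh.
by have := IH _ _ E'; rewrite /w' => /eqP; rewrite oppr_eq0 => /eqP.
Qed.

(** [class_part] and [exact_part] are the limits of [hsum] and [ssum] when the number of nabla steps
    is unbounded. *)
Definition class_part (X : ser A) : ser H := fun i => (-1) ^+ i *: h (iter i (nabla R) X 0%N).

Definition exact_part (X : ser A) : ser A := fun i => (-1) ^+ i *: s (iter i (nabla R) X 0%N).

Lemma ssumE n c m : ssum R n c m =
  if (m < n)%N then (-1) ^+ m *: s (iter m (nabla R) c 0%N) else 0.
Proof. exact: (coef_sum_mulNh (fun i => s (iter i (nabla R) c 0%N))). Qed.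

(** K X = 0 is divisible by every power of - hbar, so the coefficient at [m] can be read off after m
    + 1 steps. *)
Lemma solve X : Khat X = 0 -> X = fhat (class_part X) + Khat (exact_part X).
Proof.
move=> KX; apply/funext => m.
have KX' : Khat X = mulNh m.+1 0 by rewrite KX (linf0 (@mulNhL _ _)).
have [_ {1}->] := nabla_iter_split hA KX'.
rewrite !serD [mulNh _ _ _]mulNhE ltnSn addr0; congr (_ + _).
  by apply: eq_bigr => l _; rewrite hsumE ltn_ord.
by apply: eq_bigr => l _; rewrite ssumE ltn_ord.
Qed.

End Decomposition.

(** * The second derivatives of the exponential *)

Section SecondDerivatives.
Variables (k : fieldType) (A : binary_QFT_algebra k) (R : retract A).
Hypothesis hA : anomaly_free R.
Let H : gradedLmodType k := classical_cohomology A.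
Notation phiq := (phiq R).
Notation wphi := (wphi R).
Notation exp_phi := (exp_phi R).
Notation fhat := (fhat R).
Notation desc_arg := (desc_arg R).
Notation piq := (piq R).
Implicit Types (x y z u : seq (hvec H)) (bs : seq (seq (hvec H))) (a b : hvec H).
Let fhatL : serlin fhat := fhat_serlin hA.
Let KhatL : serlin (@Khat k A) := @Khat_serlin k A.
Let mulNhL (V : lmodType k) e : linear (mulNh e : ser V -> ser V) := @mulNh_linear k V e.

Lemma exp_phi_rcons x a :
  exp_phi (rcons x a) = unsh fst x (fun z y => exp_phi z * wphi (rcons y a)).
Proof.
rewrite /exp_phi psum_rcons; apply: eq_unsh => z y _.
rewrite (psum_linear (L := fun c => c * wphi (rcons y a))); last first.
  by case: (mull_serlin (wphi (rcons y a))).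
by apply: eq_psum => bs _ _; rewrite -cats1 big_cat big_seq1.
Qed.

(* The coefficients of [dPhi/da * dPhi/db + lambda d^2 Phi/da db], where
   [lambda] is [- hbar] and [Phi] is the generating series of [phiq]. *)
Definition hessian a b u : ser A :=
  mulNh 1 (phiq (rcons (rcons u a) b))
  + unsh fst u (fun y z => parity (a.1 * dg fst z) *: (phiq (rcons y a) * phiq (rcons z b))).

(** The second derivative of an exponential: [a] and [b] lie in different blocks, giving the product
    of first derivatives, or in the same block. *)
Lemma exp_phi_rcons2 u a b : exp_phi (rcons (rcons u a) b) =
  unsh fst u (fun z y => exp_phi z * mulNh (size y) (hessian a b y)).
Proof.
rewrite exp_phi_rcons unsh_rcons.
under [X in X + _]eq_unsh => z y _.
  rewrite exp_phi_rcons (unsh_linear (L := fun c => c * wphi (rcons y b))); last first.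
    by case: (mull_serlin (wphi (rcons y b))).
  rewrite unshZ; over.
rewrite (unshA fst u (fun z1 z2 y =>
   parity (a.1 * dg fst y) *: (exp_phi z1 * wphi (rcons z2 a) * wphi (rcons y b)))).
rewrite -unshD; apply: eq_unsh => z y _.
rewrite /hessian (linfD (@mulNhL _ _)) mulrDr addrC; congr (_ + _).
  by rewrite /wphi !size_rcons mulNhM addn1.
rewrite (unsh_linear _ _ (@mulNhL _ _)) (unsh_linear (L := *%R (exp_phi z))); last first.
  by case: (mulr_serlin (exp_phi z)).
apply: eq_unsh => y1 y2 yy; rewrite /wphi !size_rcons /=.
rewrite (linfZ (@mulNhL _ _)) -scalerAr -mulrA !(mulNhAl, mulNhAr) mulNhM mulrA.
by rewrite -(perm_size yy) size_cat.
Qed.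

Definition deg3 a b z : int := dg fst z + a.1 + b.1.

(** Coefficients of the error of the identity for the second derivatives, when [mt] and [tt] are put
    in place of M_ab and Theta_ab. *)
Definition defect a b (mt : seq (hvec H) -> H) (tt : seq (hvec H) -> ser A) u : ser A :=
  hessian a b u
  - unsh fst u (fun y z => phiq (rcons y (deg3 a b z, mt z)))
  - unsh fst u (fun y z => parity (dg fst y) *: desc_arg (tt z) y).

(** The definition of [defect] multiplied by the exponential: M^c @_c Phi becomes a derivative of
    the exponential, and K_Phi Theta becomes K of exponential times Theta because the exponential is
    closed. *)
Lemma exp_phi_decomp a b mt tt u : homogs u ->
  (forall z, homogs z -> homS (deg3 a b z - 1) (tt z)) ->
  exp_phi (rcons (rcons u a) b) =
    unsh fst u (fun z y => exp_phi z * mulNh (size y) (defect a b mt tt y))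
    + unsh fst u (fun y z => mulNh (size z) (exp_phi (rcons y (deg3 a b z, mt z))))
    + Khat (unsh fst u (fun y z => mulNh (size z) (parity (dg fst y) *: (exp_phi y * tt z)))).
Proof.
move=> hu htt; rewrite exp_phi_rcons2.
have lE z : linear ( *%R (exp_phi z)) by case: (mulr_serlin (exp_phi z)).
have -> : unsh fst u (fun y z => mulNh (size z) (exp_phi (rcons y (deg3 a b z, mt z)))) =
  unsh fst u (fun z y => exp_phi z * mulNh (size y)
      (unsh fst y (fun y1 y2 => phiq (rcons y1 (deg3 a b y2, mt y2))))).
  under eq_unsh => y z _.
    rewrite exp_phi_rcons (unsh_linear _ _ (@mulNhL _ _)); over.
  rewrite (unshA fst u (fun y1 y2 z =>
    mulNh (size z) (exp_phi y1 * wphi (rcons y2 (deg3 a b z, mt z))))).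
  apply: eq_unsh => z y _; rewrite (unsh_linear _ _ (@mulNhL _ _)) (unsh_linear _ _ (lE z)).
  apply: eq_unsh => y1 y2 yy; rewrite -mulNhAr /wphi size_rcons /= mulNhM.
  by rewrite -(perm_size yy) size_cat addnC.
have -> : Khat (unsh fst u (fun y z => mulNh (size z) (parity (dg fst y) *: (exp_phi y * tt z))))
  = unsh fst u (fun z y => exp_phi z * mulNh (size y)
      (unsh fst y (fun y1 y2 => parity (dg fst y1) *: desc_arg (tt y2) y1))).
  rewrite (unsh_linear _ _ KhatL.1).
  have E y z : perm_eq (y ++ z) u ->
    Khat (mulNh (size z) (parity (dg fst y) *: (exp_phi y * tt z))) =
    unsh fst y (fun y1 y2 => exp_phi y1 *
      mulNh (size y2 + size z) (parity (dg fst y2) *: desc_arg (tt z) y2)).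
    move=> yz; have [hy hz] := homogs_split yz hu.
    rewrite Khat_mulNh (linfZ KhatL.1) (Khat_exp_phi_desc_arg hA hy (htt z hz)) unshZ.
    rewrite (unsh_linear _ _ (@mulNhL _ _)); apply: eq_unsh => y1 y2 yy.
    rewrite (dg_split _ yy) scalerA parityD mulrAC parity_sqr mul1r.
    by rewrite scalerAr -(linfZ (@mulNhL _ _)) -mulNhAr mulNhM addnC.
  rewrite (eq_unsh E) (unshA fst u (fun y1 y2 z => exp_phi y1 *
      mulNh (size y2 + size z) (parity (dg fst y2) *: desc_arg (tt z) y2))).
  apply: eq_unsh => z y _; rewrite (unsh_linear _ _ (@mulNhL _ _)) (unsh_linear _ _ (lE z)).
  by apply: eq_unsh => y1 y2 yy; rewrite -(perm_size yy) size_cat.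
rewrite -!unshD; apply: eq_unsh => z y _.
rewrite -!mulrDr -!(linfD (@mulNhL _ _)); congr (_ * mulNh _ _).
by rewrite /defect addrAC !subrK.
Qed.

Definition mcorr x : H := mprod R (size x) x.

(* The recursion for [M_ab] and [Theta_ab] at [u]: the terms with [y = [::]] are
   the unknowns [fhat M] and [Khat Theta], so they are left out.  That [mcorr]
   can stand for [M] is part of [obstr_main]. *)
Definition obstr (tt : seq (hvec H) -> ser A) a b u : ser A :=
  hessian a b u
  - unsh fst u (fun y z => if y is [::] then 0 else
      phiq (rcons y (deg3 a b z, mcorr (rcons (rcons z a) b))))
  - unsh fst u (fun y z => if y is [::] then 0 else
      parity (dg fst y) *: desc_arg (tt (rcons (rcons z a) b)) y).

(* Course-of-values recursion on the length of [x], with fuel [n]; this is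
   [Theta]. *)
Fixpoint prim_rec n x : ser A :=
  if n is n'.+1 then
    if rev x is b :: a :: r then exact_part R (obstr (prim_rec n') a b (rev r)) else 0
  else 0.

Lemma prim_recS n u a b : prim_rec n.+1 (rcons (rcons u a) b) = exact_part R (obstr (prim_rec n) a b u).
Proof. by rewrite /= !rev_rcons revK. Qed.

Definition prim x : ser A := prim_rec (size x) x.

Lemma size_right u y z : perm_eq (y ++ z) u -> y != [::] -> (size z < size u)%N.
Proof.
by move=> /perm_size <-; rewrite size_cat; case: y => // c y _; rewrite ltnS leq_addl.
Qed.

Lemma eq_obstr t1 t2 a b u :
  (forall z, (size z < size u)%N -> t1 (rcons (rcons z a) b) = t2 (rcons (rcons z a) b)) ->
  obstr t1 a b u = obstr t2 a b u.
Proof.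
move=> E; congr (_ - _); apply: eq_unsh => y z yz.
by case: y yz => // c y /size_right/(_ isT) lt; rewrite E.
Qed.

Lemma prim_recE n x : (size x <= n)%N -> prim_rec n x = prim x.
Proof.
rewrite /prim; have [m lexm] := ubnP (size x).
elim: m => // m IH in n x lexm *; case/lastP: x lexm => [|x b]; first by case: n.
case/lastP: x => [|u a]; first by case: n.
rewrite !size_rcons; case: n => // n um un; rewrite !prim_recS; congr exact_part.
have ltm (p q r : nat) : (q.+2 < r.+1 -> p < q -> p.+2 < r)%N by lia.
have len (p q r : nat) : (q.+1 < r.+1 -> p < q -> p.+2 <= r)%N by lia.
apply: eq_obstr => z zu; rewrite !(IH _ (rcons _ _)) ?size_rcons //;
  by first [exact: (ltm _ _ _ um zu) | exact: (len _ _ _ un zu)].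
Qed.

Lemma primE u a b : prim (rcons (rcons u a) b) = exact_part R (obstr prim a b u).
Proof.
rewrite /prim !size_rcons prim_recS; congr exact_part; apply: eq_obstr => z zu.
by rewrite prim_recE // !size_rcons.
Qed.

Lemma desc_arg0 y : desc_arg 0 y = 0.
Proof.
rewrite -[RHS](psum0 fst _ y); apply: eq_psum => bs _ _.
rewrite -cats1 -(linf0 (@mulNhL A 0)) mulNh0.
by have /linf0 := (mlin_serlin (map phiq bs) [::] (@lhat_mlin k A) (@lhat_mcont k A)).1.
Qed.

Lemma lhat1 e (th : ser A) : homS e th -> lhat [:: th] = Khat th.
Proof.
move=> hth; have hal c : c \in [:: (e, th)] -> homS c.1 c.2.
  by rewrite in_cons orbF => /eqP->.
have := Khat_prod hal; rewrite big_seq1 => ->; rewrite /= big_nil mulr1 [lhat [::]](_ : _ = 0) // mulNh0.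
by rewrite (linf0 (@mulNhL _ _)) mul0r scaler0 addr0.
Qed.

Lemma desc_arg_nil e th : homS e th -> desc_arg th [::] = Khat th.
Proof. by move=> hth; rewrite /desc_arg psum_nil /= (lhat1 hth). Qed.

Lemma homS_unsh d u (F : seq (hvec H) -> seq (hvec H) -> ser A) :
  (forall y z, perm_eq (y ++ z) u -> homS d (F y z)) -> homS d (unsh fst u F).
Proof.
by move=> hF; apply: unsh_closed => // [v w|c v]; [apply: homSD|apply: homSZ].
Qed.

Lemma homS_hessian a b u : homogs u -> homog a.1 a.2 -> homog b.1 b.2 ->
  homS (deg3 a b u) (hessian a b u).
Proof.
move=> hu ha hb; apply: homSD.
  rewrite /deg3 -!dg_rcons; apply: homS_mulNh; apply: homS_phiq => //.
  by apply/homogs_rcons; split=> //; apply/homogs_rcons.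
apply: homS_unsh => y z yz; have [hy hz] := homogs_split yz hu; apply: homSZ.
have -> : deg3 a b u = dg fst (rcons y a) + dg fst (rcons z b).
  by rewrite /deg3 (dg_split _ yz) !dg_rcons; ring.
by apply: homSM; apply: homS_phiq => //; apply/homogs_rcons.
Qed.

Lemma homog_mcorr x : homogs x -> (1 < size x)%N -> homog (dg fst x) (mcorr x).
Proof.
move=> hx x1; rewrite /mcorr /mprod -/(piq x) piqE // hsumE; apply: homogZ.
case: ifP => _; last exact: homog0.
apply: homogZ; rewrite -[dg fst x]addr0; apply: rt_h_degree.
by apply: homS_iter_nabla => //; case: (homS_phiq_Omegaq hA hx).
Qed.

Lemma homS_desc_arg y e th : homogs y -> homS e th -> homS (dg fst y + e + 1) (desc_arg th y).
Proof.
move=> hy hth; apply: homS_psum => bs bsy bs0.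
pose al : seq (int * ser A) := rcons [seq (dg fst b, phiq b) | b : seq (hvec H) <- bs] (e, th).
have -> : rcons (map phiq bs) th = map snd al by rewrite map_rcons -map_comp.
have -> : dg fst y + e = dg fst al.
  by rewrite dg_rcons (dg_map (d := dg fst)) // dg_flatten (dg_perm _ bsy).
apply: homS_lhat => a; rewrite mem_rcons in_cons => /predU1P[->//|].
move=> /mapP[b bbs ->]; apply: homS_phiq => //.
exact: homogs_block bsy hy bbs.
Qed.

Lemma homS_obstr tt a b u : homogs u -> homog a.1 a.2 -> homog b.1 b.2 ->
  (forall z, (size z < size u)%N -> homogs z ->
     homS (deg3 a b z - 1) (tt (rcons (rcons z a) b))) ->
  homS (deg3 a b u) (obstr tt a b u).
Proof.
move=> hu ha hb htt; apply: homSD; first apply: homSD; first exact: homS_hessian.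
  apply: homSN; apply: homS_unsh => y z yz; have [hy hz] := homogs_split yz hu.
  case: y yz hy => [|c y] yz hy; first exact: homS0.
  have -> : deg3 a b u = dg fst (rcons (c :: y) (deg3 a b z, mcorr (rcons (rcons z a) b))).
    by rewrite dg_rcons /= /deg3 (dg_split _ yz); ring.
  apply: homS_phiq => //; apply/homogs_rcons; split=> //=.
  rewrite /deg3 -!dg_rcons; apply: homog_mcorr; last by rewrite !size_rcons.
  by apply/homogs_rcons; split=> //; apply/homogs_rcons.
apply: homSN; apply: homS_unsh => y z yz; have [hy hz] := homogs_split yz hu.
case: y yz hy => [|c y] yz hy; first exact: homS0.
have lt := size_right yz isT; apply: homSZ.
have -> : deg3 a b u = dg fst (c :: y) + (deg3 a b z - 1) + 1.
  by rewrite /deg3 (dg_split _ yz); ring.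
by apply: homS_desc_arg => //; apply: htt.
Qed.

Lemma homS_exact_part e X : homS e X -> homS (e - 1) (exact_part R X).
Proof.
move=> hX i; apply: homogZ; apply: rt_s_degree.
exact: homS_iter_nabla.
Qed.

Lemma homS_prim u a b : homogs u -> homog a.1 a.2 -> homog b.1 b.2 ->
  homS (deg3 a b u - 1) (prim (rcons (rcons u a) b)).
Proof.
move=> hu ha hb; have [m] := ubnP (size u); elim: m u hu => // m IH u hu um.
rewrite primE; apply: homS_exact_part; apply: homS_obstr => // z zu hz.
by apply: IH => //; lia.
Qed.

Lemma unsh_nil_left (W : lmodType k) u (F : seq (hvec H) -> seq (hvec H) -> W) :
  unsh fst u F = F [::] u + unsh fst u (fun y z => if y is [::] then 0 else F y z).
Proof.
rewrite (eq_unsh (G := fun y z => (if y is [::] then F y z else 0) +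
   (if y is [::] then 0 else F y z))).
  by rewrite unshD unsh_right // => -[].
by move=> [|c y] z _; rewrite ?addr0 ?add0r.
Qed.

Lemma phiq_zero e : phiq [:: (e, 0)] = 0.
Proof. by rewrite phiq1 // (linf0 (@cst_linear _ _)) (linf0 fhatL.1). Qed.

(* After multiplication by [exp (Phi / lambda)] the error term is
   [mulNh (size u) X], which gives the closedness of [X].  On cohomology it is
   the only term of the recursion for [piq] of degree at least [size u] in
   lambda, whereas [piq] has degree at most [size u]: this makes [class_part X]
   constant. *)
Lemma obstr_main u a b : homogs u -> homog a.1 a.2 -> homog b.1 b.2 ->
  Khat (obstr prim a b u) = 0 /\ class_part R (obstr prim a b u) = cst (mcorr (rcons (rcons u a) b)).
Proof.
move=> hu ha hb; have [m] := ubnP (size u); elim: m u hu => // m IH u hu um.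
set X := obstr prim a b u.
have hrr z : homogs z -> homogs (rcons (rcons z a) b).
  by move=> hz; apply/homogs_rcons; split=> //; apply/homogs_rcons.
(* Candidates known below [size u] and zero from there on, so that the defect at [u] is [obstr]
   itself. *)
pose mt z := if (size z < size u)%N then mcorr (rcons (rcons z a) b) else 0 : H.
pose tt z := if (size z < size u)%N then prim (rcons (rcons z a) b) else 0 : ser A.
have htt z : homogs z -> homS (deg3 a b z - 1) (tt z).
  by move=> hz; rewrite /tt; case: ifP => _; [apply: homS_prim|apply: homS0].
have hmt z : homogs z -> homog (deg3 a b z) (mt z).
  move=> hz; rewrite /mt; case: ifP => _; last exact: homog0.
  rewrite /deg3 -!dg_rcons; apply: homog_mcorr; last by rewrite !size_rcons.
  exact: hrr.
have dX : defect a b mt tt u = X.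
  rewrite /defect /X /obstr; congr (_ - _ - _); apply: eq_unsh => y z yz.
    case: y yz => [|c y] yz; first by rewrite /mt -(perm_size yz) ltnn phiq_zero.
    by rewrite /mt (size_right yz).
  case: y yz => [|c y] yz; first by rewrite /tt -(perm_size yz) ltnn desc_arg0 scaler0.
  by rewrite /tt (size_right yz).
(* By induction the obstruction at [z] is closed with constant class, so [solve] writes it as f(m) +
   K(Theta): these are the [y = [::]] terms left out of [obstr]. *)
have d0 z : homogs z -> (size z < size u)%N -> defect a b mt tt z = 0.
  move=> hz zu; have [KX MX] := IH z hz (leq_trans zu um).
  have := solve hA KX; rewrite MX -primE => XE.
  rewrite /defect (unsh_nil_left z (fun y z => phiq _)) (unsh_nil_left z (fun y z => _ *: desc_arg _ _)).
  rewrite dg_nil parity0 scale1r phiq1 // /mt /tt zu (desc_arg_nil (homS_prim hz ha hb)).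
  have lt y z' : perm_eq (y ++ z') z -> (size z' < size u)%N.
    by move=> /split_size[_ le]; apply: leq_ltn_trans le zu.
  have PE : unsh fst z (fun y z => if y is [::] then 0 else phiq (rcons y (deg3 a b z, mt z))) =
    unsh fst z (fun y z => if y is [::] then 0 else
      phiq (rcons y (deg3 a b z, mcorr (rcons (rcons z a) b)))).
    by apply: eq_unsh => -[|c y] z' yz //; rewrite /mt (lt _ _ yz).
  have QE : unsh fst z (fun y z => if y is [::] then 0 else
      parity (dg fst y) *: desc_arg (tt z) y) =
    unsh fst z (fun y z => if y is [::] then 0 else
      parity (dg fst y) *: desc_arg (prim (rcons (rcons z a) b)) y).
    by apply: eq_unsh => -[|c y] z' yz //; rewrite /tt (lt _ _ yz).
  rewrite PE QE; move: XE; rewrite /obstr /= -/(mt _) -/(tt _).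
  move: (hessian a b z) (unsh _ _ _) (unsh _ _ _) (fhat _) (Khat _) => W Q P F1 F2 XE.
  have -> : W = F1 + F2 + Q + P by rewrite -XE !subrK.
  by apply/eqP; rewrite -addrA -opprD subr_eq0 [F1 + P + _]addrACA [P + Q]addrC addrA.
have hS y z : perm_eq (y ++ z) u -> homogs (rcons y (deg3 a b z, mt z)).
  move=> yz; have [hy hz] := homogs_split yz hu.
  by apply/homogs_rcons; split=> //; apply: hmt.
pose T := unsh fst u (fun y z => mulNh (size z) (parity (dg fst y) *: (exp_phi y * tt z))).
pose S := unsh fst u (fun y z => mulNh (size z) (exp_phi (rcons y (deg3 a b z, mt z)))).
have EX : exp_phi (rcons (rcons u a) b) = mulNh (size u) X + S + Khat T.
  rewrite (@exp_phi_decomp a b mt tt u hu htt) -/S -/T unsh_right.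
    by rewrite exp_phi_nil mul1r dX.
  move=> z y zy z0; have [hz hy] := homogs_split zy hu.
  by rewrite d0 ?(size_right zy) // (linf0 (@mulNhL _ _)) mulr0.
clearbody X; have KX : Khat X = 0.
  have := Khat_exp_phi0 hA (hrr _ hu); rewrite EX !(linfD KhatL.1) KhatK addr0.
  rewrite [Khat S](_ : _ = 0) ?addr0 => [E|].
    by apply: (@mulNh_inj _ _ (size u)); rewrite -Khat_mulNh E (linf0 (@mulNhL _ _)).
  rewrite /S (unsh_linear _ _ KhatL.1) -[RHS](unsh0 fst _ u); apply: eq_unsh => y z yz.
  by rewrite Khat_mulNh Khat_exp_phi0 ?(linf0 (@mulNhL _ _)) //; apply: hS.
split=> //.
have [eta etaE] : exists eta : seq (hvec H) -> ser A, forall x, homogs x -> x != [::] ->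
    exp_phi x = fhat (piq x) + Khat (eta x).
  suff /choice[eta etaE] : forall x, exists c, homogs x -> x != [::] ->
      exp_phi x = fhat (piq x) + Khat c by exists eta.
  move=> x; have [hx|nhx] := pselect (homogs x /\ x != [::]).
    by have [c cE] := exp_phi_piq hA hx.1 hx.2; exists c.
  by exists 0 => hx x0; case: nhx.
pose S' := unsh fst u (fun y z => mulNh (size z) (piq (rcons y (deg3 a b z, mt z)))).
have x0 (y : seq (hvec H)) c : rcons y c != [::] by case: y.
have piE : piq (rcons (rcons u a) b) = mulNh (size u) (class_part R X) + S'.
  apply/eqP; rewrite -subr_eq0; apply/eqP.
  pose eS := unsh fst u (fun y z => mulNh (size z) (eta (rcons y (deg3 a b z, mt z)))).
  (* The difference of the two sides is exact after [fhat]; its primitive gathers those of [X], of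
     [S], of [Khat T] and, with a minus sign, of the left side. *)
  apply: (fhat_Khat_inj hA (c := mulNh (size u) (exact_part R X) + eS + T
    - eta (rcons (rcons u a) b))).
  have SE : S = fhat S' + Khat eS.
    rewrite /S /S' /eS (unsh_linear _ _ fhatL.1) (unsh_linear _ _ KhatL.1) -unshD.
    apply: eq_unsh => y z yz; rewrite etaE //; last exact: hS.
    by rewrite (linfD (@mulNhL _ _)) fhat_mulNh // Khat_mulNh.
  have := EX; rewrite etaE //; last exact: hrr.
  rewrite SE [in mulNh _ X](solve hA KX) (linfD (@mulNhL _ _)) -fhat_mulNh // -Khat_mulNh.
  rewrite (linfD fhatL.1) (linfN fhatL.1) (linfD fhatL.1).
  rewrite !(linfD KhatL.1) (linfN KhatL.1).
  move: (fhat _) (fhat _) (fhat _) (Khat _) (Khat _) (Khat _) (Khat _) => p q r c1 c2 c3 c4 E.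
  have -> : r = q + c3 + (p + c2) + c1 - c4 by rewrite -E addrK.
  by rewrite [q + c3 + _]addrACA -[q + p + _ + c1]addrA -[q + p + _ - c4]addrA [LHS]addrC addKr.
have S'0 i : (size u <= i)%N -> S' i = 0.
  move=> um'; rewrite /S'.
  have lm : linear (fun c : ser H => c i) by [].
  rewrite (unsh_linear _ _ lm) -[RHS](unsh0 fst _ u); apply: eq_unsh => y z yz.
  rewrite mulNhE; case: ifP => // zm.
  (* For [y = [::]] the list [z] has the size of [u], so [mt z = 0]. Otherwise [piq] has degree at
     most [size y - 1], and the shift by [size z] keeps the total below [size u]. *)
  case: y yz => [|c y] yz.
    by rewrite piq1 /mt -(perm_size yz) ltnn cstE if_same scaler0.
  rewrite piq_deg ?scaler0 ?size_rcons //=.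
  have ar p q r : (p.+1 + q <= r -> p.+2 - 2 < r - q)%N by lia.
  by apply: ar; move: um'; rewrite -(perm_size yz) size_cat.
apply/funext => j; have := congr1 (fun c : ser H => c (size u + j)%N) piE.
rewrite /= serD S'0 ?leq_addr // addr0 mulNhE ltnNge leq_addr /= addKn.
rewrite cstE; case: j => [|j].
  rewrite addn0 /=; have := @piq_mprod k A R (rcons (rcons u a) b).
  rewrite !size_rcons subn2 /= => -> // /(scalerI _) E.
  rewrite /mcorr !size_rcons E //.
  by rewrite signr_eq0.
rewrite piq_deg ?size_rcons //; last by rewrite subn2 /= addnS ltnS leq_addr.
by move=> /eqP; rewrite eq_sym scaler_eq0 signr_eq0 /= => /eqP.
Qed.

End SecondDerivatives.

(** * Symmetry and multilinearity of the classical limit *)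

Lemma flatten_cons (T : Type) (b : seq T) bs : flatten (b :: bs) = b ++ flatten bs.
Proof. by []. Qed.

Lemma count_cons (T : Type) (p : pred T) a s : count p (a :: s) = (p a + count p s)%N.
Proof. by []. Qed.

Lemma count_nil (T : Type) (p : pred T) : count p [::] = 0%N.
Proof. by []. Qed.

Lemma flatten_nil (T : Type) : flatten [::] = [::] :> seq T.
Proof. by []. Qed.

Ltac norm_count := repeat
  (progress rewrite -?cats1 ?flatten_cat ?flatten_cons ?flatten_nil ?cats0 ?count_cat ?count_cons ?count_nil).

(** Permutations between concatenations are linear identities between counts, which [lia]
    decides. *)
Ltac perm_count :=
  repeat match goal with H : is_true (perm_eq _ _) |- _ => move/permP: H => H end;
  let p := fresh "p" in apply/permP => p;
  repeat match goal with
    H : _ =1 _ |- _ => let H' := fresh in have H' := H p; clear H; move: H'; norm_count end;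
  norm_count; lia.

Section Symmetry.
Variables (k : fieldType) (T : eqType) (d : T -> int) (W : lmodType k).
Implicit Types (x y z s : seq T) (a b : T).

(** Splittings with [a] and [b] on the same side are covered by the two hypotheses; the other two
    kinds are exchanged, with the sign of the transposition. *)
Lemma unsh_sym s1 s2 a b (F : seq T -> seq T -> W) :
  (forall y1 y2 z, perm_eq ((y1 ++ a :: b :: y2) ++ z) (s1 ++ a :: b :: s2) ->
     F (y1 ++ a :: b :: y2) z = parity (d a * d b) *: F (y1 ++ b :: a :: y2) z) ->
  (forall y z1 z2, perm_eq (y ++ (z1 ++ a :: b :: z2)) (s1 ++ a :: b :: s2) ->
     F y (z1 ++ a :: b :: z2) = parity (d a * d b) *: F y (z1 ++ b :: a :: z2)) ->
  unsh d (s1 ++ a :: b :: s2) F = parity (d a * d b) *: unsh d (s1 ++ b :: a :: s2) F.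
Proof.
move=> sl sr; rewrite !unsh_cat unshZ; apply: eq_unsh => y1 z1 yz1 /=.
rewrite -!unshD unshZ; apply: eq_unsh => y2 z2 yz2.
have pm (w : seq T) : perm_eq w ((y1 ++ z1) ++ a :: b :: (y2 ++ z2)) ->
    perm_eq w (s1 ++ a :: b :: s2).
  move=> wp; apply: perm_trans wp _; apply: perm_cat => //.
  by rewrite !perm_cons.
rewrite sl; last first.
  by apply: pm; clear; perm_count.
rewrite [F (y1 ++ y2) (z1 ++ [:: a, b & z2])]sr; last first.
  by apply: pm; clear; perm_count.
rewrite !scalerDr !scalerA -!parityD !dg_cons.
rewrite -!addrA; congr (_ + _).
  by congr (_ *: _); apply: (parity_congr 0); ring.
rewrite !addrA; congr (_ + _); last first.
  by congr (_ *: _); apply: (parity_congr 0); ring.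
rewrite addrC; congr (_ + _).
  by congr (_ *: _); apply: (parity_congr 0); ring.
by congr (_ *: _); apply: (parity_congr (- d a * d b)); ring.
Qed.

(** The second hypothesis is needed when [a] and [b] end different blocks: ordering by last entries
    then interchanges these two neighbouring blocks. *)
Lemma psum_sym s1 s2 a b (G : seq (seq T) -> W) :
  (forall bs1 bs2 c1 c2,
     perm_eq (flatten (bs1 ++ (c1 ++ a :: b :: c2) :: bs2)) (s1 ++ a :: b :: s2) ->
     [::] \notin bs1 ++ bs2 ->
     G (bs1 ++ (c1 ++ a :: b :: c2) :: bs2)
       = parity (d a * d b) *: G (bs1 ++ (c1 ++ b :: a :: c2) :: bs2)) ->
  (forall bs1 bs2 c1 c2, perm_eq (flatten (bs1 ++ c1 :: c2 :: bs2)) (s1 ++ a :: b :: s2) ->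
     [::] \notin bs1 ++ c1 :: c2 :: bs2 ->
     G (bs1 ++ c1 :: c2 :: bs2)
       = parity (dg d c1 * dg d c2) *: G (bs1 ++ c2 :: c1 :: bs2)) ->
  psum d (s1 ++ a :: b :: s2) G = parity (d a * d b) *: psum d (s1 ++ b :: a :: s2) G.
Proof.
have [m] := ubnP (size (s1 ++ a :: b :: s2)); elim: m => // m IH in s1 s2 G *.
case: (lastP s2) => [|t c] sm Gi Gb.
  have E (a' b' : T) : s1 ++ [:: a'; b'] = rcons (rcons s1 a') b' by rewrite -!cats1 -catA.
  have X (a' b' : T) : psum d (s1 ++ [:: a'; b']) G =
    unsh d s1 (fun z1 w => unsh d w (fun z2 y => parity (d a' * dg d y) *:
       psum d z1 (fun bs => G (rcons (rcons bs (rcons z2 a')) (rcons y b')))))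
    + unsh d s1 (fun z y => psum d z (fun bs => G (rcons bs (rcons (rcons y a') b')))).
    rewrite E psum_rcons unsh_rcons; congr (_ + _).
    under eq_unsh => z y _ do rewrite psum_rcons unshZ.
    by rewrite (unshA d s1 (fun z1 z2 y => parity (d a' * dg d y) *:
       psum d z1 (fun bs => G (rcons (rcons bs (rcons z2 a')) (rcons y b'))))).
  rewrite !X scalerDr; congr (_ + _).
    rewrite unshZ; apply: eq_unsh => z1 w zw.
    rewrite [in RHS]unshC unshZ; apply: eq_unsh => z2 y zy.
    rewrite !scalerA [LHS]psumZ [RHS]psumZ; apply: eq_psum => bs bsz bs0.
    rewrite -!cats1 -!catA Gb ?scalerA -?parityD.
    - congr (_ *: _); rewrite !dg_cat !dg_cons dg_nil.
      by apply: (parity_congr (d a * dg d y)); ring.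
    - by perm_count.
    - by rewrite mem_cat !in_cons negb_or bs0; case: (z2); case: (y).
  rewrite unshZ; apply: eq_unsh => z y zy; rewrite psumZ; apply: eq_psum => bs bsz bs0.
  have R (a' b' : T) : rcons bs (rcons (rcons y a') b') = bs ++ (y ++ [:: a', b' & [::]]) :: [::].
    by rewrite -!cats1 -catA.
  rewrite !R; apply: Gi; last by rewrite cats0.
  by perm_count.
have E (a' b' : T) : s1 ++ [:: a', b' & rcons t c] = rcons (s1 ++ [:: a', b' & t]) c.
  by rewrite -!rcons_cons -rcons_cat.
rewrite !E !psum_rcons; apply: unsh_sym => [z1 z2 y zy|z y1 y2 zy].
  apply: IH => [|bs1 bs2 c1 c2 cz c0|bs1 bs2 c1 c2 cz c0].
  - move: sm; rewrite E size_rcons -(perm_size zy) size_cat ltnS.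
    exact: leq_ltn_trans (leq_addr _ _).
  - rewrite !rcons_cat !rcons_cons; apply: Gi; first by perm_count.
    by rewrite -rcons_cat mem_rcons in_cons negb_or c0 andbT; case: (y).
  - rewrite !rcons_cat !rcons_cons; apply: Gb; first by perm_count.
    by rewrite -!rcons_cons -rcons_cat mem_rcons in_cons negb_or c0 andbT; case: (y).
rewrite psumZ; apply: eq_psum => bs bsz bs0.
rewrite !rcons_cat !rcons_cons -!cats1; apply: Gi; last by rewrite cats0.
by perm_count.
Qed.

End Symmetry.

Definition hsym (k : fieldType) (V : gradedLmodType k) (W : lmodType k)
    (F : seq (hvec V) -> W) := forall s1 s2 (a b : hvec V),
  homogs (s1 ++ a :: b :: s2) ->
  F (s1 ++ a :: b :: s2) = parity (a.1 * b.1) *: F (s1 ++ b :: a :: s2).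

Lemma hlin_linear (k : fieldType) (V : lmodType k) (W X : lmodType k) (L : W -> X)
    (F : seq (int * V) -> W) : linear L -> hlin F -> hlin (fun x => L (F x)).
Proof. by move=> lL lF s1 s2 e c u v; rewrite lF lL. Qed.

Lemma hlin_rcons (k : fieldType) (V W : lmodType k) (F : seq (int * V) -> W) a :
  hlin F -> hlin (fun x => F (rcons x a)).
Proof. by move=> lF s1 s2 e c u v; rewrite !rcons_cat !rcons_cons lF. Qed.

Lemma hlin_cons (k : fieldType) (V W : lmodType k) (F : seq (int * V) -> W) a :
  hlin F -> hlin (fun x => F (a :: x)).
Proof. by move=> lF s1 s2; apply: (lF (a :: s1)). Qed.

Lemma hlin0 (k : fieldType) (V W : lmodType k) (F : seq (int * V) -> W) s1 s2 e :
  hlin F -> F (s1 ++ (e, 0) :: s2) = 0.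
Proof.
move=> lF; have := lF s1 s2 e 1 0 0; rewrite scaler0 addr0 scale1r.
by move=> /eqP; rewrite -{1}[F _]addr0 (inj_eq (addrI _)) eq_sym => /eqP.
Qed.

Lemma hblin_prod (k : fieldType) (V : lmodType k) (B : algType k) (F : seq (int * V) -> B) :
  hlin F -> hblin (fun bs => \prod_(b <- bs) F b).
Proof.
move=> lF bs1 bs2 s1 s2 e c u v; rewrite !big_cat !big_cons /= lF.
by rewrite mulrDl mulrDr -scalerAl -scalerAr.
Qed.

Lemma mlin_slot0 (k : fieldType) (V W : lmodType k) (F : seq V -> W) s1 s2 :
  mlin F -> linear (fun v => F (s1 ++ v :: s2)).
Proof. by move=> lF c u v; apply: lF. Qed.

Section ClassicalFamilies.
Variables (k : fieldType) (A : binary_QFT_algebra k) (R : retract A).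
Hypothesis hA : anomaly_free R.
Let H : gradedLmodType k := classical_cohomology A.
Let h := rt_h R.
Let s := rt_s R.
Notation phiq := (phiq R).
Notation Omegaq := (Omegaq R).
Notation desc_arg := (desc_arg R).
Notation prim := (prim R).
Notation obstr := (obstr R).
Notation mcorr := (mcorr R).
Implicit Types (x y z u : seq (hvec H)) (bs : seq (seq (hvec H))) (a b : hvec H).
Let mulNhL (V : lmodType k) e : linear (mulNh e : ser V -> ser V) := @mulNh_linear k V e.

Lemma iter_nabla_linear n : linear (iter n (nabla R)).
Proof.
elim: n => [|n IH] c u v //=; rewrite IH; exact: nabla_linear.
Qed.

(** The family is a parameter so that an induction on the length can insert one cut off at that
    length. *)
Definition Omega_step N (F : seq (hvec H) -> ser A) x : ser A :=
  psum fst x (fun bs => if size bs == 1%N then 0 else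
    mulNh (N - size bs) (\prod_(b <- bs) F b)).

Lemma Omega_step_hlin N F : hlin F -> hlin (Omega_step N F).
Proof.
move=> lF; apply: psum_hlin => bs1 bs2 s1 s2 e c u v; rewrite !size_cat /=.
case: ifP => _; first by rewrite scaler0 addr0.
by rewrite (hblin_prod lF) mulNhL.
Qed.

Lemma phiq_hlin : hlin phiq.
Proof.
(* [hlin] speaks of lists of every length, so the induction is on a cut-off [m] of the family. *)
suff hm m : hlin (fun x => if (size x <= m)%N then phiq x else 0).
  move=> s1 s2 e c u v; have := hm (size s1 + size s2).+1 s1 s2 e c u v.
  by rewrite !size_cat /= addnS leqnn.
elim: m => [|m IH] s1 s2 e c u v; rewrite !size_cat /= addnS.
  by rewrite scaler0 addr0.
case: ifP => sm; last by rewrite scaler0 addr0.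
have sE w : size (s1 ++ (e, w) :: s2) = (size s1 + size s2).+1 by rewrite size_cat addnS.
have [s0|s0] := posnP (size s1 + size s2).
  move: s0 => /eqP; rewrite addn_eq0 !size_eq0 => /andP[/eqP-> /eqP->] /=.
  by rewrite !(phiq1 hA) cst_linear (fhat_serlin hA).1.
have E w : phiq (s1 ++ (e, w) :: s2) =
  - iter (size s1 + size s2) (nabla R) (Omega_step (size s1 + size s2).+1
      (fun x => if (size x <= m)%N then phiq x else 0) (s1 ++ (e, w) :: s2)).
  rewrite phiqE sE //= OmegaqE; congr (- iter _ _ _).
  apply: eq_psum => bs bsx bs0; rewrite sE; case: eqP => // /eqP bs1.
  congr mulNh; apply: eq_big_seq => b bbs.
  rewrite ifT //; have := block_lt bsx bs0 bs1 bbs; rewrite sE ltnS => le.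
  exact: leq_trans le sm.
by rewrite !E (Omega_step_hlin _ IH) iter_nabla_linear opprD scalerN.
Qed.

Lemma Omega_step_size x : Omegaq x = Omega_step (size x) phiq x.
Proof. exact: OmegaqE. Qed.

Lemma Omegaq_hlin : hlin Omegaq.
Proof.
move=> s1 s2 e c u v; rewrite !Omega_step_size !size_cat /=.
exact: (Omega_step_hlin _ phiq_hlin).
Qed.

(** The form h Omega_n^[n-2] of m_n, free of the sum over powers of - hbar in [pi_quantum];
    linearity and symmetry are visible from it. *)
Definition mcorr_iter x : H := h (iter (size x - 2) (nabla R) (Omegaq x) 0%N).

Lemma mqE x : (1 < size x)%N -> mcorr x = mcorr_iter x.
Proof.
move=> x1; rewrite /mcorr /mprod -/(piq R x) piqE // hsumE ifT; last first.
  by case: (size x) x1 => [|[|n]] // _; rewrite !subSS subn0.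
by rewrite scalerA -expr2 sqrr_sign scale1r.
Qed.

Lemma mcorr_iter_hlin : hlin mcorr_iter.
Proof.
move=> s1 s2 e c u v; rewrite /mcorr_iter !size_cat /= Omegaq_hlin iter_nabla_linear.
by rewrite serD serZ linearP.
Qed.

(** Omega involves shorter blocks only, symmetric by induction, and graded commutativity
    interchanges the factors; nabla is linear, so phi inherits the symmetry. *)
Lemma phiq_Omegaq_sym s1 s2 a b : homogs (s1 ++ a :: b :: s2) ->
  phiq (s1 ++ a :: b :: s2) = parity (a.1 * b.1) *: phiq (s1 ++ b :: a :: s2) /\
  Omegaq (s1 ++ a :: b :: s2) = parity (a.1 * b.1) *: Omegaq (s1 ++ b :: a :: s2).
Proof.
have [m] := ubnP (size (s1 ++ a :: b :: s2)).
elim: m => // m IH in s1 s2 a b * => sm hx.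
have sE (a' b' : hvec H) : size (s1 ++ a' :: b' :: s2) = (size s1 + size s2).+2.
  by rewrite size_cat !addnS.
have hOm : Omegaq (s1 ++ a :: b :: s2) = parity (a.1 * b.1) *: Omegaq (s1 ++ b :: a :: s2).
  rewrite !OmegaqE !sE; apply: psum_sym => [bs1 bs2 c1 c2 bsx bs0|bs1 bs2 c1 c2 bsx bs0].
    rewrite !size_cat /=; case: eqP => [_|/eqP n1]; first by rewrite scaler0.
    rewrite -(linfZ (@mulNhL _ _)) !big_cat !big_cons /=; congr mulNh.
    have bin : c1 ++ a :: b :: c2 \in bs1 ++ (c1 ++ a :: b :: c2) :: bs2.
      by rewrite mem_cat mem_head orbT.
    have bsn : [::] \notin bs1 ++ (c1 ++ a :: b :: c2) :: bs2.
      move: bs0; rewrite !mem_cat in_cons => /norP[/negPf-> /negPf->].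
      by case: (c1).
    rewrite (IH c1 c2 a b _ _).1 -?scalerAl ?scalerAr //.
      apply: leq_trans (block_lt bsx bsn _ bin) _; last by rewrite -ltnS.
      by rewrite size_cat.
    exact: homogs_block bsx hx bin.
  rewrite !size_cat /=; case: eqP => [_|/eqP n1]; first by rewrite scaler0.
  rewrite -(linfZ (@mulNhL _ _)) !big_cat !big_cons /=; congr mulNh.
  have hc c : c \in [:: c1; c2] -> homogs c.
    move=> cc; apply: homogs_block bsx hx _.
    by move: cc; rewrite mem_cat !in_cons orbF => /orP[]->; rewrite ?orbT.
  have c2in : c2 \in [:: c1; c2] by rewrite !in_cons eqxx orbT.
  rewrite [phiq c1 * (phiq c2 * _)]mulrA.
  rewrite (serC (homS_phiq hA (hc c1 (mem_head _ _))) (homS_phiq hA (hc c2 c2in))).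
  by rewrite -scalerAl -scalerAr -mulrA.
split=> //; rewrite !phiqE ?sE // hOm.
rewrite (linfZ (iter_nabla_linear (size s1 + size s2).+2.-1)).
exact: esym (scalerN _ _).
Qed.

Lemma phiq_sym : hsym phiq.
Proof. by move=> s1 s2 a b hx; case: (phiq_Omegaq_sym hx). Qed.

Lemma mcorr_iter_sym : hsym mcorr_iter.
Proof.
move=> s1 s2 a b hx; rewrite /mcorr_iter (phiq_Omegaq_sym hx).2 !size_cat /=.
by rewrite (linfZ (iter_nabla_linear _)) serZ linearZ.
Qed.

Definition phi0 x : A := phiq x 0%N.

Lemma phi0_hlin : hlin phi0.
Proof. exact: (hlin_linear (L := fun c : ser A => c 0%N)) phiq_hlin. Qed.

Lemma phi0_sym : hsym phi0.
Proof. by move=> s1 s2 a b hx; rewrite /phi0 phiq_sym. Qed.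

Lemma homog_phi0 x : homogs x -> homog (dg fst x) (phi0 x).
Proof. by move=> hx; apply: homS_phiq. Qed.

Definition ell0 (vs : seq A) : A := ellS vs 0%N.

Lemma ell0_mlin : mlin ell0.
Proof. by move=> s1 s2 c u v; rewrite /ell0 ellS_mlin. Qed.

Lemma ell0_sym s1 s2 (a b : hvec A) : homog a.1 a.2 -> homog b.1 b.2 ->
  ell0 (s1 ++ a.2 :: b.2 :: s2) = parity (a.1 * b.1) *: ell0 (s1 ++ b.2 :: a.2 :: s2).
Proof.
move=> ha hb.
have [_ _ sy] := @bqa_SHom k A (size s1 + size s2).+2 0 isT.
have E (a' b' : hvec A) : ell0 (s1 ++ a'.2 :: b'.2 :: s2)
  = bqa_ell A (size s1 + size s2).+2 0 (s1 ++ a'.2 :: b'.2 :: s2).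
  by rewrite -!addnS -[(size s2).+2]/(size (a'.2 :: b'.2 :: s2)) -size_cat /ell0 /ellS; case: (s1).
rewrite !E; apply: (sy (size s1)) => //.
by rewrite ltnS leq_addr.
Qed.

Definition desc0_arg (th : A) y : A := psum fst y (fun bs => ell0 (rcons (map phi0 bs) th)).

Lemma desc_arg_desc0_arg th y : desc_arg th y 0%N = desc0_arg (th 0%N) y.
Proof.
rewrite /desc_arg (psum_linear (L := fun c : ser A => c 0%N)) //.
apply: eq_psum => bs _ _; rewrite /lhat ser_eval_0 /ell0; congr (ellS _ _).
by rewrite map_rcons -map_comp.
Qed.

Lemma desc0_arg_hlin th : hlin (desc0_arg th).
Proof.
apply: psum_hlin => bs1 bs2 s1 s2 e c u v.
by rewrite !map_cat !map_cons phi0_hlin !rcons_cat !rcons_cons ell0_mlin.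
Qed.

Lemma desc0_arg_linear y : linear (desc0_arg^~ y).
Proof.
move=> c u v; rewrite /desc0_arg psumZ -psumD; apply: eq_psum => bs _ _.
by rewrite -!cats1 ell0_mlin.
Qed.

Lemma desc0_arg_sym th : hsym (desc0_arg th).
Proof.
move=> s1 s2 a b hx; apply: psum_sym => [bs1 bs2 c1 c2 bsx bs0|bs1 bs2 c1 c2 bsx bs0].
  have bin : c1 ++ a :: b :: c2 \in bs1 ++ (c1 ++ a :: b :: c2) :: bs2.
    by rewrite mem_cat mem_head orbT.
  rewrite !map_cat !map_cons (phi0_sym (homogs_block bsx hx bin)) !rcons_cat !rcons_cons.
  exact: (linfZ (mlin_slot0 _ _ ell0_mlin)).
have hc c : c \in [:: c1; c2] -> homogs c.
  move=> cc; apply: homogs_block bsx hx _.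
  by move: cc; rewrite mem_cat !in_cons orbF => /orP[]->; rewrite ?orbT.
rewrite !map_cat !map_cons !rcons_cat !rcons_cons.
apply: (@ell0_sym _ _ (dg fst c1, phi0 c1) (dg fst c2, phi0 c2)).
  by apply: homog_phi0; apply: hc; rewrite mem_head.
by apply: homog_phi0; apply: hc; rewrite !in_cons eqxx orbT.
Qed.

Definition prim0 x : A := prim x 0%N.

(** This and the next two are the classical limits of the terms of [obstr] and become the three sums
    of M_n; the summand lambda @_a @_b Phi has no classical part. The parameters [mu] and [tau]
    allow other forms or truncations of the families to be substituted. *)
Definition obstr0_prod a b u : A := unsh fst u (fun y z => parity (a.1 * dg fst z) *:
  (phi0 (rcons y a) * phi0 (rcons z b))).

Definition obstr0_phi (mu : seq (hvec H) -> H) a b u : A :=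
  unsh fst u (fun y z => if y is [::] then 0 else
    phi0 (rcons y (deg3 a b z, mu (rcons (rcons z a) b)))).

Definition obstr0_ell (tau : seq (hvec H) -> A) a b u : A :=
  unsh fst u (fun y z => if y is [::] then 0 else
    parity (dg fst y) *: desc0_arg (tau (rcons (rcons z a) b)) y).

Definition obstr0 a b u : A := obstr0_prod a b u - obstr0_phi mcorr a b u - obstr0_ell prim0 a b u.

Lemma obstr_obstr0 a b u : obstr prim a b u 0%N = obstr0 a b u.
Proof.
have l0 : linear (fun c : ser A => c 0%N) by [].
rewrite /obstr !serB /hessian serD mulNhE /= add0r !(unsh_linear _ _ l0).
congr (_ - _ - _); apply: eq_unsh => y z _.
- by rewrite serZ serM0.
- by case: y.
- by case: y => // c y; rewrite serZ desc_arg_desc0_arg.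
Qed.

Lemma prim0E u a b : prim0 (rcons (rcons u a) b) = s (obstr0 a b u).
Proof. by rewrite /prim0 primE /exact_part expr0 scale1r /= obstr_obstr0. Qed.

Lemma obstr0_phi_mcorr_iter a b u : obstr0_phi mcorr a b u = obstr0_phi mcorr_iter a b u.
Proof.
apply: eq_unsh => -[|c y] z _ //; rewrite mqE //.
by rewrite !size_rcons.
Qed.

End ClassicalFamilies.

Section ClassicalObstruction.
Variables (k : fieldType) (A : binary_QFT_algebra k) (R : retract A).
Hypothesis hA : anomaly_free R.
Let H : gradedLmodType k := classical_cohomology A.
Let s := rt_s R.
Notation mcorr_iter := (mcorr_iter R).
Notation phi0 := (phi0 R).
Notation prim0 := (prim0 R).
Notation obstr0 := (obstr0 R).
Notation obstr0_prod := (obstr0_prod R).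
Notation obstr0_phi := (obstr0_phi R).
Notation obstr0_ell := (obstr0_ell R).
Implicit Types (x y z u : seq (hvec H)) (bs : seq (seq (hvec H))) (a b : hvec H).

Lemma phi0_last y e : linear (fun v => phi0 (rcons y (e, v))).
Proof. by move=> c u v; rewrite -!cats1 phi0_hlin. Qed.

Lemma hlin_rcons2 (W : lmodType k) (F : seq (hvec H) -> W) a b :
  hlin F -> hlin (fun x => F (rcons (rcons x a) b)).
Proof. by move=> hF; apply: (hlin_rcons (F := fun x => F (rcons x b)) a (hlin_rcons b hF)). Qed.

Lemma dg_slotH s1 s2 e (v w : H) :
  dg fst (s1 ++ (e, v) :: s2) = dg fst (s1 ++ (e, w) :: s2).
Proof. by rewrite !dg_cat !dg_cons. Qed.

Lemma obstr0_prod_hlin a b : hlin (obstr0_prod a b).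
Proof.
apply: unsh_hlin => [z|y] s1 s2 e c u v.
  rewrite (hlin_rcons a (phi0_hlin hA)) mulrDl scalerDr -scalerAl.
  by rewrite [in RHS]scalerA [c * _]mulrC -scalerA.
rewrite (hlin_rcons b (phi0_hlin hA)) mulrDr scalerDr -scalerAr.
rewrite (dg_slotH s1 s2 e (c *: u + v) u) (dg_slotH s1 s2 e v u).
by rewrite [in RHS]scalerA [c * _]mulrC -scalerA.
Qed.

Lemma obstr0_phi_hlin mu a b : hlin mu -> hlin (obstr0_phi mu a b).
Proof.
move=> hmu; apply: unsh_hlin => [z|y] s1 s2 e c u v.
  case: s1 => [|d s1] /=.
    exact: (hlin_rcons _ (phi0_hlin hA) [::]).
  exact: (hlin_rcons _ (phi0_hlin hA) (d :: s1)).
case: y => [|d y]; first by rewrite scaler0 addr0.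
rewrite (hlin_rcons2 a b hmu) /deg3.
by rewrite (dg_slotH s1 s2 e (c *: u + v) u) (dg_slotH s1 s2 e v u) phi0_last.
Qed.

Lemma obstr0_ell_hlin tau a b : hlin tau -> hlin (obstr0_ell tau a b).
Proof.
move=> htau; apply: unsh_hlin => [z|y] s1 s2 e c u v.
  rewrite (dg_slotH s1 s2 e (c *: u + v) u) (dg_slotH s1 s2 e v u).
  have := @desc0_arg_hlin k A R hA (tau (rcons (rcons z a) b)) s1 s2 e c u v.
  case: s1 => [|d s1] /= ->; rewrite scalerDr; congr (_ + _);
    by rewrite !scalerA mulrC.
case: y => [|d y]; first by rewrite scaler0 addr0.
rewrite (hlin_rcons2 a b htau) desc0_arg_linear scalerDr; congr (_ + _).
by rewrite !scalerA mulrC.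
Qed.

Lemma obstr0_prod_a e b u : linear (fun v => obstr0_prod (e, v) b u).
Proof.
move=> c v w; rewrite /obstr0_prod unshZ -unshD; apply: eq_unsh => y z _ /=.
by rewrite phi0_last mulrDl scalerDr -scalerAl !scalerA mulrC.
Qed.

Lemma obstr0_prod_b a e u : linear (fun v => obstr0_prod a (e, v) u).
Proof.
move=> c v w; rewrite /obstr0_prod unshZ -unshD; apply: eq_unsh => y z _ /=.
by rewrite phi0_last mulrDr scalerDr -scalerAr !scalerA mulrC.
Qed.

Lemma obstr0_phi_a mu e b u : hlin mu -> linear (fun v => obstr0_phi mu (e, v) b u).
Proof.
move=> hmu c v w; rewrite /obstr0_phi unshZ -unshD; apply: eq_unsh => -[|d y] z _.
  by rewrite scaler0 addr0.
by rewrite -!cats1 -!(catA z) /= hmu (phi0_hlin hA (d :: y) [::]).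
Qed.

Lemma obstr0_phi_b mu a e u : hlin mu -> linear (fun v => obstr0_phi mu a (e, v) u).
Proof.
move=> hmu c v w; rewrite /obstr0_phi unshZ -unshD; apply: eq_unsh => -[|d y] z _.
  by rewrite scaler0 addr0.
by rewrite -!(cats1 (rcons z a)) hmu phi0_last.
Qed.

Lemma obstr0_ell_a tau e b u : hlin tau -> linear (fun v => obstr0_ell tau (e, v) b u).
Proof.
move=> htau c v w; rewrite /obstr0_ell unshZ -unshD; apply: eq_unsh => -[|d y] z _.
  by rewrite scaler0 addr0.
rewrite -!cats1 -!(catA z) /= htau desc0_arg_linear scalerDr; congr (_ + _).
by rewrite !scalerA mulrC.
Qed.

Lemma obstr0_ell_b tau a e u : hlin tau -> linear (fun v => obstr0_ell tau a (e, v) u).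
Proof.
move=> htau c v w; rewrite /obstr0_ell unshZ -unshD; apply: eq_unsh => -[|d y] z _.
  by rewrite scaler0 addr0.
rewrite -!(cats1 (rcons z a)) htau desc0_arg_linear scalerDr; congr (_ + _).
by rewrite !scalerA mulrC.
Qed.

Lemma lin3B (W : lmodType k) (c : k) (p1 p2 p3 q1 q2 q3 r1 r2 r3 : W) :
  p1 = c *: p2 + p3 -> q1 = c *: q2 + q3 -> r1 = c *: r2 + r3 ->
  p1 - q1 - r1 = c *: (p2 - q2 - r2) + (p3 - q3 - r3).
Proof.
by move=> -> -> ->; rewrite !scalerBr !opprD [c *: p2 + p3 + _]addrACA [LHS]addrACA.
Qed.

Lemma prim0_small x : (size x <= 1)%N -> prim0 x = 0.
Proof. by case: x => [|a [|]]. Qed.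

Definition obstr0_trunc tau a b u : A := obstr0_prod a b u - obstr0_phi mcorr_iter a b u - obstr0_ell tau a b u.

Lemma prim0_hlin : hlin prim0.
Proof.
suff hm m : hlin (fun x => if (size x <= m)%N then prim0 x else 0).
  move=> s1 s2 e c u v; have := hm (size s1 + size s2).+1 s1 s2 e c u v.
  by rewrite !size_cat /= addnS leqnn.
elim: m => [|m IH] s1 s2 e c u v; rewrite !size_cat /= addnS.
  by rewrite scaler0 addr0.
case: ifP => sm; last by rewrite scaler0 addr0.
pose tau x := if (size x <= m)%N then prim0 x else 0.
have E u' a b : (size u' <= m.-1)%N -> prim0 (rcons (rcons u' a) b) = s (obstr0_trunc tau a b u').
  move=> um; rewrite prim0E // /obstr0 obstr0_phi_mcorr_iter; congr (s (_ - _)).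
  apply: eq_unsh => -[|d y] z yz //; rewrite /tau ifT // !size_rcons.
  have := size_right yz isT.
  have ar p q : (q <= m.-1 -> p < q -> p.+2 <= m)%N by lia.
  exact: ar um.
(* The varied entry is the last one, the last but one, or lies in the list [u] of the recursion. *)
case: (lastP s2) sm => [|t b] sm.
  case: (lastP s1) sm => [|t a] sm.
    by rewrite !prim0_small // scaler0 addr0.
  rewrite !cats1 !E; last first.
  1-3: by move: sm; rewrite size_rcons addn0; case: (m).
  rewrite -linearP; congr (s _); apply: lin3B; first exact: obstr0_prod_b.
    exact: (obstr0_phi_b _ _ _ (mcorr_iter_hlin hA)).
  exact: (obstr0_ell_b _ _ _ IH).
case: (lastP t) sm => [|t' a] sm.
  have rE w : s1 ++ (e, w) :: rcons [::] b = rcons (rcons s1 (e, w)) b.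
    by rewrite -!cats1 -catA.
  rewrite !rE !E; last first.
  1-3: by move: sm; rewrite /= addn1; case: (m).
  rewrite -linearP; congr (s _); apply: lin3B; first exact: obstr0_prod_a.
    exact: (obstr0_phi_a _ _ _ (mcorr_iter_hlin hA)).
  exact: (obstr0_ell_a _ _ _ IH).
have rE w : s1 ++ (e, w) :: rcons (rcons t' a) b = rcons (rcons (s1 ++ (e, w) :: t') a) b.
  by rewrite !rcons_cat !rcons_cons.
rewrite !rE !E; last first.
1-3: move: sm; rewrite !size_rcons size_cat /= !addnS => sm;
  have ar p : (p.+2 < m.+1 -> p.+1 <= m.-1)%N by lia.
1-3: exact: ar sm.
rewrite -linearP; congr (s _); apply: lin3B; first exact: obstr0_prod_hlin.
  exact: (obstr0_phi_hlin _ _ (mcorr_iter_hlin hA)).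
exact: (obstr0_ell_hlin _ _ IH).
Qed.

Lemma unshC_sym a b u : homogs u -> homog a.1 a.2 -> homog b.1 b.2 ->
  obstr0_prod a b u = parity (a.1 * b.1) *: obstr0_prod b a u.
Proof.
move=> hu ha hb; rewrite /obstr0_prod [in RHS]unshC unshZ; apply: eq_unsh => y z yz.
have [hy hz] := homogs_split yz hu.
have hya : homogs (rcons y a) by apply/homogs_rcons.
have hzb : homogs (rcons z b) by apply/homogs_rcons.
have := @gmulC k A _ _ _ _ (homog_phi0 hA hya) (homog_phi0 hA hzb).
move=> ->; rewrite !scalerA -!parityD !dg_rcons.
congr (_ *: _); apply: (parity_congr (a.1 * dg fst z)); ring.
Qed.

Lemma perm_swap2 (U : eqType) (t1 t2 : seq U) p q :
  perm_eq (t1 ++ p :: q :: t2) (t1 ++ q :: p :: t2).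
Proof. by perm_count. Qed.

Lemma hsym_rcons (W : lmodType k) (F : seq (hvec H) -> W) c : hsym F -> homog c.1 c.2 ->
  hsym (fun x => F (rcons x c)).
Proof.
move=> sF hc s1 s2 a b hx; rewrite !rcons_cat !rcons_cons sF //.
by rewrite -!rcons_cons -rcons_cat; apply/homogs_rcons.
Qed.

Lemma obstr0_prod_sym a b : homog a.1 a.2 -> homog b.1 b.2 -> hsym (obstr0_prod a b).
Proof.
move=> ha hb s1 s2 p q hx; apply: unsh_sym => [y1 y2 z yz|y z1 z2 yz].
  have [hy hz] := homogs_split yz hx.
  rewrite (hsym_rcons (phi0_sym hA) ha hy) -scalerAl.
  by rewrite [LHS]scalerA mulrC -scalerA.
have [hy hz] := homogs_split yz hx.
rewrite (hsym_rcons (phi0_sym hA) hb hz) -scalerAr.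
by rewrite (dg_perm fst (perm_swap2 z1 z2 p q)) [LHS]scalerA mulrC -scalerA.
Qed.

Lemma homog_mcorr_iter a b z : homogs z -> homog a.1 a.2 -> homog b.1 b.2 ->
  homog (deg3 a b z) (mcorr_iter (rcons (rcons z a) b)).
Proof.
move=> hz ha hb; rewrite -mqE ?size_rcons // /deg3 -!dg_rcons.
apply: homog_mcorr; rewrite ?size_rcons //.
by apply/homogs_rcons; split=> //; apply/homogs_rcons.
Qed.

Lemma hsym_rcons2 (W : lmodType k) (F : seq (hvec H) -> W) a b :
  hsym F -> homog a.1 a.2 -> homog b.1 b.2 -> hsym (fun x => F (rcons (rcons x a) b)).
Proof.
move=> sF ha hb; apply: (hsym_rcons (F := fun x => F (rcons x b)) _ ha).
exact: hsym_rcons.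
Qed.

Lemma obstr0_phi_sym a b : homog a.1 a.2 -> homog b.1 b.2 -> hsym (obstr0_phi mcorr_iter a b).
Proof.
move=> ha hb s1 s2 p q hx; apply: unsh_sym => [y1 y2 z yz|y z1 z2 yz].
  have [hy hz] := homogs_split yz hx.
  have := hsym_rcons (c := (deg3 a b z, mcorr_iter (rcons (rcons z a) b)))
    (phi0_sym hA) (homog_mcorr_iter hz ha hb) hy.
  by case: y1 {yz hy} => [|d y1].
have [hy hz] := homogs_split yz hx.
case: y yz hy => [|d y] yz hy; first by rewrite scaler0.
rewrite (hsym_rcons2 (mcorr_iter_sym hA) ha hb hz) (linfZ (phi0_last _ _)) /deg3.
by rewrite (dg_perm fst (perm_swap2 z1 z2 p q)).
Qed.

Lemma obstr0_phi_symab a b u : homogs u -> homog a.1 a.2 -> homog b.1 b.2 ->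
  obstr0_phi mcorr_iter a b u = parity (a.1 * b.1) *: obstr0_phi mcorr_iter b a u.
Proof.
move=> hu ha hb; rewrite /obstr0_phi unshZ; apply: eq_unsh => y z yz.
have [hy hz] := homogs_split yz hu.
case: y yz hy => [|d y] yz hy; first by rewrite scaler0.
have rE a' b' : rcons (rcons z a') b' = z ++ [:: a'; b'] by rewrite -!cats1 -catA.
rewrite !rE (mcorr_iter_sym hA) ?(linfZ (phi0_last _ _)).
  by rewrite /deg3 addrAC.
by rewrite -rE; apply/homogs_rcons; split=> //; apply/homogs_rcons.
Qed.

(** [size s2 = 1] is the exchange across the two factors of S^{n-2}H (x) S^2H. Swapping the last two
    entries uses the symmetry of the obstruction in [a] and [b]; earlier swaps use its symmetry in
    [u]. *)
Lemma prim0_sym s1 s2 a b : size s2 != 1%N -> homogs (s1 ++ a :: b :: s2) ->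
  prim0 (s1 ++ a :: b :: s2) = parity (a.1 * b.1) *: prim0 (s1 ++ b :: a :: s2).
Proof.
have [m] := ubnP (size (s1 ++ a :: b :: s2)).
elim: m => // m IH in s1 s2 a b * => sm ss hx.
case: (lastP s2) sm ss hx => [|t d]; last case: (lastP t) => [|t' c].
- move=> sm _ hx; have rE a' b' : s1 ++ [:: a'; b'] = rcons (rcons s1 a') b'.
    by rewrite -!cats1 -catA.
  move: hx; rewrite !rE => /homogs_rcons[/homogs_rcons[hs ha] hb].
  rewrite !prim0E // /obstr0 !obstr0_phi_mcorr_iter // -linearZ; congr (s _).
  rewrite !scalerBr -unshC_sym // -obstr0_phi_symab //; congr (_ - _).
  rewrite /obstr0_ell unshZ; apply: eq_unsh => y z yz; have [hy hz] := homogs_split yz hs.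
  case: y yz hy => [|y0 y] yz hy; first by rewrite scaler0.
  have lt := size_right yz isT.
  have rz a' b' : rcons (rcons z a') b' = z ++ [:: a', b' & [::]] by rewrite -!cats1 -catA.
  rewrite !rz (IH z [::] a b) //.
  + by rewrite (linfZ (@desc0_arg_linear _ _ _ _)) scalerA mulrC -scalerA.
  + have lz : (size (z ++ [:: a; b]) < size (s1 ++ [:: a; b]))%N.
      by rewrite !size_cat ltn_add2r.
    exact: leq_trans lz sm.
  by rewrite -rz; apply/homogs_rcons; split=> //; apply/homogs_rcons.
- by move=> _.
- move=> sm _ hx.
  have rE a' b' : s1 ++ a' :: b' :: rcons (rcons t' c) d
     = rcons (rcons (s1 ++ a' :: b' :: t') c) d.
    by rewrite !rcons_cat !rcons_cons.
  move: hx; rewrite !rE => /homogs_rcons[/homogs_rcons[hs hc] hd].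
  rewrite !prim0E // /obstr0 !obstr0_phi_mcorr_iter // -linearZ; congr (s _).
  rewrite !scalerBr -obstr0_prod_sym // -obstr0_phi_sym //; congr (_ - _).
  apply: unsh_sym => [y1 y2 z yz|y z1 z2 yz].
    have [hy hz] := homogs_split yz hs.
    rewrite (dg_perm fst (perm_swap2 y1 y2 a b)).
    have := desc0_arg_sym hA (prim0 (rcons (rcons z c) d)) hy.
    by case: y1 {yz hy} => [|y0 y1] /= ->; rewrite !scalerA mulrC.
  have [hy hz] := homogs_split yz hs.
  case: y yz hy => [|y0 y] yz hy; first by rewrite scaler0.
  have lt := size_right yz isT.
  have rz a' b' : rcons (rcons (z1 ++ a' :: b' :: z2) c) d
     = z1 ++ a' :: b' :: rcons (rcons z2 c) d.
    by rewrite !rcons_cat !rcons_cons.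
  rewrite !rz (IH z1 (rcons (rcons z2 c) d) a b).
  - by rewrite (linfZ (@desc0_arg_linear _ _ _ _)) !scalerA mulrC.
  - have lz : (size (z1 ++ a :: b :: rcons (rcons z2 c) d)
        < size (s1 ++ a :: b :: rcons (rcons t' c) d))%N.
      by rewrite -rz rE !size_rcons !ltnS.
    exact: leq_trans lz sm.
  - by rewrite !size_rcons.
  by rewrite -rz; apply/homogs_rcons; split=> //; apply/homogs_rcons.
Qed.

End ClassicalObstruction.

(** * Multilinear extension to inhomogeneous vectors *)

Section Projections.
Variables (k : fieldType) (V : gradedLmodType k).

(** Vanishing outside [r] makes [q] unique although [r] is not, so that the chosen components depend
    linearly on [v]. *)
Definition is_decomp (v : V) (r : seq int) (q : int -> V) :=
  [/\ uniq r, forall i, homog i (q i), forall i, i \notin r -> q i = 0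
    & v = \sum_(i <- r) q i].

Lemma decomp_exists v : exists rq, is_decomp v rq.1 rq.2.
Proof.
have [r [u [ur [hu ->]]]] := homog_span v.
exists (r, fun i => if i \in r then u i else 0); split=> //= [i|i /negPf->//|].
  by case: ifP => _ //; apply: homog0.
by apply: eq_big_seq => i ->.
Qed.

Definition decomp v : seq int * (int -> V) := projT1 (cid (decomp_exists v)).

Definition supp v : seq int := (decomp v).1.

Definition proj (i : int) v : V := (decomp v).2 i.

Lemma decompP v : is_decomp v (supp v) (proj^~ v).
Proof. exact: projT2 (cid (decomp_exists v)). Qed.

Lemma homog_proj i v : homog i (proj i v).
Proof. by case: (decompP v). Qed.

Lemma sum_widen (W : zmodType) (r r' : seq int) (F : int -> W) : uniq r -> uniq r' ->
  {subset r <= r'} -> (forall i, i \notin r -> F i = 0) ->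
  \sum_(i <- r) F i = \sum_(i <- r') F i.
Proof.
move=> ur ur' rr' F0; rewrite -(sum_subset F ur' ur rr') big_mkcond.
by apply: eq_bigr => i _; case: ifPn => // /F0.
Qed.

Lemma decomp_uniq v r q : is_decomp v r q -> forall i, q i = proj i v.
Proof.
case: (decompP v) => us hp p0 vE [ur hq q0 vE'] i.
pose R := undup (r ++ supp v).
have uR : uniq R by apply: undup_uniq.
have sr : {subset r <= R} by move=> j jr; rewrite mem_undup mem_cat jr.
have ss : {subset supp v <= R} by move=> j jr; rewrite mem_undup mem_cat jr orbT.
have [iR|] := boolP (i \in R); last first.
  by rewrite mem_undup mem_cat => /norP[/q0-> /p0->].
apply/eqP; rewrite -subr_eq0; apply/eqP.
apply: (@homog_free _ _ R (fun j => q j - proj j v)) => // [j|].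
  by apply: homogD => //; apply: homogN.
rewrite sumrB -(sum_widen ur uR sr q0) -(sum_widen us uR ss p0).
by rewrite -vE' -vE subrr.
Qed.

Lemma proj_linear i : linear (proj i).
Proof.
move=> c u v; have [us hp p0 uE] := decompP u; have [us' hp' p0' vE] := decompP v.
pose R := undup (supp u ++ supp v).
have uR : uniq R by apply: undup_uniq.
have su : {subset supp u <= R} by move=> j jr; rewrite mem_undup mem_cat jr.
have sv : {subset supp v <= R} by move=> j jr; rewrite mem_undup mem_cat jr orbT.
apply/esym; apply: (@decomp_uniq _ R (fun i => c *: proj i u + proj i v)); split=> //.
- by move=> j; apply: homogP.
- by move=> j; rewrite mem_undup mem_cat => /norP[/p0-> /p0'->]; rewrite scaler0 addr0.
rewrite big_split -scaler_sumr /= -(sum_widen us uR su p0) -(sum_widen us' uR sv p0').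
by rewrite -uE -vE.
Qed.

Lemma proj_homog i j v : homog i v -> proj j v = if j == i then v else 0.
Proof.
move=> hv; apply/esym; apply: (@decomp_uniq _ [:: i] (fun j => if j == i then v else 0)).
split=> // [l|l|]; last by rewrite big_seq1 eqxx.
  by case: eqP => [->|_] //; apply: homog0.
by rewrite inE => /negPf->.
Qed.

End Projections.

Section MultilinearExtension.
Variables (k : fieldType) (V W : gradedLmodType k).
Implicit Types (F G : seq (hvec V) -> W).

(** Signs in the recursion refer to degrees, whereas phi^{-1} takes bare vectors; each vector is
    expanded into its homogeneous components. *)
Fixpoint multilin_ext F (vs : seq V) : W :=
  if vs is v :: vs' then
    \sum_(i <- supp v) multilin_ext (fun x => F ((i, proj i v) :: x)) vs'
  else F [::].

Lemma multilin_ext_comb c F G vs :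
  multilin_ext (fun x => c *: F x + G x) vs = c *: multilin_ext F vs + multilin_ext G vs.
Proof.
elim: vs F G => //= v vs IH F G; rewrite scaler_sumr -big_split.
by apply: eq_bigr => i _; rewrite IH.
Qed.

Lemma eq_multilin_ext F G vs : (forall x, homogs x -> size x = size vs -> F x = G x) ->
  multilin_ext F vs = multilin_ext G vs.
Proof.
elim: vs F G => [|v vs IH] F G FG /=; first by apply: FG.
apply: eq_bigr => i _; apply: IH => x hx sx; apply: FG; last by rewrite /= sx.
move=> y; rewrite in_cons => /predU1P[->|/hx//]; exact: homog_proj.
Qed.

Lemma mext0 vs : multilin_ext (fun=> 0) vs = 0.
Proof. by elim: vs => //= v vs IH; rewrite big1. Qed.

(** Zero components contribute nothing, so one index list can serve several vectors. *)
Lemma multilin_ext_cons F v vs r : hlin F -> uniq r -> {subset supp v <= r} ->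
  multilin_ext F (v :: vs) = \sum_(i <- r) multilin_ext (fun x => F ((i, proj i v) :: x)) vs.
Proof.
move=> lF ur sr; have [us _ p0 _] := decompP v.
apply: sum_widen => // i /p0 E.
rewrite -[RHS](mext0 vs); apply: eq_multilin_ext => x _ _.
by rewrite E (hlin0 [::]).
Qed.

Lemma multilin_ext_multilinear F n : hlin F -> multilinear n (multilin_ext F).
Proof.
move=> lF s1 s2 c u v _; elim: s1 F lF => [|w s1 IH] F lF; last first.
  rewrite /= scaler_sumr -big_split; apply: eq_bigr => i _; apply: IH.
  exact: hlin_cons.
pose r := undup (supp (c *: u + v) ++ supp u ++ supp v).
have ur : uniq r by apply: undup_uniq.
rewrite /cat !(multilin_ext_cons _ lF ur) => [|i|i|i]; try by rewrite mem_undup !mem_cat => ->; rewrite ?orbT.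
rewrite scaler_sumr -big_split; apply: eq_bigr => i _ /=.
rewrite -multilin_ext_comb; apply: eq_multilin_ext => x _ _.
by rewrite proj_linear (lF [::]).
Qed.

Lemma multilin_ext_hom F (a : hvec V) vs : hlin F -> homog a.1 a.2 ->
  multilin_ext F (a.2 :: vs) = multilin_ext (fun x => F (a :: x)) vs.
Proof.
case: a => e v lF /= hv.
have [us _ p0 _] := decompP v.
(* [supp v] may miss [e] when [v = 0], and may contain degrees in which the component is zero. *)
pose r := undup (e :: supp v).
have ur : uniq r by apply: undup_uniq.
have er : e \in r by rewrite mem_undup mem_head.
rewrite -[LHS]/(multilin_ext F (v :: vs)) (multilin_ext_cons _ lF ur); last first.
  by move=> i iv; rewrite mem_undup in_cons iv orbT.
rewrite (bigD1_seq e) //= big1 => [|i ie].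
  by rewrite addr0; apply: eq_multilin_ext => x _ _; rewrite (proj_homog _ hv) eqxx.
rewrite -[RHS](mext0 vs); apply: eq_multilin_ext => x _ _.
by rewrite (proj_homog _ hv) (negPf ie) (hlin0 [::]).
Qed.

Lemma multilin_ext_vects F x : hlin F -> homogs x -> multilin_ext F (vects x) = F x.
Proof.
elim: x F => // a x IH F lF hx.
have [hx' ha] : homogs x /\ homog a.1 a.2.
  by split=> [b bx|]; apply: hx; rewrite in_cons ?bx ?orbT ?eqxx.
by rewrite [LHS](multilin_ext_hom _ lF ha) IH //; apply: hlin_cons.
Qed.

Lemma multilin_ext_gsym F n i : hlin F ->
  (forall s1 s2 a b, size s1 = i -> (size s1 + size s2).+2 = n ->
     homogs (s1 ++ a :: b :: s2) ->
     F (s1 ++ a :: b :: s2) = parity (a.1 * b.1) *: F (s1 ++ b :: a :: s2)) ->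
  gsym_at n (multilin_ext F) i.
Proof.
move=> lF sF s1 s2 y z si sn hy hz.
elim: s1 i n F lF sF si sn => [|v s1 IH] i n F lF sF si sn; last first.
  rewrite /= scaler_sumr; apply: eq_bigr => j _.
  apply: (IH (size s1) n.-1); first exact: hlin_cons.
  - move=> t1 t2 a b st sn' hx; apply: (sF ((j, proj j v) :: t1)).
    + by rewrite /= st -si.
    + by rewrite /= addSn sn' -sn.
    move=> c; rewrite in_cons => /predU1P[->|/hx//]; exact: homog_proj.
  - by [].
  - by rewrite -sn.
rewrite /cat !(multilin_ext_hom _ lF) // !multilin_ext_hom //; try exact: hlin_cons.
rewrite -[RHS]addr0 -[in RHS](mext0 s2) -multilin_ext_comb; apply: eq_multilin_ext => x hx sx.
rewrite addr0; apply: (sF [::]) => //; first by rewrite sx.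
by move=> c; rewrite !in_cons => /predU1P[->//|/predU1P[->//|/hx//]].
Qed.

End MultilinearExtension.

(** * The classical limit of the obstruction *)

Section Together.
Variables (k : fieldType) (V : gradedLmodType k) (W : lmodType k).
Implicit Types (x u : seq (hvec V)) (a b : hvec V).

Definition together n (ps : seq (seq nat)) :=
  has (fun p => ((n - 2)%N \in p) && ((n - 1)%N \in p)) ps.

(** The two terms of [unsh_rcons]: either [a] joins the last block, or it stays with the other
    entries, and the sign carries it back across [y]. *)
Lemma psum_together u a b (G1 G2 : seq (seq (hvec V)) -> W) :
  let x := rcons (rcons u a) b in
  psum (posdeg x) (iota 0 (size x)) (fun ps => if together (size x) ps
      then G1 [seq subv x p | p <- ps] else G2 [seq subv x p | p <- ps])
  = unsh fst u (fun z y => parity (a.1 * dg fst y) *: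
      psum fst (rcons z a) (fun bs => G2 (rcons bs (rcons y b))))
    + unsh fst u (fun z y => psum fst z (fun bs => G1 (rcons bs (rcons (rcons y a) b)))).
Proof.
move=> x; pose m := size u; pose g := nth (0, 0) x : nat -> hvec V.
have sx : size x = m.+2 by rewrite !size_rcons.
have ga : g m = a by rewrite /g /x nth_rcons size_rcons leqnn nth_rcons ltnn eqxx.
have gb : g m.+1 = b by rewrite /g /x nth_rcons size_rcons ltnn eqxx.
have gu : map g (iota 0 m) = u.
  rewrite -[RHS](mkseq_nth (0, 0)) /mkseq; apply/eq_in_map => i.
  rewrite mem_iota /= add0n => im.
  by rewrite /g /x !nth_rcons size_rcons ltnS im (ltnW im).
have gd i : (g i).1 = posdeg x i by [].
have -> : iota 0 (size x) = rcons (rcons (iota 0 m) m) m.+1.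
  by rewrite sx -!cats1 -catA -[in RHS](iotaD 0 m 2) addn2.
rewrite psum_rcons unsh_rcons -{1 2}gu !(unsh_map (d := posdeg x)) //.
have lt_m i y z : perm_eq (z ++ y) (iota 0 m) -> i \in z ++ y -> (i < m)%N.
  by move=> zy; rewrite (perm_mem zy) mem_iota.
congr (_ + _); apply: eq_unsh => z y zy.
  rewrite -gd ga (dg_map (d := posdeg x)) //; congr (_ *: _).
  rewrite -ga -map_rcons (psum_map (d := posdeg x)) //; apply: eq_psum => ps psz ps0.
  rewrite ifN; first by rewrite map_rcons [subv x (rcons y _)](map_rcons g) gb.
  apply/hasP => -[p]; rewrite mem_rcons in_cons sx subn2 subn1 /=.
  move=> /predU1P[->|pps] /andP[pm pm1].
    move: pm; rewrite mem_rcons in_cons ltn_eqF //= => my.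
    by have := lt_m m y z zy; rewrite mem_cat my orbT ltnn => /(_ isT).
  have : m.+1 \in rcons z m by rewrite -(perm_mem psz); apply/flattenP; exists p.
  rewrite mem_rcons in_cons gtn_eqF //= => mz.
  by have := lt_m m.+1 y z zy; rewrite mem_cat mz ltnNge leqW // => /(_ isT).
rewrite (psum_map (d := posdeg x)) //; apply: eq_psum => ps psz ps0.
rewrite ifT.
  by rewrite map_rcons [subv x (rcons _ _)](map_rcons g) (map_rcons g) ga gb.
apply/hasP; exists (rcons (rcons y m) m.+1); first by rewrite mem_rcons mem_head.
by rewrite sx subn2 subn1 /= !mem_rcons !in_cons mem_rcons in_cons !eqxx !orbT.
Qed.

End Together.

(** * The three sums of M_n as terms of the classical obstruction *)

Section MainTerm.
Variables (k : fieldType) (A : binary_QFT_algebra k) (R : retract A).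
Hypothesis hA : anomaly_free R.
Let H : gradedLmodType k := classical_cohomology A.
Notation mcorr := (mcorr R).
Notation phi0 := (phi0 R).
Notation desc0_arg := (desc0_arg R).
Notation prim0 := (prim0 R).
Notation obstr0 := (obstr0 R).
Notation obstr0_prod := (obstr0_prod R).
Notation obstr0_phi := (obstr0_phi R).
Notation obstr0_ell := (obstr0_ell R).
Implicit Types (x y z u : seq (hvec H)) (bs : seq (seq (hvec H))) (a b : hvec H).

Definition phi_inv (n : nat) (vs : seq H) : A := multilin_ext (W := A) (fun x => - prim0 x) vs.

Lemma oppT0_hlin : hlin (fun x => - prim0 x).
Proof. by move=> s1 s2 e c u v; rewrite prim0_hlin // opprD scalerN. Qed.

Lemma rcons2P x : (1 < size x)%N -> exists u a b, x = rcons (rcons u a) b.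
Proof.
case: (lastP x) => // y b; case: (lastP y) => // u a _.
by exists u, a, b.
Qed.

Lemma phi_inv_S2Hom n : (2 <= n)%N -> S2Hom n (-1) (phi_inv n).
Proof.
move=> n2; split.
- exact: multilin_ext_multilinear oppT0_hlin.
- move=> x sx hx; rewrite /phi_inv (multilin_ext_vects oppT0_hlin hx); apply: homogN.
  have [|u [a [b E]]] := @rcons2P x; first by rewrite sx.
  move: hx; rewrite E => /homogs_rcons[/homogs_rcons[hu ha] hb].
  rewrite -[deg _]/(dg fst _) !dg_rcons; exact: homS_prim.
- move=> i i1 i2; apply: multilin_ext_gsym; first exact: oppT0_hlin.
  move=> s1 s2 a b si sn hx; rewrite prim0_sym ?scalerN //.
  by apply: contra_neq i2 => s21; rewrite -sn s21 si; lia.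
Qed.

Lemma hlin_Jv (W : lmodType k) (F : seq (hvec H) -> W) x : hlin F ->
  F (map (@Jv k H) x) = parity (dg fst x) *: F x.
Proof.
move=> lF; suff E r : F (r ++ map (@Jv k H) x) = parity (dg fst x) *: F (r ++ x).
  exact: (E [::]).
elim: x r => [|a x IH] r; first by rewrite dg_nil parity0 scale1r.
rewrite /= -[Jv a]/(a.1, parity a.1 *: a.2) -[_ *: a.2]addr0 lF hlin0 // addr0.
by rewrite -surjective_pairing -[in LHS]cat_rcons IH cat_rcons scalerA -parityD dg_cons.
Qed.

Lemma phi_classicalE y : phi_classical R (size y) y = phi0 y.
Proof. by []. Qed.

Lemma sum_parts_if (W : lmodType k) x (c : seq (seq nat) -> bool)
    (v : seq (seq nat) -> W) :
  \sum_(P in parts (size x) | c (blocks P)) epsilon x P *: v (blocks P) =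
  psum (posdeg x) (iota 0 (size x)) (fun ps => if c ps then v ps else 0).
Proof.
rewrite -sum_parts big_mkcondr; apply: eq_bigr => P _.
by case: ifP => _; rewrite ?scaler0.
Qed.

Lemma M_of_sum1 u a b : let x := rcons (rcons u a) b in
  \sum_(P in parts (size x) | (#|P| == 2%N) && ~~ last_two_together P)
    epsilon x P *: \prod_(p <- blocks P) phi_classical R (size p) (subv x p) = obstr0_prod a b u.
Proof.
move=> x.
transitivity (\sum_(P in parts (size x) |
      (size (blocks P) == 2%N) && ~~ together (size x) (blocks P))
    epsilon x P *: \prod_(p <- map (subv x) (blocks P)) phi0 p).
  apply: eq_big => P; first by rewrite size_blocks.
  move=> _; rewrite big_map; congr (_ *: _); apply: eq_bigr => p _.
  by rewrite -phi_classicalE size_subv.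
rewrite (sum_parts_if x (fun ps => (size ps == 2%N) && ~~ together (size x) ps)
  (fun ps => \prod_(p <- map (subv x) ps) phi0 p)).
have := psum_together u a b (fun _ => 0) (fun bs : seq (seq (hvec H)) =>
   if size bs == 2%N then \prod_(p <- bs) phi0 p else 0).
rewrite /= -/x => E.
rewrite -[RHS]addr0.
transitivity (psum (posdeg x) (iota 0 (size x)) (fun ps => if together (size x) ps
      then 0 else if size [seq subv x p | p <- ps] == 2%N then
      \prod_(p <- [seq subv x p | p <- ps]) phi0 p else 0)).
  by apply: eq_psum => ps _ _; rewrite size_map; case: (together _ _); case: (_ == _).
rewrite E; congr (_ + _); last first.
  by rewrite -[RHS](unsh0 fst A u); apply: eq_unsh => z y _; rewrite psum0.
apply: eq_unsh => z y _; congr (_ *: _).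
have z0 : rcons z a != [::] by case: z.
transitivity (\prod_(p <- rcons [:: rcons z a] (rcons y b)) phi0 p).
  rewrite -(psum_seq1 fst (fun bs => \prod_(p <- rcons bs (rcons y b)) phi0 p) z0).
  by apply: eq_psum => bs _ _; rewrite size_rcons eqSS.
by rewrite /= big_cons big_seq1.
Qed.

Lemma last_subv x ps : last [::] [seq subv x p | p <- ps] = subv x (last [::] ps).
Proof. exact: (last_map (subv x) ps [::]). Qed.

(** The size of the last block forces the other blocks to be singletons, so the sum over partitions
    is a sum over splits of [u]. *)
Lemma M_of_sum2 u a b : let x := rcons (rcons u a) b in
  \sum_(P in parts (size x) | [&& size (last [::] (blocks P)) == (size x - #|P| + 1)%N,
                             last_two_together P & #|P| != 1%N])
      (let bs := blocks P in
       let B := last [::] bs in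
       let xB := subv x B in
       epsilon x P *: phi_classical R #|P|
         (rcons (flatten [seq subv x p | p <- take #|P|.-1 bs])
                (deg xB, mprod R (size B) xB))) = obstr0_phi mcorr a b u.
Proof.
move=> x /=.
pose G bs : A := if (size (last [::] bs) == (size x - size bs + 1)%N) && (size bs != 1%N) then
  phi_classical R (size bs) (rcons (flatten (take (size bs).-1 bs))
    (deg (last [::] bs), mcorr (last [::] bs))) else 0.
transitivity (psum (posdeg x) (iota 0 (size x)) (fun ps => if together (size x) ps
      then G [seq subv x p | p <- ps] else 0)).
  rewrite -sum_parts big_mkcondr; apply: eq_bigr => P _.
  rewrite /G size_map size_blocks last_subv.
  rewrite size_subv /last_two_together /same_block -/(together _ _).
  case: (together _ _); rewrite ?andbF ?andFb ?andTb /= ?scaler0 //.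
  by case: ifP => _; rewrite ?scaler0 // /mcorr size_subv -map_take.
rewrite (psum_together u a b G (fun _ => 0)) -[RHS]add0r; congr (_ + _).
  rewrite -[RHS](unsh0 fst A u); apply: eq_unsh => z y _.
  by rewrite psum0 scaler0.
apply: eq_unsh => z y zy.
(* [z = [::]] is the one-block partition; its exclusion from M_n matches the terms left out of
   [obstr]. *)
transitivity (if z is [::] then 0 else
  phi0 (rcons (flatten [seq [:: c] | c <- z]) (deg3 a b y, mcorr (rcons (rcons y a) b)))); last first.
  by case: (z) => // c z'; congr (phi0 (rcons _ _)); elim: (c :: z') => //= c' w ->.
rewrite -(psum_singletons fst z (fun bs => if z is [::] then 0 else
  phi0 (rcons (flatten bs) (deg3 a b y, mcorr (rcons (rcons y a) b))))).
apply: eq_psum => bs bsz bs0; rewrite /G last_rcons !size_rcons.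
have [_ sb] := sum_predn bs0.
have -> : (((size y).+2 == (size u).+2 - (size bs).+1 + 1) = (size bs == size z))%N.
  rewrite -(perm_size zy) size_cat; move: sb; rewrite (perm_size bsz).
  have ar p q r : (p <= q -> (r.+2 == (q + r).+2 - p.+1 + 1) = (p == q))%N.
    by move=> pq; apply/eqP/eqP; lia.
  exact: ar.
have tk : take (size bs) (rcons bs (rcons (rcons y a) b)) = bs.
  by rewrite -cats1 take_size_cat.
case: eqP => //= bz; rewrite eqSS tk.
case: z zy bsz bz => [|c z] zy bsz bz; first by move: bz => ->.
rewrite bz /= -[(size z).+2]/(size (c :: z)).+1 -(perm_size bsz).
by rewrite -(size_rcons (flatten bs) (deg (rcons (rcons y a) b), mcorr (rcons (rcons y a) b)))
  phi_classicalE -[deg _]/(dg fst _) !dg_rcons.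
Qed.

(** The operators J on the blocks produce the sign [parity (dg fst y)] of [obstr0_ell], and phi^{-1}
    = - Theta^(0) the minus sign. *)
Lemma M_of_sum3 u a b : let x := rcons (rcons u a) b in homogs x ->
  \sum_(P in parts (size x) | last_two_together P && (#|P| != 1%N))
      (let bs := blocks P in
       let B := last [::] bs in
       epsilon x P *: bqa_ell A #|P| 0%N
         (rcons [seq phi_classical R (size p) (map (@Jv k H) (subv x p))
                 | p <- take #|P|.-1 bs]
                (phi_inv (size B) (vects (subv x B))))) = - obstr0_ell prim0 a b u.
Proof.
move=> x hx /=.
pose G bs : A := if (size bs != 1%N) then
  bqa_ell A (size bs) 0%N (rcons [seq phi0 (map (@Jv k H) p) | p <- take (size bs).-1 bs]
     (phi_inv 0 (vects (last [::] bs)))) else 0.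
transitivity (psum (posdeg x) (iota 0 (size x)) (fun ps => if together (size x) ps
      then G [seq subv x p | p <- ps] else 0)).
  rewrite -sum_parts big_mkcondr; apply: eq_bigr => P _.
  rewrite /G size_map size_blocks last_subv.
  rewrite /last_two_together /same_block -/(together _ _).
  case: (together _ _); rewrite ?andbF ?andFb ?andTb /= ?scaler0 //.
  case: ifP => _; rewrite ?scaler0 //; congr (_ *: bqa_ell _ _ _ (rcons _ _)).
  rewrite -map_take -map_comp; apply: eq_map => p /=.
  by rewrite -phi_classicalE size_map size_subv.
rewrite (psum_together u a b G (fun _ => 0)) -[RHS]add0r; congr (_ + _).
  rewrite -[RHS](unsh0 fst A u); apply: eq_unsh => z y _.
  by rewrite psum0 scaler0.
have [/homogs_rcons[hu ha] hb] := (homogs_rcons _ _).1 hx.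
rewrite -unshN; apply: eq_unsh => z y zy; have [hz hy] := homogs_split zy hu.
have hyab : homogs (rcons (rcons y a) b).
  by apply/homogs_rcons; split=> //; apply/homogs_rcons.
case: z zy hz => [|c z] zy hz; first by rewrite psum_nil /G /= oppr0.
rewrite -scalerN /desc0_arg -[X in _ *: X]scaleN1r !psumZ; apply: eq_psum => bs bsz bs0.
have tk : take (size bs) (rcons bs (rcons (rcons y a) b)) = bs.
  by rewrite -cats1 take_size_cat.
rewrite /G size_rcons eqSS last_rcons /= tk.
have bs1 : size bs != 0%N.
  by case: (bs) bsz => // /perm_size.
rewrite bs1 /phi_inv (multilin_ext_vects oppT0_hlin hyab).
have ellE (l : seq A) t : bqa_ell A (size l).+1 0%N (rcons l t) = ell0 (rcons l t).
  by rewrite -(size_rcons l t) /ell0 /ellS; case: (l).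
rewrite -{1}(size_map (fun p => phi0 (map (@Jv k H) p)) bs) ellE.
move: (prim0 _) => t0; rewrite -!cats1.
rewrite -scaleN1r (linfZ (mlin_slot0 _ [::] (@ell0_mlin k A))) scalerA mulrC -scalerA.
congr (_ *: _); rewrite -(dg_perm _ bsz).
suff E r : ell0 (r ++ [seq phi0 (map (@Jv k H) p) | p <- bs] ++ [:: t0]) =
    parity (dg fst (flatten bs)) *: ell0 (r ++ [seq phi0 p | p <- bs] ++ [:: t0]).
  exact: (E [::]).
elim: bs r {bsz bs0 tk bs1} => [|d bs IH] r.
  by rewrite dg_nil parity0 scale1r.
rewrite /= hlin_Jv; last exact: phi0_hlin.
rewrite (linfZ (mlin_slot0 r _ (@ell0_mlin k A))) -!(cat_rcons (phi0 d)) IH.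
by rewrite scalerA -parityD dg_cat.
Qed.

Lemma M_of_obstr0 u a b : let x := rcons (rcons u a) b in homogs x ->
  M_of R phi_inv (size x) x = obstr0 a b u.
Proof.
move=> x hx; rewrite /M_of M_of_sum1 -/x.
rewrite [X in _ - X + _]M_of_sum2 [X in _ + X]M_of_sum3 //.
Qed.

End MainTerm.

Theorem theorem1p3 (k : fieldType) (hk : [pchar k] =i pred0)
    (A : binary_QFT_algebra k) (R : retract A) (hA : anomaly_free R) :
  exists phi_inv : nat -> seq (classical_cohomology A) -> A,
    (forall n : nat, (2 <= n)%N -> S2Hom n (-1) (phi_inv n)) /\
    (forall (n : nat) (x : seq (hvec (classical_cohomology A))),
       (2 <= n)%N -> size x = n -> homogs x ->
       mprod R n x = rt_h R (M_of R phi_inv n x)).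
Proof.
exists (phi_inv R); split=> [|n x n2 sx hx]; first exact: phi_inv_S2Hom.
have [|u [a [b E]]] := @rcons2P _ A x; first by rewrite sx.
subst x; rewrite -sx (M_of_obstr0 hA hx).
move: hx => /homogs_rcons[/homogs_rcons[hu ha] hb].
(* At order 0 the class of the obstruction is [h] of its classical limit, which is M_n. *)
have [_ /(congr1 (fun c : ser _ => c 0%N))] := obstr_main hA hu ha hb.
by rewrite /class_part expr0 scale1r /= obstr_obstr0.
Qed.
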